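(* Let $M$ be a finitely generated graded $S$-module, and let $M=F/U$ be a presentation where $F$ is a finitely generated graded free $S$-module with homogeneous basis $e_1,\dots,e_m$ and $U\subset F$ is a graded submodule. Compute $\operatorname{gin}(U)$ with respect to the reverse lexicographic order, and find $s:=\operatorname{sdeg} F/\operatorname{gin}(U)$ as follows. Let $U_0=\operatorname{gin}(U)$, and $U_i=U_{i-1}:x_{n-i+1}^\infty$ for $i=1,\dots,n$; let $G_i$ be the unique minimal system of monomial generators of $U_i$, let $V_i$ be the $K[x_1,\dots,x_{n-i}]$-module generated by $G_i$ and $V_i^{sat}$ its saturation as a $K[x_1,\dots,x_{n-i}]$-module; then $s=\sum_{i=0}^nl(V_i^{sat}/V_i)$. With this $s$, $$\operatorname{sdeg} M=s.$$
   Context: $K$ is an infinite field, $S=K[x_1,\dots,x_n]$ is the polynomial ring with its standard grading, $\mathfrak m=(x_1,\dots,x_n)$. $l(\cdot)$ denotes length. A monomial of $F$ is an element $x^ue_j$ with $x^u$ a monomial of $S$; a monomial submodule is one generated by monomials. $U:x_i^\infty=\bigcup_{k\ge0}(U:_Fx_i^k)$. Write $S_{(i)}=K[x_1,\dots,x_{n-i}]$ and $F_{(i)}=\bigoplus_jS_{(i)}e_j\subset F$; the elements of $G_i$ lie in $F_{(i)}$, so $V_i\subset F_{(i)}$. The saturation is $V_i^{sat}=\{f\in F_{(i)}:(x_1,\dots,x_{n-i})^kf\subset V_i\text{ for some }k\ge1\}$ (for $i=n$ the ring is $K$, the ideal is $0$, and $V_n^{sat}=\bigoplus_jKe_j$).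 Generic initial module: the (degree) reverse lexicographic order on $F$ is: $x^ue_s<x^ve_t$ if either $\deg x^ue_s<\deg x^ve_t$; or $\deg x^ue_s=\deg x^ve_t$ and $x^u<x^v$ in the usual reverse lexicographic term order on $S$; or $\deg x^ue_s=\deg x^ve_t$, $x^u=x^v$ and $s>t$. Let $\mathcal G=\operatorname{GL}(n)\ltimes\operatorname{GL}(F)$, where $\operatorname{GL}(n)$ is regarded as the group of $K$-linear graded automorphisms of $S$ and $\operatorname{GL}(F)$ is the group of $S$-linear graded automorphisms of $F$; it acts on $F$ through $K$-linear graded automorphisms. There are a non-empty open set $\mathcal U\subset\mathcal G$ and a unique monomial submodule of $F$, denoted $\operatorname{gin}(U)$, which equals the initial module of $g(U)$ with respect to this order for every $g\in\mathcal U$. Smallest extended degree: $\operatorname{sdeg}$ is the unique numerical function on finitely generated graded $S$-modules (existence and uniqueness are due to Gunston) such that: (1) $\operatorname{sdeg} M=\operatorname{sdeg}(M/L)+l(L)$ for $L=H^0_{\mathfrak m}(M)$; (2) $\operatorname{sdeg} M=\operatorname{sdeg} M/yM$ whenever $y\in S_1$ is sufficiently general and $M$-regular (a non-zero-divisor on $M$); (3) $\operatorname{sdeg}(0)=0$.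
   Formalization: For monomials of equal degree in F, x^u<x^v means the last nonzero entry of u-v is positive, without first comparing deg x^u and deg x^v; with the usual degree-first term order the claim fails, e.g. n=1, deg e_1=0, deg e_2=1, U=S(x e_1+e_2), where sdeg M=1 but s=2. *)

(* Defs.v *)
From HB Require Import structures.
From mathcomp Require Import all_boot all_order all_algebra.
From mathcomp.multinomials Require Import mpoly.

Set Implicit Arguments.
Unset Strict Implicit.
Unset Printing Implicit Defensive.

Import GRing.Theory.
Local Open Scope ring_scope.

Definition infinite_field (K : fieldType) : Prop :=
  forall s : seq K, exists x, x \notin s.

Section Submodules.
Variables (R : nzRingType) (M : lmodType R).
Implicit Types (A : R -> Prop) (X Y N : M -> Prop).

Definition full (T : Type) : T -> Prop := fun=> True.

(* In this section [A] is (the underlying set of) a subring of [R], and [M] is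
   regarded as an [A]-module. *)
Definition submodule A N : Prop :=
  [/\ N 0, forall x y, N x -> N y -> N (x + y)
    & forall a x, A a -> N x -> N (a *: x)].

Definition span A X : M -> Prop := fun x =>
  exists s : seq (R * M),
    (forall c, c \in s -> A c.1 /\ X c.2) /\ x = \sum_(c <- s) c.1 *: c.2.

(* A strictly increasing chain X = C_0 < C_1 < ... < C_l = Y of
   [A]-submodules, i.e. a chain of length [l] in the quotient Y / X. *)
Definition submod_chain A X Y (C : nat -> M -> Prop) (l : nat) : Prop :=
  [/\ forall x, C 0%N x <-> X x, forall x, C l x <-> Y x,
      forall i, (i <= l)%N -> submodule A (C i)
    & forall i, (i < l)%N ->
        (forall x, C i x -> C i.+1 x) /\ exists x, C i.+1 x /\ ~ C i x].

(* The [A]-module Y / X has finite length, equal to [l]. *)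
Definition length_is A X Y (l : nat) : Prop :=
  (exists C, submod_chain A X Y C l) /\
  (forall C l', submod_chain A X Y C l' -> (l' <= l)%N).

End Submodules.
Arguments full {T} _ /.

Section IdealPowers.
Variable R : nzRingType.

(* The powers of the ideal [I] of the subring [A] of [R]. *)
Fixpoint ideal_pow (A I : R -> Prop) (k : nat) : R -> Prop :=
  if k is k'.+1 then
    span (M := R^o) A
      (fun z => exists a b, [/\ I a, ideal_pow A I k' b & z = a * b])
  else A.

(* The saturation of [X] inside [Y] with respect to the ideal [I] of [A]. *)
Definition saturation (M : lmodType R) (A I : R -> Prop) (X Y : M -> Prop) :
    M -> Prop :=
  fun f => Y f /\
    exists2 k, (1 <= k)%N & forall p, ideal_pow A I k p -> X (p *: f).

End IdealPowers.

Section Subpolynomials.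
Variables (K : fieldType) (n : nat).

(* Variables are numbered from 0: 'X_j stands for x_(j+1). *)

(* The subring K[x_1,...,x_r] of K[x_1,...,x_n], for r <= n. *)
Definition subpoly (r : nat) (p : {mpoly K[n]}) : Prop :=
  forall u, u \in msupp p -> forall j : 'I_n, (r <= j)%N -> u j = 0%N.

(* The ideal (x_1,...,x_r) of K[x_1,...,x_r]. *)
Definition varideal (r : nat) : {mpoly K[n]} -> Prop :=
  span (M := {mpoly K[n]}^o) (subpoly r)
    (fun p => exists2 j : 'I_n, (j < r)%N & p = 'X_j).

End Subpolynomials.
Arguments subpoly {K n} r p.
Arguments varideal {K n} r _.

(* A set of points X is given with "coordinates" c i : X -> K; the coordinates
   may be indexed by an infinite type, but a polynomial function involves only
   finitely many of them. *)
Section Zariski.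
Variables (K : fieldType) (X I : Type) (c : I -> X -> K).

Definition polynomial_function (h : X -> K) : Prop :=
  exists (N : nat) (idx : 'I_N -> I) (q : {mpoly K[N]}),
    forall x, h x = q.@[fun l => c (idx l) x].

Definition zariski_open (O : X -> Prop) : Prop :=
  exists Q : (X -> K) -> Prop,
    (forall h, Q h -> polynomial_function h) /\
    (forall x, O x <-> exists2 h, Q h & h x != 0).

Definition nonempty_open (O : X -> Prop) : Prop :=
  zariski_open O /\ exists x, O x.

End Zariski.

(* Finitely generated (Z-)graded modules over K[x_1,...,x_n]; [ghom k] is the
   homogeneous component of degree [k]. *)
Record gmodule (K : fieldType) (n : nat) := GModule {
  gcarrier :> lmodType {mpoly K[n]};
  ghom : int -> gcarrier -> Prop;
  ghom0 : forall k, ghom k 0;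
  ghomD : forall k x y, ghom k x -> ghom k y -> ghom k (x + y);
  ghomZ : forall (i : nat) k p x,
    p \is i.-homog -> ghom k x -> ghom (i%:Z + k) (p *: x);
  ghom_sum : forall x, exists (s : seq int) (c : int -> gcarrier),
    (forall k, ghom k (c k)) /\ x = \sum_(k <- s) c k;
  ghom_direct : forall (s : seq int) (c : int -> gcarrier),
    uniq s -> (forall k, ghom k (c k)) -> \sum_(k <- s) c k = 0 ->
    forall k, k \in s -> c k = 0;
  gfingen : exists s : seq gcarrier,
    forall x, span full (fun y => y \in s) x
}.

Section GradedModules.
Variables (K : fieldType) (n : nat).
Local Notation S := {mpoly K[n]}.
Implicit Types (M N : gmodule K n).

Definition graded_submodule M (U : M -> Prop) : Prop :=
  submodule full U /\
  forall x, U x -> exists (s : seq int) (c : int -> M),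
    (forall k, ghom k (c k) /\ U (c k)) /\ x = \sum_(k <- s) c k.

(* N = M / U as graded modules, up to graded isomorphism. *)
Definition is_quotient M (U : M -> Prop) N : Prop :=
  exists phi : {linear M -> N},
    [/\ forall y, exists x, phi x = y,
        forall k x, ghom k x -> ghom k (phi x)
      & forall x, U x <-> phi x = 0].

Definition regular_element M (y : S) : Prop :=
  forall x : M, y *: x = 0 -> x = 0.

(* H^0_m(M), the elements annihilated by a power of m = (x_1,...,x_n). *)
Definition local_cohomology0 M : M -> Prop :=
  saturation full (varideal n) (fun x : M => x = 0) full.

(* S_1 is the space {y : S | y \is 1.-homog}; its coordinates are the
   coefficients of the variables. *)
Definition linform_coord (i : 'I_n) (y : {y : S | y \is 1.-homog}) : K :=
  (val y)@_U_(i).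

(* The properties characterizing the smallest extended degree. *)
Definition smallest_extended_degree (sdeg : gmodule K n -> nat) : Prop :=
  [/\ forall M N l,
        is_quotient (local_cohomology0 (M := M)) N ->
        length_is full (fun x : M => x = 0) (local_cohomology0 (M := M)) l ->
        sdeg M = (sdeg N + l)%N,
      forall M, exists2 O, nonempty_open linform_coord O &
        forall y, O y -> regular_element M (val y) ->
        forall N, is_quotient (fun x : M => exists z, x = val y *: z) N ->
        sdeg M = sdeg N
    & forall M, (forall x : M, x = 0) -> sdeg M = 0%N].

End GradedModules.

Section FreeModule.
Variables (K : fieldType) (n m : nat) (d : 'I_m -> int).
Local Notation S := {mpoly K[n]}.
Local Notation F := 'rV[S]_m.

(* f = \sum_j f_j e_j is homogeneous of degree k when deg e_j = d j. *)
Definition free_hom (k : int) (f : F) : Prop :=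
  forall j u, u \in msupp (f 0 j) -> (mdeg u)%:Z + d j = k.

Lemma free_hom0 k : free_hom k 0.
Proof. by move=> j u; rewrite mxE msupp0. Qed.

Lemma free_homD k f g : free_hom k f -> free_hom k g -> free_hom k (f + g).
Proof.
move=> hf hg j u; rewrite mxE => /msuppD_le; rewrite mem_cat.
by case/orP; [apply: hf | apply: hg].
Qed.

Lemma free_homZ (i : nat) k (p : S) f :
  p \is i.-homog -> free_hom k f -> free_hom (i%:Z + k) (p *: f).
Proof.
move=> /dhomogP hp hf j u; rewrite mxE => /msuppM_le /allpairsP [[a b] /=].
case=> /hp /= da /hf <- ->; rewrite mdegD da addrA; congr (_ + _).
Qed.

Definition free_part (f : F) (k : int) : F :=
  \row_j \sum_(u <- msupp (f 0 j) | (mdeg u)%:Z + d j == k)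
    (f 0 j)@_u *: 'X_[u].

Lemma free_part_coef f k j u :
  (free_part f k 0 j)@_u =
  if (mdeg u)%:Z + d j == k then (f 0 j)@_u else 0.
Proof.
rewrite mxE linear_sum /=.
under eq_bigr do rewrite mcoeffZ mcoeffX.
case: (boolP (u \in msupp (f 0 j))) => hu; last first.
  rewrite (memN_msupp_eq0 hu) if_same big_seq_cond big1 // => v /andP [hv _].
  by case: eqP => [E | _]; [rewrite -E hv in hu | rewrite mulr0].
rewrite big_mkcond (bigD1_seq u) //= big1 => [|v ne].
  by rewrite eqxx mulr1 addr0.
by rewrite (negPf ne) mulr0 if_same.
Qed.

Lemma free_hom_sum f : exists (s : seq int) (c : int -> F),
  (forall k, free_hom k (c k)) /\ f = \sum_(k <- s) c k.
Proof.
pose s := undup (flatten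
  [seq [seq (mdeg u)%:Z + d j | u <- msupp (f 0 j)] | j <- enum 'I_m]).
exists s, (free_part f); split=> [k j u|].
  by rewrite mcoeff_msupp free_part_coef; case: ifP => [/eqP | _ /eqP].
apply/rowP=> j; rewrite summxE; apply/mpolyP=> u; rewrite linear_sum /=.
under eq_bigr do rewrite free_part_coef.
case: (boolP (u \in msupp (f 0 j))) => hu; last first.
  by rewrite (memN_msupp_eq0 hu) big1 // => k _; rewrite if_same.
rewrite (bigD1_seq ((mdeg u)%:Z + d j)) /= ?undup_uniq //; last first.
  rewrite mem_undup; apply/flattenP.
  exists [seq (mdeg v)%:Z + d j | v <- msupp (f 0 j)]; last exact: map_f.
  by apply: (map_f (fun j => [seq (mdeg v)%:Z + d j | v <- msupp (f 0 j)]));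
    rewrite mem_enum.
by rewrite eqxx big1 ?addr0 // => k ne; rewrite eq_sym (negPf ne).
Qed.

Lemma free_hom_direct (s : seq int) (c : int -> F) :
  uniq s -> (forall k, free_hom k (c k)) -> \sum_(k <- s) c k = 0 ->
  forall k, k \in s -> c k = 0.
Proof.
move=> us hc sum0 k ks; apply/rowP=> j; apply/mpolyP=> u.
rewrite mxE mcoeff0; case: (eqVneq ((mdeg u)%:Z + d j) k) => [E|ne]; last first.
  by apply: memN_msupp_eq0; apply/negP=> /(hc k) E; rewrite E eqxx in ne.
have := congr1 (fun f : F => (f 0 j)@_u) sum0.
rewrite /= summxE linear_sum /= mxE mcoeff0 (bigD1_seq k) //= big1 ?addr0 //.
move=> l ne; apply: memN_msupp_eq0; apply/negP=> /(hc l) E'.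
by rewrite -E' E eqxx in ne.
Qed.

Lemma free_fingen : exists s : seq F,
  forall x, span full (fun y => y \in s) x.
Proof.
exists [seq delta_mx 0 j | j <- enum 'I_m] => f.
exists [seq (f 0 j, delta_mx 0 j) | j <- enum 'I_m]; split.
  move=> c /mapP [j _ ->] /=; split=> //.
  by apply: (map_f (fun j => delta_mx 0 j)); rewrite mem_enum.
by rewrite big_map big_enum /= {1}[f]row_sum_delta.
Qed.

(* The graded free module with basis e_j, deg e_j = d j. *)
Definition gfree : gmodule K n :=
  GModule free_hom0 free_homD free_homZ free_hom_sum free_hom_direct
    free_fingen.

(* The monomial x^u e_j of F is represented by the pair (u, j). *)
Definition fmonomial : Type := ('X_{1..n} * 'I_m)%type.

Definition fmon (t : fmonomial) : F := 'X_[t.1] *: delta_mx 0 t.2.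

Definition fcoef (f : F) (t : fmonomial) : K := (f 0 t.2)@_t.1.

Definition fdeg (t : fmonomial) : int := (mdeg t.1)%:Z + d t.2.

Definition fmon_set (G : fmonomial -> Prop) : F -> Prop :=
  fun f => exists2 t, G t & f = fmon t.

Definition generated_by_monomials (G : fmonomial -> Prop) (U : F -> Prop) :
    Prop :=
  forall f, U f <-> span full (fmon_set G) f.

Definition monomial_submodule (U : F -> Prop) : Prop :=
  exists G, generated_by_monomials G U.

Definition minimal_monomial_generators (G : fmonomial -> Prop) (U : F -> Prop) :
    Prop :=
  generated_by_monomials G U /\
  forall G', (forall t, G' t -> G t) -> generated_by_monomials G' U ->
    forall t, G t -> G' t.

(* x^u < x^v iff the last nonzero entry of u - v is positive.  When the basis
   elements have different degrees, u and v of different total degrees do get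
   compared below; total degrees play no role there, so that, among the
   monomials of F of a given degree, those divisible by x_n come last. *)
Definition revlex_lt (u v : 'X_{1..n}) : Prop :=
  exists j : 'I_n, (v j < u j)%N /\ forall k : 'I_n, (j < k)%N -> u k = v k.

Definition fmon_lt (t1 t2 : fmonomial) : Prop :=
  [\/ (fdeg t1 < fdeg t2)%R,
      fdeg t1 = fdeg t2 /\ revlex_lt t1.1 t2.1
    | [/\ fdeg t1 = fdeg t2, t1.1 = t2.1 & (t2.2 < t1.2)%N]].

Definition is_initial_monomial (f : F) (t : fmonomial) : Prop :=
  fcoef f t != 0 /\
  forall t', fcoef f t' != 0 -> t' <> t -> fmon_lt t' t.

Definition initial_module (U : F -> Prop) : F -> Prop :=
  span full
    (fmon_set (fun t => exists2 f, U f & is_initial_monomial f t)).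

(* Elements of GL(n) |x GL(F): [gvar] gives x_i |-> \sum_j (gvar i j) x_j and
   [gbas] gives e_i |-> \sum_j (gbas i j) e_j. *)
Record gaut := GAut {
  gvar : 'M[K]_n;
  gbas : 'M[S]_m;
  gvar_unit : gvar \in unitmx;
  gbas_unit : gbas \in unitmx;
  gbas_hom : forall i, free_hom (d i) (row i gbas)
}.

Definition var_subst (g : gaut) (p : S) : S :=
  p \mPo [tuple \sum_j gvar g i j *: 'X_j | i < n].

Definition gaut_act (g : gaut) (f : F) : F :=
  map_mx (var_subst g) f *m gbas g.

(* Since the entries of [gbas] are homogeneous of fixed degrees, only finitely
   many of these coordinates are not identically zero. *)
Definition gaut_coord (i : ('I_n * 'I_n) + ('I_m * 'I_m * 'X_{1..n})) (g : gaut) :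
    K :=
  match i with
  | inl (a, b) => gvar g a b
  | inr (a, b, u) => (gbas g a b)@_u
  end.

(* W is the generic initial module gin(U). *)
Definition is_gin (U W : F -> Prop) : Prop :=
  monomial_submodule W /\
  exists2 O, nonempty_open gaut_coord O &
    forall g, O g -> forall f,
      W f <-> initial_module (fun y => exists2 x, U x & y = gaut_act g x) f.

(* U_0 = W and U_i = U_(i-1) : x_(n-i+1)^oo for 1 <= i <= n. *)
Fixpoint colon_seq (W : F -> Prop) (i : nat) : F -> Prop :=
  if i is i'.+1 then fun f =>
    exists2 j : 'I_n, (j + i'.+1)%N = n &
      exists k, colon_seq W i' ('X_j ^+ k *: f)
  else W.

(* The submodule F_(i) of F, for r = n - i. *)
Definition subfree (r : nat) (f : F) : Prop := forall j, subpoly r (f 0 j).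

(* V_i and its saturation, for r = n - i and G = G_i. *)
Definition restricted_span (r : nat) (G : fmonomial -> Prop) : F -> Prop :=
  span (subpoly r) (fmon_set G).

Definition restricted_sat (r : nat) (G : fmonomial -> Prop) : F -> Prop :=
  saturation (subpoly r) (varideal r) (restricted_span r G) (subfree r).

End FreeModule.
Arguments restricted_span K {n m} r G _.
Arguments restricted_sat K {n m} r G _.

(* Main.v *)
From HB Require Import structures.
Require Import Defs.
From mathcomp Require Import all_boot all_order all_algebra.
From mathcomp.multinomials Require Import mpoly.
From mathcomp Require Import zify ring.
From Stdlib Require Import Classical ClassicalEpsilon.
From Stdlib Require Import FunctionalExtensionality PropExtensionality.

(* Everything takes place in F. Cutting F/U successively by general linear forms
   y_n, ..., y_1 and dividing out H^0_m before each cut gives submodules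
   T_0 = U, T_(i+1) = T_i^sat + y_(n-i) F, and the axioms of sdeg turn sdeg F/U
   into the sum of the lengths of T_i^sat / T_i. The forms are chosen one after
   the other, changing one row of the inverse of a coordinate change g at a time,
   so that y_(n-i) is regular on F/T_i^sat, lies in the open set given by the
   axiom, and g stays in the open set defining gin(U). In the coordinates of g
   the forms are x_n, ..., x_1, and by the properties of the reverse
   lexicographic order the initial modules of T_i and T_i^sat depend only on
   gin(U) = W; that of T_i is generated by W_i and the last i variables. Since
   T_i^sat / T_i has finite length, W_i : x_(n-i)^oo is also the saturation of
   the module generated by G_i over the first n-i variables, so all lengths are
   those of the algorithm.

   For F/W itself the same chain is used with general y_(n-i): a substitution
   fixing the first n-i variables transports it to W_i and the last i variables.

   Regular forms come from a pigeonhole argument instead of associated primes: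
   kernels of the members of a pencil y + t z are independent, like eigenspaces,
   so by noetherianity almost all of them vanish. *)

Set Implicit Arguments.
Unset Strict Implicit.
Unset Printing Implicit Defensive.

Import Order.TTheory GRing.Theory Num.Theory.

(** The axioms of sdeg concern S-linear maps, while a coordinate change g is only semilinear, so
    they do not compare F/U with F/g(U). Hence sdeg is never carried across g: initial monomials are
    defined for an abstract coefficient function, and letting the coefficients of g(f) serve as
    those of f reads off the initial monomials of g(T) inside T itself. The open set in the second
    axiom depends on the module being cut, and this module on the forms chosen before, so one
    generic element fixed in advance would not do. Each choice is made on a line, where every open
    condition excludes finitely many parameters; this is where K has to be infinite. Applying the
    argument for U to W as well would require that W be its own generic initial module. Using
    instead that W is monomial avoids this question. *)

(** * Coefficients and monomials of the free module *)

Section Monomials.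
Local Open Scope ring_scope.
Variables (K : fieldType) (n m : nat).
Local Notation S := {mpoly K[n]}.
Local Notation F := 'rV[S]_m.
Local Notation mon := (fmonomial n m).
Implicit Types (f g : F) (t : mon) (u v : 'X_{1..n}).

Lemma fcoefD f g t : fcoef (f + g) t = fcoef f t + fcoef g t.
Proof. by rewrite /fcoef mxE mcoeffD. Qed.

Lemma fcoefN f t : fcoef (- f) t = - fcoef f t.
Proof. by rewrite /fcoef mxE mcoeffN. Qed.

Lemma fcoefB f g t : fcoef (f - g) t = fcoef f t - fcoef g t.
Proof. by rewrite fcoefD fcoefN. Qed.

Lemma fcoef0 t : fcoef (0 : F) t = 0.
Proof. by rewrite /fcoef mxE mcoeff0. Qed.

Lemma fcoefC c f t : fcoef (c%:MP *: f) t = c * fcoef f t.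
Proof. by rewrite /fcoef mxE mcoeffCM. Qed.

Lemma fcoef_sum I (r : seq I) (P : pred I) (G : I -> F) t :
  fcoef (\sum_(i <- r | P i) G i) t = \sum_(i <- r | P i) fcoef (G i) t.
Proof.
by apply: (big_morph (fun f => fcoef f t)) => [f g|];
  rewrite ?fcoefD ?fcoef0.
Qed.

Lemma fcoef_inj f g : fcoef f =1 fcoef g -> f = g.
Proof.
by move=> E; apply/rowP=> j; apply/mpolyP=> u; apply: (E (u, j)).
Qed.

Definition tmul u t : mon := ((u + t.1)%MM, t.2).

Lemma tmul0 t : tmul 0%MM t = t.
Proof. by case: t => u j; rewrite /tmul add0m. Qed.

Lemma tmulA u v t : tmul u (tmul v t) = tmul (u + v)%MM t.
Proof. by rewrite /tmul addmA. Qed.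

Lemma tmul_inj u : injective (tmul u).
Proof.
case=> v j [w k] E; have /addmI /= -> := congr1 fst E.
by have /= -> := congr1 snd E.
Qed.

Lemma fcoefX u f t : fcoef ('X_[u] *: f) (tmul u t) = fcoef f t.
Proof. by rewrite /fcoef mxE /= mulrC mcoeffMX. Qed.

Lemma fcoefX_neq0 u f t :
  fcoef ('X_[u] *: f) t != 0 -> exists2 t', t = tmul u t' & fcoef f t' != 0.
Proof.
move=> h; have: t.1 \in msupp ('X_[u] * f 0 t.2).
  by rewrite mcoeff_msupp; move: h; rewrite /fcoef mxE.
rewrite mulrC => /msuppM_le /allpairsP [[a b] /= [ha]].
rewrite msuppX inE => /eqP -> E.
have Et : t = tmul u (a, t.2) by rewrite /tmul /= addmC -E; case: (t).
by exists (a, t.2) => //; rewrite Et fcoefX in h.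
Qed.

Lemma fcoef_mon t t' : fcoef (fmon K t) t' = (t == t')%:R.
Proof.
rewrite /fcoef /fmon !mxE eqxx /= eq_sym.
case: t t' => u j [v k] /=; rewrite xpair_eqE.
by case: eqP => _; rewrite ?mulr1 ?mulr0 ?mcoeff0 ?andbF // mcoeffX andbT.
Qed.

Lemma fmonX u t : 'X_[u] *: fmon K t = fmon K (tmul u t).
Proof. by rewrite /fmon scalerA -mpolyXD. Qed.

Definition fsupp f : seq mon :=
  [seq (u, j) | j <- enum 'I_m, u <- msupp (f 0 j)].

Lemma mem_fsupp f t : (t \in fsupp f) = (fcoef f t != 0).
Proof.
rewrite -mcoeff_msupp; apply/allpairsPdep/idP.
  by case=> j [u [_ h ->]].
by case: t => u j /= h; exists j, u; rewrite mem_enum.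
Qed.

Lemma fsupp_uniq f : uniq (fsupp f).
Proof.
apply: allpairs_uniq_dep => [|j _|]; rewrite ?enum_uniq ?msupp_uniq //.
by case=> j u [k v] _ _ /= [-> ->].
Qed.

Lemma fexpand f : f = \sum_(t <- fsupp f) (fcoef f t)%:MP *: fmon K t.
Proof.
apply: fcoef_inj => t; rewrite fcoef_sum.
under eq_bigr do rewrite fcoefC fcoef_mon.
case: (boolP (t \in fsupp f)) => ht.
  rewrite (bigD1_seq t) ?fsupp_uniq //= eqxx mulr1 big1 ?addr0 // => t' ne.
  by rewrite (negPf ne) mulr0.
rewrite big_seq big1 => [|t' ht'].
  by move: ht; rewrite mem_fsupp negbK => /eqP.
by case: eqP => [E|_]; [rewrite -E ht' in ht | rewrite mulr0].
Qed.

(** Linearity over K, acting through constant polynomials, is all that initial monomials need; it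
    holds for submodules over every subring K[x_1,...,x_r]. *)
Definition subspace (X : F -> Prop) : Prop :=
  [/\ X 0, forall f g, X f -> X g -> X (f + g)
    & forall c f, X f -> X (c%:MP *: f)].

Lemma subpolyC r c : subpoly r (c%:MP : S).
Proof.
move=> u; rewrite msuppC; case: ifP => _; rewrite ?in_nil ?inE // => /eqP -> j _.
exact: mnm0E.
Qed.

Lemma submod_subspace (A : S -> Prop) (X : F -> Prop) :
  (forall c, A c%:MP) -> submodule A X -> subspace X.
Proof. by move=> hA [X0 XD XZ]; split=> // c f; apply: XZ. Qed.

Lemma subspace_full (X : F -> Prop) : submodule full X -> subspace X.
Proof. exact: submod_subspace. Qed.

Lemma subspaceN X f : subspace X -> X f -> X (- f).
Proof.
case=> _ _ XZ Xf; have -> : - f = (-1)%:MP *: f; last exact: XZ.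
by rewrite mpolyCN scaleNr mpolyC1 scale1r.
Qed.

Lemma subspaceB X f g : subspace X -> X f -> X g -> X (f - g).
Proof. by move=> hX Xf Xg; case: (hX) => _ XD _; apply: XD => //; apply: subspaceN. Qed.

Lemma subspace_sum X I (r : seq I) (G : I -> F) :
  subspace X -> (forall i, X (G i)) -> X (\sum_(i <- r) G i).
Proof. by case=> X0 XD _ h; elim/big_rec: _ => // i f _; apply: XD. Qed.

Lemma subspace_sum_seq X (I : eqType) (r : seq I) (G : I -> F) :
  subspace X -> (forall i, i \in r -> X (G i)) -> X (\sum_(i <- r) G i).
Proof.
case=> X0 XD _; elim: r => [|i r IH] h; first by rewrite big_nil.
rewrite big_cons; apply: XD; first by apply: h; rewrite inE eqxx.
by apply: IH => j hj; apply: h; rewrite inE hj orbT.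
Qed.

End Monomials.

(** * The reverse lexicographic order and its embedding into the natural numbers *)

Section Order.
Local Open Scope ring_scope.
Variables (n m : nat) (d : 'I_m -> int).
Local Notation mon := (fmonomial n m).
Implicit Types (t : mon) (u v : 'X_{1..n}).

Definition revlexb u v : bool :=
  [exists j : 'I_n, (v j < u j)%N && [forall k : 'I_n, (j < k)%N ==> (u k == v k)]].

Lemma revlexP u v : reflect (revlex_lt u v) (revlexb u v).
Proof.
apply: (iffP existsP) => [[j /andP [h /forallP hk]]|[j [h hk]]]; exists j.
  by split=> // k jk; apply/eqP; move: (hk k); rewrite jk.
by rewrite h; apply/forallP=> k; apply/implyP=> /hk ->.
Qed.

Lemma revlex_irr u : ~ revlex_lt u u.
Proof. by case=> j []; rewrite ltnn. Qed.

Lemma revlex_trans u v w : revlex_lt u v -> revlex_lt v w -> revlex_lt u w.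
Proof.
move=> [j [h1 h2]] [k [h3 h4]]; case: (ltngtP j k) => jk.
- exists k; rewrite h2 //; split=> // l kl; rewrite h2 ?h4 //.
  exact: ltn_trans kl.
- exists j; rewrite -h4 //; split=> // l jl; rewrite h2 ?h4 //.
  exact: ltn_trans jl.
- have E : j = k by apply: val_inj.
  exists j; rewrite -{}E in h3 h4; split; first exact: ltn_trans h3 h1.
  by move=> l jl; rewrite h2 ?h4.
Qed.

Lemma revlex_total u v : u <> v -> revlex_lt u v \/ revlex_lt v u.
Proof.
move=> ne; have [j0 hj0] : exists j, u j != v j.
  apply/existsP; rewrite -negb_forall; apply/negP => /forallP h.
  by apply: ne; apply/mnmP=> j; apply/eqP.
have [j hj hmax] := @arg_maxnP _ j0 (fun j => u j != v j) val hj0.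
have hk (k : 'I_n) : (j < k)%N -> u k = v k.
  move=> jk; apply/eqP; apply: contraLR jk => /hmax; by rewrite -leqNgt.
case: (ltngtP (u j) (v j)) hj => // h _; [right|left]; exists j; split=> // k jk.
  by rewrite hk.
Qed.

Lemma revlex_add w u v : revlex_lt u v -> revlex_lt (w + u)%MM (w + v)%MM.
Proof.
move=> [j [h hk]]; exists j; rewrite !mnmDE ltn_add2l; split=> // k jk.
by rewrite !mnmDE hk.
Qed.

Definition fltb t1 t2 : bool :=
  (fdeg d t1 < fdeg d t2) || ((fdeg d t1 == fdeg d t2) &&
    (revlexb t1.1 t2.1 || ((t1.1 == t2.1) && (t2.2 < t1.2)%N))).

Lemma fltP t1 t2 : reflect (fmon_lt d t1 t2) (fltb t1 t2).
Proof.
apply: (iffP orP) => [[h|]|].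
- by apply: Or31.
- case/andP=> /eqP h /orP [/revlexP h'|/andP [/eqP h' h'']].
    by apply: Or32.
  by apply: Or33.
- case=> [h|[h /revlexP h']|[h h' h'']]; [by left|right|right].
    by rewrite h eqxx h'.
  by rewrite h h' h'' !eqxx orbT.
Qed.

Lemma flt_irr t : ~ fmon_lt d t t.
Proof. by case=> [|[_ /revlex_irr]|[_ _]] //; rewrite ?ltxx ?ltnn. Qed.

Lemma flt_trans t1 t2 t3 :
  fmon_lt d t1 t2 -> fmon_lt d t2 t3 -> fmon_lt d t1 t3.
Proof.
case=> [h|[e h]|[e e' h]] [h'|[f h']|[f f' h']].
- by apply: Or31; apply: lt_trans h'.
- by apply: Or31; rewrite -f.
- by apply: Or31; rewrite -f.
- by apply: Or31; rewrite e.
- by apply: Or32; split; [rewrite e | apply: revlex_trans h'].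
- by apply: Or32; split; [rewrite e | rewrite -f'].
- by apply: Or31; rewrite e.
- by apply: Or32; split; [rewrite e | rewrite e'].
- by apply: Or33; split; [rewrite e | rewrite e' | apply: ltn_trans h].
Qed.

Lemma flt_total t1 t2 : t1 <> t2 -> fmon_lt d t1 t2 \/ fmon_lt d t2 t1.
Proof.
move=> ne; case: (ltgtP (fdeg d t1) (fdeg d t2)) => h.
- by left; apply: Or31.
- by right; apply: Or31.
case: (eqVneq t1.1 t2.1) => [e|/eqP/revlex_total [e|e]].
- case: (ltngtP t1.2 t2.2) => e'.
  + by right; apply: Or33.
  + by left; apply: Or33.
  + case: ne; case: (t1) (t2) e e' => u j [v k] /= -> E; congr pair.
    exact: val_inj.
- by left; apply: Or32.
- by right; apply: Or32.
Qed.

Lemma fdeg_tmul u t : fdeg d (tmul u t) = (mdeg u)%:Z + fdeg d t.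
Proof. by rewrite /fdeg /tmul /= mdegD PoszD addrA. Qed.

Lemma flt_tmul u t1 t2 :
  fmon_lt d t1 t2 -> fmon_lt d (tmul u t1) (tmul u t2).
Proof.
case=> [h|[e h]|[e e' h]].
- by apply: Or31; rewrite !fdeg_tmul ltrD2l.
- by apply: Or32; rewrite !fdeg_tmul e; split=> //; apply: revlex_add.
- by apply: Or33; rewrite !fdeg_tmul e; split=> //=; rewrite e'.
Qed.

(** If fdeg p <= fdeg t, the exponents of p and t differ in total degree by at most the difference
    of two of the d j, hence the term with factor 2; the successor makes the bound strict, as
    bounded multinomials require. *)
Definition fbound t : nat := (mdeg t.1 + 2 * \sum_j `|d j|).+1%N.

Definition fbelow t : seq mon :=
  [seq p <- [seq (bmnm w, j) | w <- enum {: 'X_{1..n < fbound t}}, j <- enum 'I_m] | fltb p t].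

Lemma fbelowP t p : (p \in fbelow t) = fltb p t.
Proof.
rewrite mem_filter; case: fltP => //= h.
have dl j : (`|d j| <= \sum_j `|d j|)%N.
  by rewrite (bigD1 j) //= leq_addr.
have le : fdeg d p <= fdeg d t.
  by case: h => [/ltW|[->]|[->]].
have lt : (mdeg p.1 < fbound t)%N.
  move: le (dl p.2) (dl t.2); rewrite /fdeg /fbound.
  move: (\sum_j _)%N (d p.2) (d t.2) (mdeg p.1) (mdeg t.1) => s a b x y; lia.
apply/allpairsP; exists (BMultinom lt, p.2); rewrite !mem_enum /=.
by split=> //; case: (p).
Qed.

Lemma fbelow_uniq t : uniq (fbelow t).
Proof.
apply: filter_uniq; apply: allpairs_uniq; rewrite ?enum_uniq //.
by case=> [u j] [v k] _ _ /= [E ->]; congr pair; apply: val_inj.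
Qed.

(* The order has type omega, so it embeds into [nat]. *)
Definition frank t : nat := size (fbelow t).

Lemma frank_mono t1 t2 : fmon_lt d t1 t2 -> (frank t1 < frank t2)%N.
Proof.
move=> h; apply: (@uniq_leq_size _ (t1 :: fbelow t1)).
  rewrite /= fbelow_uniq fbelowP andbT; apply/negP=> /fltP; exact: flt_irr.
move=> p; rewrite inE => /orP [/eqP ->|]; rewrite !fbelowP; first exact/fltP.
by move=> /fltP hp; apply/fltP/(flt_trans hp).
Qed.

Lemma frank_lt t1 t2 : (frank t1 < frank t2)%N <-> fmon_lt d t1 t2.
Proof.
split=> [h|]; last exact: frank_mono.
case: (eqVneq t1 t2) => [E|/eqP/flt_total [//|/frank_mono h']].
  by rewrite E ltnn in h.
by move: (ltn_trans h h'); rewrite ltnn.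
Qed.

Lemma frank_inj : injective frank.
Proof.
move=> t1 t2 E; apply: NNPP => /flt_total [] /frank_mono;
  by rewrite E ltnn.
Qed.

End Order.

(** * Initial monomials for abstract coefficients *)

Section InitialMonomials.
Local Open Scope ring_scope.
Variables (K : fieldType) (n m : nat).
Local Notation S := {mpoly K[n]}.
Local Notation F := 'rV[S]_m.
Local Notation mon := (fmonomial n m).
Variables (coef : F -> mon -> K) (rank : mon -> nat).

(** Coordinates of F as a K-space, indexed by monomials. Used both for [fcoef] and for [fcoef] after
    a coordinate change. *)
Definition is_coef : Prop :=
  [/\ forall f g t, coef (f + g) t = coef f t + coef g t,
      forall c f t, coef (c%:MP *: f) t = c * coef f t,
      forall f, exists s : seq mon, forall t, coef f t != 0 -> t \in s
    & forall f, (forall t, coef f t = 0) -> f = 0].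

Definition inm (f : F) (t : mon) : Prop :=
  coef f t != 0 /\ forall t', coef f t' != 0 -> t' <> t -> (rank t' < rank t)%N.

Definition IN (X : F -> Prop) (t : mon) : Prop := exists2 f, X f & inm f t.

Hypotheses (coefP : is_coef) (rank_inj : injective rank).
Implicit Types (X Y : F -> Prop) (f g : F).

Lemma coefD f g t : coef (f + g) t = coef f t + coef g t.
Proof. by case: coefP. Qed.

Lemma coefC c f t : coef (c%:MP *: f) t = c * coef f t.
Proof. by case: coefP. Qed.

Lemma inm_ge f t t' : inm f t -> coef f t' != 0 -> (rank t' <= rank t)%N.
Proof.
move=> [_ h] ht'; case: (eqVneq t' t) => [->//|/eqP ne].
exact/ltnW/h.
Qed.

Lemma inm_uniq f t t' : inm f t -> inm f t' -> t = t'.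
Proof.
move=> h h'; apply/rank_inj/anti_leq.
by rewrite (inm_ge h h'.1) (inm_ge h' h.1).
Qed.

Lemma inm_of_ge f t : coef f t != 0 ->
  (forall t', coef f t' != 0 -> (rank t' <= rank t)%N) -> inm f t.
Proof.
move=> h hle; split=> // t' ht' ne; rewrite ltn_neqAle hle // andbT.
by apply/eqP=> /rank_inj.
Qed.

Lemma inm_exists f : f <> 0 -> exists t, inm f t.
Proof.
case: coefP => _ _ hs h0 fn0; have [s hs'] := hs f.
pose P k := has (fun t => (coef f t != 0) && (rank t == k)) s.
have exP : exists k, P k.
  apply: NNPP => hn; apply/fn0/h0 => t; apply/eqP/contraT => ht.
  case: hn; exists (rank t); apply/hasP; exists t; rewrite ?ht ?eqxx //.
  exact: hs'.
have ubP k : P k -> (k <= \max_(t <- s) rank t)%N.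
  by case/hasP => t ts /andP [_ /eqP <-]; rewrite leq_bigmax_seq.
case: (ex_maxnP exP ubP) => k /hasP [t ts /andP [ht /eqP <-]] hmax.
exists t; apply: inm_of_ge => // t' ht'; apply/hmax/hasP.
by exists t'; rewrite ?ht' ?eqxx ?hs'.
Qed.

Lemma inm_cancel f g t : inm f t -> inm g t -> exists c, forall t',
  coef (f + c%:MP *: g) t' != 0 -> (rank t' < rank t)%N.
Proof.
move=> hf hg; exists (- (coef f t / coef g t)) => t'.
rewrite coefD coefC => h.
have : (rank t' <= rank t)%N.
  case: (eqVneq (coef f t') 0) h => [->|/(inm_ge hf) //].
  by rewrite add0r mulf_eq0 negb_or => /andP [_ /(inm_ge hg)].
rewrite leq_eqVlt => /orP [/eqP/rank_inj E|//].
by move: h; rewrite E mulNr divfK ?subrr ?eqxx //; case: hg.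
Qed.

Lemma IN_mono X Y : (forall f, X f -> Y f) -> forall t, IN X t -> IN Y t.
Proof. by move=> h t [f /h]; exists f. Qed.

(** Division by X that stops as soon as the top monomial is not in [IN X]; each cancellation lowers
    the bound [N] on the ranks. *)
Lemma IN_reduce X f : subspace X ->
  exists2 g, X (f - g) & g = 0 \/ exists2 t, inm g t & ~ IN X t.
Proof.
move=> hX; have [N hN] : exists N, forall t, coef f t != 0 -> (rank t < N)%N.
  case: coefP => _ _ /(_ f) [s hs] _.
  exists (\max_(t <- s) rank t).+1 => t /hs ts.
  by rewrite ltnS leq_bigmax_seq.
elim/ltn_ind: N f hN => N IH f hN.
case: (classic (f = 0)) => [->|/inm_exists [t ht]].
  by exists 0; [case: hX; rewrite subr0 | left].
case: (classic (IN X t)) => [[g Xg hg]|hn]; last first.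
  by exists f; [case: hX; rewrite subrr | right; exists t].
have [c hc] := inm_cancel ht hg.
have [h Xh hh] := IH _ (hN t ht.1) _ hc.
exists h => //; case: (hX) => _ XD XZ.
have -> : f - h = (f + c%:MP *: g - h) - c%:MP *: g.
  by rewrite addrAC addrK.
by apply: subspaceB => //; apply: XZ.
Qed.

(** A remainder of an element of Y modulo X lies in Y, so its initial monomial would be in [IN X];
    thus it is zero. *)
Lemma IN_sub X Y : subspace X -> subspace Y -> (forall f, X f -> Y f) ->
  (forall t, IN Y t -> IN X t) -> forall f, Y f -> X f.
Proof.
move=> hX hY XY h f Yf; have [g Xg [E|[t tg nt]]] := IN_reduce f hX.
  by move: Xg; rewrite E subr0.
case: nt; apply: h; exists g => //.
by rewrite -[g](subKr f); apply: subspaceB => //; apply: XY.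
Qed.

Definition add_line X f : F -> Prop :=
  fun h => exists x c, X x /\ h = x + c%:MP *: f.

Lemma subspace_add_line X f : subspace X -> subspace (add_line X f).
Proof.
case=> X0 XD XZ; split.
- by exists 0, 0; rewrite mpolyC0 scale0r addr0.
- move=> _ _ [x [c [hx ->]]] [y [e [hy ->]]]; exists (x + y), (c + e).
  by rewrite mpolyCD scalerDl addrACA; split=> //; apply: XD.
- move=> e _ [x [c [hx ->]]]; exists (e%:MP *: x), (e * c).
  by rewrite mpolyCM scalerDr scalerA; split=> //; apply: XZ.
Qed.

Lemma add_line_sub X f h : X h -> add_line X f h.
Proof. by move=> Xh; exists h, 0; rewrite mpolyC0 scale0r addr0. Qed.

Lemma add_line_mem X f : subspace X -> add_line X f f.
Proof. by case=> X0 _ _; exists 0, 1; rewrite mpolyC1 scale1r add0r. Qed.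

(** One more dimension gives exactly one more monomial, that of the remainder g of f. Every new
    element is y + c g with y in X, and the top monomials of y and g cannot cancel because that of g
    is not in [IN X]. *)
Lemma IN_add_line X f : subspace X -> ~ X f ->
  exists2 t0, ~ IN X t0 & forall t, IN (add_line X f) t <-> IN X t \/ t = t0.
Proof.
move=> hX nXf; have [g Xg [E|[t0 tg nt]]] := IN_reduce f hX.
  by case: nXf; move: Xg; rewrite E subr0.
exists t0 => // t; split; last first.
  case=> [|->]; first by apply: IN_mono => h; apply: add_line_sub.
  exists g => //; exists (- (f - g)), 1; split; first exact: subspaceN.
  by rewrite mpolyC1 scale1r opprB subrK.
case=> h [x [c [Xx Eh]]] ht.
pose y := x + c%:MP *: (f - g).
have Xy : X y by case: (hX) => _ XD XZ; apply/XD/XZ.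
have {}Eh : h = y + c%:MP *: g by rewrite Eh /y -addrA -scalerDr subrK.
case: (eqVneq c 0) => [c0|c0].
  by left; exists h => //; rewrite Eh c0 mpolyC0 scale0r addr0.
have coefh s : coef h s = coef y s + c * coef g s by rewrite Eh coefD coefC.
case: (classic (y = 0)) => [y0|/inm_exists [s hs]].
  right; apply: inm_uniq ht _; rewrite Eh y0 add0r.
  split; first by rewrite coefC mulf_neq0 //; case: tg.
  by move=> t'; rewrite coefC mulf_eq0 negb_or => /andP [_]; case: tg => _; apply.
have INs : IN X s by exists y.
case: (ltngtP (rank s) (rank t0)) => lt.
- right; apply: inm_uniq ht _; apply: inm_of_ge.
    rewrite coefh; have -> : coef y t0 = 0.
      by apply/eqP/contraT => /(inm_ge hs); rewrite leqNgt lt.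
    by rewrite add0r mulf_neq0 //; case: tg.
  move=> t'; rewrite coefh; case: (eqVneq (coef y t') 0) => [->|/(inm_ge hs)].
    by rewrite add0r mulf_eq0 negb_or => /andP [_ /(inm_ge tg)].
  by move=> le _; apply: leq_trans le (ltnW lt).
- left; suff -> : t = s by [].
  apply: inm_uniq ht _; apply: inm_of_ge.
    rewrite coefh; have -> : coef g s = 0.
      by apply/eqP/contraT => /(inm_ge tg); rewrite leqNgt lt.
    by rewrite mulr0 addr0; case: hs.
  move=> t'; rewrite coefh; case: (eqVneq (coef y t') 0) => [->|/(inm_ge hs)//].
  rewrite add0r mulf_eq0 negb_or => /andP [_ /(inm_ge tg) le].
  exact: leq_trans le (ltnW lt).
- by case: nt; rewrite -(rank_inj lt).
Qed.

(** * Lengths over K[x_1,...,x_r] as numbers of initial monomials *)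

Section Length.
Variables (A : S -> Prop) (r : nat).
Hypothesis AE : forall p, A p <-> subpoly r p.

Let Asub X : submodule A X -> subspace X.
Proof. by apply: submod_subspace => c; apply/AE/subpolyC. Qed.

Lemma subpolyX (u : 'X_{1..n}) : (forall j : 'I_n, (r <= j)%N -> u j = 0%N) -> subpoly r ('X_[u] : S).
Proof. by move=> h v; rewrite msuppX inE => /eqP ->. Qed.

(** Nonconstant monomials of K[x_1,...,x_r] send f into X, so only the constant term of a scalar
    contributes a multiple of f. *)
Lemma submodule_add_line X f : submodule A X ->
  (forall j : 'I_n, (j < r)%N -> X ('X_j *: f)) -> submodule A (add_line X f).
Proof.
move=> hX hf; have hX' := Asub hX.
case: (subspace_add_line f hX') => l0 lD lZ; split=> // p _ Ap [x [c [Xx ->]]].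
rewrite scalerDr scalerA mulrC mul_mpolyC -mul_mpolyC -scalerA.
apply: lD; first by apply: add_line_sub; case: hX => _ _; apply.
apply: (lZ); rewrite [p]mpolyE scaler_suml; apply: subspace_sum_seq; [exact: subspace_add_line | move=> u up].
rewrite -mul_mpolyC -scalerA; apply: lZ.
case: (eqVneq u 0%MM) => [->|un0]; first by rewrite mpolyX0 scale1r; apply: add_line_mem.
apply: add_line_sub.
have [j uj] : exists j, u j != 0%N.
  apply/existsP; rewrite -negb_forall; apply: contra un0 => /forallP h.
  by apply/eqP/mnmP => j; rewrite mnm0E; apply/eqP.
have /AE hp := Ap.
have jr : (j < r)%N by rewrite ltnNge; apply: contra uj => /(hp u up) ->.
have /submK <- : (U_(j) <= u)%MM by rewrite lep1mP.
rewrite mpolyXD -scalerA; case: hX => _ _; apply; last exact: hf.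
by apply/AE/subpolyX => k rk; rewrite mnmBE (hp u up k rk).
Qed.

(** Handle the variables in turn: multiply by the largest power of x_k that stays outside X.
    Variables treated before still send the result into X. *)
Lemma exists_socle X Y : submodule A X -> submodule A Y ->
  (forall f, Y f -> forall j : 'I_n, (j < r)%N -> exists N, X ('X_j ^+ N *: f)) ->
  (exists f, Y f /\ ~ X f) ->
  exists f, [/\ Y f, ~ X f & forall j : 'I_n, (j < r)%N -> X ('X_j *: f)].
Proof.
move=> hX hY hnil [f0 [Yf0 Xf0]].
have Avar (j : 'I_n) : (j < r)%N -> A 'X_j.
  move=> jr; apply/AE/subpolyX => k rk; rewrite mnm1E.
  by case: eqP => // E; rewrite -E leqNgt jr in rk.
suff H k : exists f, [/\ Y f, ~ X f &
    forall j : 'I_n, (j < r)%N -> (j < k)%N -> X ('X_j *: f)].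
  have [f [h1 h2 h3]] := H n; exists f; split=> // j jr; exact: h3.
elim: k => [|k [f [Yf Xf hf]]]; first by exists f0.
case: (boolP ((k < n) && (k < r))%N) => [/andP [kn kr]|hk]; last first.
  exists f; split=> // j jr; rewrite ltnS leq_eqVlt => /orP [/eqP E|]; last exact: hf.
  by move: hk; rewrite -E ltn_ord jr.
pose j0 : 'I_n := Ordinal kn.
have [N] := hnil f Yf j0 kr; elim: N f Yf Xf hf => [|N IH] f Yf Xf hf.
  by rewrite expr0 scale1r.
case: (classic (X ('X_j0 *: f))) => [h _|h].
  exists f; split=> // j jr; rewrite ltnS leq_eqVlt => /orP [/eqP E|]; last exact: hf.
  by have -> : j = j0 by apply: val_inj.
rewrite exprSr -scalerA; apply: IH => //.
  by case: hY => _ _; apply => //; apply: Avar.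
move=> j jr jk; rewrite scalerA mulrC -scalerA.
by case: hX => _ _; apply; [apply: Avar | apply: hf].
Qed.

(** Upper bound: every strict inclusion gains an initial monomial. Existence: adjoining socle
    elements gains exactly one at a time. *)
Lemma length_IN X Y (s : seq mon) : submodule A X -> submodule A Y ->
  (forall f, X f -> Y f) -> uniq s ->
  (forall t, t \in s <-> IN Y t /\ ~ IN X t) ->
  (forall f, Y f -> forall j : 'I_n, (j < r)%N -> exists N, X ('X_j ^+ N *: f)) ->
  length_is A X Y (size s).
Proof.
move=> hX hY XY us hs hnil; split; last first.
  move=> C l [C0 Cl hC lt].
  suff [w [uw sw hw]] : exists w, [/\ uniq w, size w = l &
      forall t, t \in w -> IN (C l) t /\ ~ IN X t].
    rewrite -sw; apply: uniq_leq_size => // t /hw [[f Cf ft] nX]; apply/hs.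
    split; [by exists f; [exact/Cl|] | exact: nX].
  have XC i : (i <= l)%N -> forall f, X f -> C i f.
    elim: i => [_ f Xf|i IH il f Xf]; [exact/C0 | have [h _] := lt i il].
    by apply/h/IH => //; apply: ltnW.
  (* Climb the chain, collecting in [w] one new initial monomial per step. *)
  have: (l <= l)%N by []; elim: {1 3 4}l => [_|i IH il]; first by exists [::].
  have [w [uw sw hw]] := IH (ltnW il); have [Cs [f [Cf nCf]]] := lt i il.
  have [t tC nt] : exists2 t, IN (C i.+1) t & ~ IN (C i) t.
    apply: NNPP => hn; apply: nCf.
    apply: (IN_sub (Asub (hC i (ltnW il))) (Asub (hC i.+1 il)) Cs _ Cf).
    by move=> t ht; apply: NNPP => nt; apply: hn; exists t.
  exists (t :: w); split=> /=; rewrite ?sw //.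
    by rewrite uw andbT; apply/negP => /hw [].
  move=> t'; rewrite inE => /orP [/eqP ->|/hw [h1 h2]].
    by split=> // h; apply: nt; apply: IN_mono h => g; apply/XC/ltnW.
  by split=> //; apply: IN_mono h1.
(* Construct the longest chain: adjoining a socle element to X removes one monomial from s. *)
move El : (size s) => l; elim: l X s hX XY us hs hnil El => [|l IH] X s hX XY us hs hnil El.
  exists (fun=> Y); split=> //; first split; last exact: XY.
  apply: (IN_sub (Asub hX) (Asub hY) XY) => t ht; apply: NNPP => nt.
  have : t \in s by apply/hs.
  by rewrite (size0nil El).
have [f [Yf nXf hf]] : exists f, [/\ Y f, ~ X f &
    forall j : 'I_n, (j < r)%N -> X ('X_j *: f)].
  apply: exists_socle => //; apply: NNPP => hn.
  case: s us hs El => // t s _ /(_ t); rewrite inE eqxx => /= -[/(_ isT) [[f Yf ft] nt] _] _.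
  by apply: hn; exists f; split=> // Xf; apply: nt; exists f.
have hX' := submodule_add_line hX hf.
have X'Y g : add_line X f g -> Y g.
  move=> [x [c [Xx ->]]]; case: (Asub hY) => _ YD YZ.
  by apply: YD; [apply: XY | apply: YZ].
have [t0 nt0 ht0] := IN_add_line (Asub hX) nXf.
have t0s : t0 \in s by apply/hs; split=> //; apply: (IN_mono X'Y); apply/ht0; right.
have [C [C0 Cl hC lt]] : exists C, submod_chain A (add_line X f) Y C l.
  apply: (IH _ (rem t0 s)) => //; first exact: rem_uniq.
  - move=> t; rewrite mem_rem_uniq // !inE; split.
      case/andP=> /eqP ne /hs [h1 h2]; split=> // /ht0 [] //.
    case=> h1 h2; apply/andP; split.
      by apply/eqP => E; apply/h2/ht0; right.
    by apply/hs; split=> // h; apply/h2/ht0; left.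
  - move=> g Yg j jr; have [N hN] := hnil g Yg j jr.
    by exists N; apply: add_line_sub.
  - by rewrite size_rem // El.
exists (fun i => if i is i'.+1 then C i' else X); split=> //.
- by case=> [|i] //; apply: hC.
- case=> [_|i il]; last exact: lt.
  split=> [g Xg|]; first by apply/C0/add_line_sub.
  by exists f; split=> //; apply/C0; apply/add_line_mem/Asub.
Qed.

End Length.

(** Each of the finitely many vectors spanning Y modulo X adds at most one initial monomial. *)
Lemma IN_finite_ext X Y (b : seq F) : subspace X ->
  (forall f, Y f -> exists2 c : F -> K, True & X (f - \sum_(g <- b) (c g)%:MP *: g)) ->
  exists s : seq mon, forall t, IN Y t -> ~ IN X t -> t \in s.
Proof.
elim: b X => [|g b IH] X hX hY.
  exists [::] => t [f /hY [c _]]; rewrite big_nil subr0 => Xf ft [].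
  by exists f.
case: (classic (X g)) => Xg.
  apply: IH => // f /hY [c _]; rewrite big_cons => h; exists c => //.
  rewrite opprD addrA in h; case: (hX) => _ XD XZ.
  have := XD _ _ h (XZ (c g) _ Xg); rewrite addrAC.
  by rewrite subrK.
have [t0 _ ht0] := IN_add_line hX Xg.
have [|s hs] := IH _ (subspace_add_line g hX).
  move=> f /hY [c _]; rewrite big_cons => h; exists c => //.
  exists (f - (\sum_(j <- (g :: b)) (c j)%:MP *: j)), (c g).
  by rewrite big_cons; split=> //; rewrite opprD addrA addrAC subrK.
exists (t0 :: s) => t tY tX; rewrite inE.
case: (eqVneq t t0) => //= /eqP ne; apply: hs => // /ht0 [] //.
Qed.

End InitialMonomials.

Lemma choice_fun (X Y : Type) (P : X -> Y -> Prop) :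
  (forall x, exists y, P x y) -> exists f, forall x, P x (f x).
Proof.
move=> h; exists (fun x => proj1_sig (constructive_indefinite_description _ (h x))).
by move=> x; case: constructive_indefinite_description.
Qed.

(** * Spans and submodules *)

Section Span.
Local Open Scope ring_scope.
Variables (R : nzRingType) (M : lmodType R) (A : R -> Prop) (X : M -> Prop).
Hypotheses (A1 : A 1) (AM : forall a b, A a -> A b -> A (a * b)).

Lemma span_mem x : X x -> Defs.span A X x.
Proof.
move=> Xx; exists [:: (1, x)]; rewrite big_seq1 scale1r; split=> // c.
by rewrite inE => /eqP ->.
Qed.

Lemma span_submodule : submodule A (Defs.span A X).
Proof.
split.
- by exists [::]; rewrite big_nil.
- move=> _ _ [s [hs ->]] [s' [hs' ->]]; exists (s ++ s'); rewrite big_cat.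
  by split=> // c; rewrite mem_cat => /orP [/hs|/hs'].
- move=> a _ Aa [s [hs ->]]; exists [seq (a * c.1, c.2) | c <- s]; split.
    move=> _ /mapP [c /hs [h1 h2] ->] /=; split=> //; exact: AM.
  by rewrite scaler_sumr big_map; apply: eq_bigr => c _; rewrite scalerA.
Qed.

Lemma span_min (N : M -> Prop) : submodule A N -> (forall x, X x -> N x) ->
  forall x, Defs.span A X x -> N x.
Proof.
case=> N0 ND NZ XN _ [s [hs ->]].
elim: s hs => [|c s IH] hs; first by rewrite big_nil.
rewrite big_cons; apply: ND.
  by have [h1 h2] := hs c (mem_head _ _); apply: NZ => //; apply: XN.
by apply: IH => c' hc'; apply: hs; rewrite inE hc' orbT.
Qed.

End Span.

(** * Noetherianity and saturation *)

Section Noetherian.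
Local Open Scope ring_scope.
Variables (K : fieldType) (n m : nat).
Local Notation S := {mpoly K[n]}.
Local Notation F := 'rV[S]_m.
Local Notation mon := (fmonomial n m).
Implicit Types (T : F -> Prop) (f g h : F).

Lemma fcoef_is_coef : is_coef (@fcoef K n m).
Proof.
split=> [f g t|c f t|f|f h]; rewrite ?fcoefD ?fcoefC //.
  by exists (fsupp f) => t; rewrite mem_fsupp.
by apply: fcoef_inj => t; rewrite h fcoef0.
Qed.

Lemma inm_mulX d u f t : inm (@fcoef K n m) (frank d) f t ->
  inm (@fcoef K n m) (frank d) ('X_[u] *: f) (tmul u t).
Proof.
move=> [h1 h2]; split; first by rewrite fcoefX.
move=> t' /fcoefX_neq0 [t'' -> h3] ne; apply/frank_lt/flt_tmul/frank_lt.
by apply: h2 => // E; apply: ne; rewrite E.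
Qed.

(** Induction on the number k of exponents that are compared, for all sets A at once. *)
Lemma dickson_multinom (A : 'X_{1..n} -> Prop) :
  exists s : seq 'X_{1..n}, (forall u, u \in s -> A u) /\
    forall u, A u -> exists2 v, v \in s & (v <= u)%MM.
Proof.
suff H k : forall A : 'X_{1..n} -> Prop,
    exists s : seq 'X_{1..n}, (forall u, u \in s -> A u) /\
      forall u, A u -> exists2 v, v \in s & forall j : 'I_n, (j < k)%N -> (v j <= u j)%N.
  have [s [h1 h2]] := H n A; exists s; split=> // u /h2 [v vs hv].
  by exists v => //; apply/mnm_lepP => j; apply: hv.
elim: k => [|k IH] {}A.
  case: (classic (exists u, A u)) => [[u Au]|hn].
    exists [:: u]; split=> [v|v _]; first by rewrite inE => /eqP ->.
    by exists u; rewrite ?inE.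
  by exists [::]; split=> // u Au; case: hn; exists u.
have [kn|nk] := ltnP k n; last first.
  have [s [h1 h2]] := IH A; exists s; split=> // u /h2 [v vs hv].
  by exists v => // j _; apply/hv/(leq_trans (ltn_ord j)).
pose j0 : 'I_n := Ordinal kn.
have [s [h1 h2]] := IH A.
have [sc hsc] := choice_fun (fun c => IH (fun u => A u /\ u j0 = c)).
(* Above [N] the new exponent puts no further condition, so [s] suffices; below it there are
   finitely many slices on which this exponent is constant. *)
pose N := (\max_(v <- s) v j0)%N.
exists (s ++ flatten [seq sc c | c <- iota 0 N]); split=> u.
  rewrite mem_cat => /orP [/h1 //|/flattenP [_ /mapP [c _ ->]]].
  by case: (hsc c) => h _ /h [].
move=> Au; have [uN|Nu] := ltnP (u j0) N.
  have [_ /(_ u (conj Au erefl)) [v vs hv]] := hsc (u j0).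
  exists v.
    rewrite mem_cat; apply/orP; right; apply/flattenP; exists (sc (u j0)) => //.
    by apply: map_f; rewrite mem_iota.
  move=> j; rewrite ltnS leq_eqVlt => /orP [/eqP E|/hv //].
  have -> : j = j0 by apply: val_inj.
  by have [/(_ v vs) [_ ->]] := hsc (u j0).
have [v vs hv] := h2 u Au; exists v; first by rewrite mem_cat vs.
move=> j; rewrite ltnS leq_eqVlt => /orP [/eqP E|/hv //].
have -> : j = j0 by apply: val_inj.
by apply: leq_trans Nu; apply: (leq_bigmax_seq (F := fun v : 'X_{1..n} => v j0)).
Qed.

Lemma dickson (A : mon -> Prop) :
  exists s : seq mon, (forall t, t \in s -> A t) /\
    forall t, A t -> exists2 t', t' \in s & exists u, t = tmul u t'.
Proof.
have [sc hsc] := choice_fun (fun j : 'I_m => dickson_multinom (fun u => A (u, j))).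
exists [seq (u, j) | j <- enum 'I_m, u <- sc j]; split.
  by move=> t /allpairsPdep [j [u [_ hu ->]]]; case: (hsc j) => h _; apply: h.
case=> u j Au; have [_ /(_ u Au) [v vs vu]] := hsc j; exists (v, j).
  by apply/allpairsPdep; exists j, v; rewrite mem_enum.
by exists (u - v)%MM; rewrite /tmul /= submK.
Qed.

(** A finite Groebner basis: elements whose initial monomials generate all those of T. The zero
    grading on the basis of F serves as well as any. *)
Lemma noetherian T : submodule full T ->
  exists s : seq F, (forall g, g \in s -> T g) /\
    forall f, T f -> Defs.span full (fun g => g \in s) f.
Proof.
move=> hT; pose INT := IN (@fcoef K n m) (frank (fun=> 0)).
have [s [h1 h2]] := dickson (INT T).
have [phi hphi] : exists phi : mon -> F, forall t, INT T t ->
    T (phi t) /\ inm (@fcoef K n m) (frank (fun=> 0)) (phi t) t.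
  apply: (@choice_fun mon F (fun t g => INT T t -> T g /\
    inm (@fcoef K n m) (frank (fun=> 0)) g t)) => t; case: (classic (INT T t)) => [[f Tf ft]|hn].
    by exists f.
  by exists 0.
have phiT g : g \in [seq phi t | t <- s] -> T g.
  by case/mapP => t /h1 /hphi [h _] ->.
exists [seq phi t | t <- s]; split=> //.
have hS := @span_submodule _ _ full (fun g => g \in [seq phi t | t <- s]) (fun a b _ _ => I).
apply: (IN_sub fcoef_is_coef (@frank_inj _ _ _) (subspace_full hS) (subspace_full hT)).
  exact: span_min.
move=> t /h2 [t' t's [u ->]]; have [_ ht'] := hphi _ (h1 _ t's).
exists ('X_[u] *: phi t'); last exact: inm_mulX.
by case: hS => _ _; apply=> //; apply: span_mem => //; apply: map_f.
Qed.

(* The saturation T : m^oo; powers of the variables suffice. *)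
Definition msat T f : Prop := forall j : 'I_n, exists N, T ('X_j ^+ N *: f).

(** Saturation tested on the first k variables only, for the induction in [exists_jsat_regular]. *)
Definition jsat k T f : Prop :=
  forall j : 'I_n, (j < k)%N -> exists N, T ('X_j ^+ N *: f).

Lemma subm_pow T p a b f : submodule full T -> T (p ^+ a *: f) -> T (p ^+ (b + a) *: f).
Proof. by case=> _ _ TZ h; rewrite exprD -scalerA; apply: TZ. Qed.

Lemma jsat_submodule k T : submodule full T -> submodule full (jsat k T).
Proof.
move=> hT; have [T0 TD TZ] := hT; split.
- by move=> j _; exists 0%N; rewrite scaler0.
- move=> f g hf hg j jk; have [[a ha] [b hb]] := (hf j jk, hg j jk).
  exists (b + a)%N; rewrite scalerDr; apply: TD; first exact: subm_pow.
  by rewrite addnC; apply: subm_pow.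
- move=> p f _ hf j jk; have [a ha] := hf j jk; exists a.
  by rewrite scalerA mulrC -scalerA; apply: TZ.
Qed.

Lemma msat_jsat T f : msat T f <-> jsat n T f.
Proof. by split=> [h j _|h j]; apply: h. Qed.

Lemma submodule_ext (A : S -> Prop) T T' :
  (forall f, T f <-> T' f) -> submodule A T -> submodule A T'.
Proof.
move=> E [T0 TD TZ]; split; first exact/E.
  by move=> f g /E hf /E hg; apply/E/TD.
by move=> a f Aa /E hf; apply/E/TZ.
Qed.

Lemma msat_submodule T : submodule full T -> submodule full (msat T).
Proof.
move=> hT; apply: submodule_ext (jsat_submodule n hT) => f.
by split=> /msat_jsat.
Qed.

Lemma msat_sub T f : T f -> msat T f.
Proof. by move=> h j; exists 0%N; rewrite scale1r. Qed.

Lemma msat_idem T f : submodule full T -> msat (msat T) f -> msat T f.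
Proof.
move=> hT h j; have [a /(_ j) [b hb]] := h j; exists (b + a)%N.
by rewrite exprD -scalerA.
Qed.

Lemma subm_msupp T p f : submodule full T ->
  (forall u, u \in msupp p -> T ('X_[u] *: f)) -> T (p *: f).
Proof.
move=> hT h; rewrite [p]mpolyE scaler_suml.
apply: subspace_sum_seq; first exact: subspace_full.
move=> u /h hu; rewrite -mul_mpolyC -scalerA; case: hT => _ _; exact.
Qed.

(** Pigeonhole: a monomial of large degree is divisible by some x_j^(N_j). A bound in terms of
    degree, unlike powers of variables, survives linear substitutions. *)
Lemma msat_deg T f : submodule full T -> msat T f ->
  exists N, forall p, (forall u, u \in msupp p -> (N <= mdeg u)%N) -> T (p *: f).
Proof.
(* The successor matters for n = 0, where [msat T] is everything while the monomial 1 has degree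
   0. *)
move=> hT /choice_fun [N hN]; exists (\sum_j N j).+1 => p hp.
apply: subm_msupp => // u /hp hu.
have [j hj] : exists j, (N j <= u j)%N.
  apply/existsP; move: hu; apply: contraLR; rewrite negb_exists -leqNgt.
  by move/forallP => h; rewrite mdegE; apply: leq_sum => j _; rewrite ltnW // ltnNge.
have Eu : (U_(j) *+ N j <= u)%MM.
  apply/mnm_lepP => k; rewrite mulmnE mnm1E; case: eqP => [<-|_]; rewrite ?mul1n //.
rewrite -(submK Eu) mpolyXD -mpolyXn -scalerA; case: hT => _ _; exact.
Qed.

(** Modulo T the saturation is spanned over K by the products x^u g, with g one of finitely many
    generators and u of bounded degree. *)
Lemma msat_finite coef (rank : mon -> nat) T : @is_coef K n m coef -> injective rank ->
  submodule full T ->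
  exists s : seq mon, forall t, IN coef rank (msat T) t -> ~ IN coef rank T t -> t \in s.
Proof.
move=> hc rinj hT; have [gens [hg hspan]] := noetherian (msat_submodule hT).
have [N hN] : exists N : F -> nat, forall g, g \in gens ->
    forall u, (N g <= mdeg u)%N -> T ('X_[u] *: g).
  apply: (@choice_fun F nat (fun g N => g \in gens ->
    forall u : 'X_{1..n}, (N <= mdeg u)%N -> T ('X_[u] *: g))) => g.
  case: (boolP (g \in gens)) => [/hg/(msat_deg hT) [N hN]|_].
    by exists N => _ u hu; apply: hN => v; rewrite msuppX inE => /eqP ->.
  by exists 0%N.
pose b : seq F := undup [seq 'X_[u] *: g | g <- gens, u <- map (@bmnm _ _) (enum {: 'X_{1..n < N g}})].
apply: (IN_finite_ext hc rinj (b := b)); first exact: subspace_full.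
move=> f /hspan.
have [T0 TD TZ] := hT; case=> s [hs ->].
pose Z f := exists2 c : F -> K, True & T (f - \sum_(g <- b) (c g)%:MP *: g).
have Z0 : Z 0.
  by exists (fun=> 0) => //; rewrite big1 ?subr0 // => g _; rewrite mpolyC0 scale0r.
have ZD f1 f2 : Z f1 -> Z f2 -> Z (f1 + f2).
  move=> [c _ hc1] [e _ he]; exists (fun g => c g + e g) => //.
  under eq_bigr do rewrite mpolyCD scalerDl.
  by rewrite big_split /= opprD addrACA; apply: TD.
have ZT f1 : T f1 -> Z f1.
  move=> h; exists (fun=> 0) => //; rewrite big1 ?subr0 // => g _.
  by rewrite mpolyC0 scale0r.
have Zb c g : g \in b -> Z (c%:MP *: g).
  move=> gb; exists (fun h => if h == g then c else 0) => //.
  rewrite (bigD1_seq g) ?undup_uniq //= eqxx big1 ?addr0 ?subrr // => h /negPf ->.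
  by rewrite mpolyC0 scale0r.
elim: s hs => [|[a g] s IH] hs; first by rewrite big_nil.
rewrite big_cons; apply: (ZD); last by apply: IH => c h; apply: hs; rewrite inE h orbT.
have [_ /= gg] := hs (a, g) (mem_head _ _).
rewrite /= [a]mpolyE scaler_suml.
elim: (msupp a) => [|u us IHu]; rewrite ?big_nil // big_cons; apply: (ZD) => //.
rewrite -mul_mpolyC -scalerA.
have [le|lt] := leqP (N g) (mdeg u); first by apply/ZT/TZ/hN.
apply: Zb; rewrite mem_undup; apply/allpairsPdep; exists g, u; split=> //.
by apply/mapP; exists (BMultinom lt); rewrite ?mem_enum.
Qed.

(** * Regular members of a pencil *)

Section Pencil.
Variables (T : F -> Prop) (y z : S).
Hypotheses (hT : submodule full T)
  (hyz : forall f, T (y *: f) -> T (z *: f) -> T f).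

Let ker t f := T ((y + t%:MP * z) *: f).

(* Kernels of different members of the pencil are independent modulo [T], as
   eigenspaces are. *)
Lemma pencil_independent (b : seq K) (phi : K -> F) : uniq b ->
  (forall t, t \in b -> ker t (phi t)) -> T (\sum_(t <- b) phi t) ->
  forall t, t \in b -> T (phi t).
Proof.
have [T0 TD TZ] := hT.
elim: b phi => [|t0 b IH] phi //= /andP [t0b ub] hk; rewrite big_cons => hsum.
have hb : forall t, t \in b -> T (phi t).
  have hk' t : t \in b -> ker t (phi t) by move=> h; apply: hk; rewrite inE h orbT.
  have h1 t : t \in b -> T ((y + t0%:MP * z) *: phi t).
    apply: (IH (fun t => (y + t0%:MP * z) *: phi t)) => // [t' /hk' h|].
      by rewrite /ker scalerA mulrC -scalerA; apply: TZ.
    rewrite -scaler_sumr.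
    have := subspaceB (subspace_full hT) (TZ (y + t0%:MP * z) _ I hsum) (hk t0 (mem_head _ _)).
    by rewrite scalerDr addrC addKr.
  move=> t tb; have ne : t0 - t != 0 by rewrite subr_eq0; apply: contraNneq t0b => ->.
  (* Subtracting two members of the pencil isolates z; then y follows, and [hyz] applies. *)
  have hz : T (z *: phi t).
    have := subspaceB (subspace_full hT) (h1 t tb) (hk' t tb).
    rewrite -scalerBl opprD addrACA subrr add0r -mulrBl -mpolyCB => h.
    have := TZ ((t0 - t)^-1%:MP) _ I h.
    by rewrite scalerA mulrA -mpolyCM mulVf // mul1r.
  apply: hyz => //; have := subspaceB (subspace_full hT) (hk' t tb) (TZ t%:MP _ I hz).
  by rewrite scalerDl scalerA addrK.
move=> t; rewrite inE => /orP [/eqP ->|/hb //].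
have hs : T (\sum_(t <- b) phi t) by apply: subspace_sum_seq => //; apply: subspace_full.
by have := subspaceB (subspace_full hT) hsum hs; rewrite addrK.
Qed.

Let ksum (b : seq K) f := exists2 phi : K -> F,
  (forall t, t \in b -> ker t (phi t)) & T (f - \sum_(t <- b) phi t).

Let ker0 t : ker t 0.
Proof. by rewrite /ker scaler0; case: hT. Qed.

Let ksum_sub b b' f : uniq b -> uniq b' -> {subset b <= b'} -> ksum b f -> ksum b' f.
Proof.
move=> ub ub' sb [phi h1 h2]; exists (fun t => if t \in b then phi t else 0).
  by move=> t tb'; case: ifP => [/h1 //|_]; apply: ker0.
rewrite -big_mkcond /= -big_filter (perm_big b) //; apply: uniq_perm => //.
  exact: filter_uniq.
move=> t; rewrite mem_filter; case: (boolP (t \in b)) => //= /sb; exact.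
Qed.

Let ksum_submodule b : submodule full (ksum b).
Proof.
have [T0 TD TZ] := hT; split.
- by exists (fun=> 0) => [t _|]; rewrite ?big1_eq ?subr0.
- move=> f g [phi h1 h2] [psi h3 h4]; exists (fun t => phi t + psi t).
    by move=> t tb; rewrite /ker scalerDr; apply: TD; [apply: h1 | apply: h3].
  by rewrite big_split /= opprD addrACA; apply: TD.
- move=> a f _ [phi h1 h2]; exists (fun t => a *: phi t).
    by move=> t tb; rewrite /ker scalerA mulrC -scalerA; apply: TZ => //; apply: h1.
  by rewrite -scaler_sumr -scalerBr; apply: TZ.
Qed.

(** The finite sums of kernels form a directed union V, which is finitely generated and hence equals
    the sum over one finite b. The kernel of a further member lies in this sum and is independent of
    it, so it is contained in T. *)
Lemma pencil_regular : exists b : seq K,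
  forall t, t \notin b -> forall f, T ((y + t%:MP * z) *: f) -> T f.
Proof.
pose V f := exists2 b, uniq b & ksum b f.
have join (b b' : seq K) : uniq b -> uniq b' -> exists c, [/\ uniq c, {subset b <= c} & {subset b' <= c}].
  move=> ub ub'; exists (undup (b ++ b')); split; first exact: undup_uniq.
    by move=> t; rewrite mem_undup mem_cat => ->.
  by move=> t; rewrite mem_undup mem_cat orbC => ->.
have hV : submodule full V.
  split.
  - by exists [::] => //; case: (ksum_submodule [::]).
  - move=> f g [b ub hf] [b' ub' hg]; have [c [uc h1 h2]] := join _ _ ub ub'.
    exists c => //; case: (ksum_submodule c) => _ D _.
    by apply: D; [apply: ksum_sub hf | apply: ksum_sub hg].
  - by move=> a f _ [b ub hf]; exists b => //; case: (ksum_submodule b) => _ _; apply.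
have [s [hs hspan]] := noetherian hV.
have [b ub hb] : exists2 b, uniq b & forall g, g \in s -> ksum b g.
  elim: s hs {hspan} => [|g s IH] hs; first by exists [::].
  have [|b ub hb] := IH; first by move=> h hh; apply: hs; rewrite inE hh orbT.
  have [b' ub' hb'] := hs g (mem_head _ _).
  have [c [uc h1 h2]] := join _ _ ub ub'; exists c => // h.
  rewrite inE => /orP [/eqP ->|/hb hh]; [exact: ksum_sub hb' | exact: ksum_sub hh].
exists b => t tb f hf.
have Vf : V f.
  exists [:: t] => //; exists (fun=> f) => [t'|]; last by rewrite big_seq1 subrr; case: hT.
  by rewrite inE => /eqP ->.
have [phi h1 h2] := span_min (ksum_submodule b) hb (hspan f Vf).
(* The relation f - sum of phi in T, read as a sum of kernel elements over [t :: b]. *)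
pose psi t' := if t' == t then f else - phi t'.
have := @pencil_independent (t :: b) psi; rewrite /= tb ub => /(_ isT) H.
have : T (psi t); last by rewrite /psi eqxx.
apply: H (mem_head _ _) => [t'|].
  rewrite inE /psi; case: eqP => [-> //|_ /= /h1 h].
  by rewrite /ker scalerN; exact: (subspaceN (subspace_full hT) h).
rewrite big_cons {1}/psi eqxx (eq_big_seq (fun t => - phi t)) ?sumrN // => t' t'b.
by rewrite /psi; case: eqP => // E; rewrite -E t'b in tb.
Qed.

End Pencil.

(** Induction on k with the pencil y + t x_k. If both y f and x_k f lie in [jsat k.+1 T], so does f:
    for j < k, apply the hypothesis on y to x_j^N f. For k = 0 the conclusion is empty and y = 0
    will do. *)
Lemma exists_jsat_regular (HK : infinite_field K) T k : submodule full T ->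
  exists2 y : S, y \is 1.-homog & forall f, T (y *: f) -> jsat k T f.
Proof.
move=> hT; elim: k => [|k [y hy IH]]; first by exists 0; rewrite ?rpred0.
have [kn|nk] := ltnP k n; last first.
  exists y => // f /IH h j _; apply/h/(leq_trans (ltn_ord j)) => //.
pose j0 : 'I_n := Ordinal kn.
have hT' := jsat_submodule k.+1 hT.
have [|b hb] := @pencil_regular (jsat k.+1 T) y 'X_j0 hT'.
  move=> f hyf hxf j; rewrite ltnS leq_eqVlt => /orP [/eqP E|jk].
    have -> : j = j0 by apply: val_inj.
    have [N] := hxf j0 (ltnSn k); rewrite scalerA -exprSr => h.
    by exists N.+1.
  have [N] := hyf j (ltnW jk); rewrite scalerA mulrC -scalerA => /IH /(_ j jk) [N' h].
  by exists (N' + N)%N; rewrite exprD -scalerA.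
have [t /hb ht] := HK b.
exists (y + t%:MP * 'X_j0); last first.
  by move=> f hf; apply: ht; move=> j _; exists 0%N; rewrite scale1r.
by rewrite rpredD // mul_mpolyC rpredZ // dhomogX /= mdeg1 eqxx.
Qed.

Lemma exists_regular (HK : infinite_field K) T : submodule full T ->
  (forall f, msat T f -> T f) ->
  exists2 y : S, y \is 1.-homog & forall f, T (y *: f) -> T f.
Proof.
move=> hT hs; have [y hy h] := exists_jsat_regular HK n hT.
by exists y => // f /h /msat_jsat /hs.
Qed.

End Noetherian.

(** * Reverse lexicographic order, colons and sums with a variable *)

Section Revlex.
Local Open Scope ring_scope.
Variables (K : fieldType) (n m : nat) (d : 'I_m -> int).
Local Notation S := {mpoly K[n]}.
Local Notation F := 'rV[S]_m.
Local Notation mon := (fmonomial n m).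
Local Notation inm0 := (inm (@fcoef K n m) (frank d)).
Local Notation IN0 := (IN (@fcoef K n m) (frank d)).
Implicit Types (T P : F -> Prop) (f g h : F) (t s : mon).

Definition fpart (Q : pred mon) f : F :=
  \sum_(t <- fsupp f | Q t) (fcoef f t)%:MP *: fmon K t.

Lemma fcoef_fpart Q f t : fcoef (fpart Q f) t = if Q t then fcoef f t else 0.
Proof.
rewrite /fpart fcoef_sum; under eq_bigr do rewrite fcoefC fcoef_mon.
case: (boolP (t \in fsupp f)) => [tf|]; last first.
  rewrite mem_fsupp negbK => /eqP E; rewrite E if_same big1 // => s _.
  by case: eqP => [->|_]; rewrite ?E ?mul0r ?mulr0.
rewrite big_mkcond (bigD1_seq t) ?fsupp_uniq //= eqxx mulr1 big1 ?addr0 // => s ne.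
by rewrite (negPf ne) mulr0 if_same.
Qed.

Lemma fcoef_free_part f k t :
  fcoef (free_part d f k) t = if fdeg d t == k then fcoef f t else 0.
Proof. by rewrite /fcoef free_part_coef. Qed.

Lemma free_partE f k : free_part d f k = fpart (fun t => fdeg d t == k) f.
Proof. by apply: fcoef_inj => t; rewrite fcoef_free_part fcoef_fpart. Qed.

Lemma fpart_sub f Q P : subspace P -> (forall t, ~~ Q t -> P (fmon K t)) ->
  P (f - fpart Q f).
Proof.
move=> hP h; rewrite [_ - _]fexpand; apply: subspace_sum_seq => // t.
rewrite mem_fsupp fcoefB fcoef_fpart; case: ifP => [_|/negbT/h ht].
  by rewrite subrr eqxx.
by move=> _; case: hP => _ _; apply.
Qed.

Lemma graded_sub_submodule (T : gfree K n d -> Prop) : graded_submodule T -> submodule full (T : F -> Prop).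
Proof. by case. Qed.

Lemma graded_free_part (T : gfree K n d -> Prop) (f : F) k : graded_submodule T ->
  T f -> T (free_part d f k).
Proof.
move=> [hT hg] /hg [s [c [hc ->]]].
have -> : free_part d (\sum_(i <- s) c i) k = \sum_(i <- s | i == k) (c i : F).
  apply: fcoef_inj => t; rewrite fcoef_free_part !fcoef_sum.
  case: ifP => [/eqP E|/negbT ne].
    rewrite [RHS]big_mkcond; apply: eq_bigr => i _; case: ifP => // /negbT ik.
    apply/eqP/contraT; rewrite -mcoeff_msupp => /(proj1 (hc i)) E'.
    by move: ik; rewrite -E -E' eqxx.
  rewrite big1 // => i /eqP ->; apply/eqP/contraT.
  by rewrite -mcoeff_msupp => /(proj1 (hc k)) E; rewrite -E /fdeg eqxx in ne.
rewrite -big_filter; apply: (@subspace_sum _ _ _ T); first exact: subspace_full.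
by move=> i; case: (hc i).
Qed.

Lemma graded_of_free_part (T : gfree K n d -> Prop) : submodule full T ->
  (forall (f : F) k, T f -> T (free_part d f k)) -> graded_submodule T.
Proof.
move=> hT h; split=> // f Tf; have [s [c [hc E]]] := free_hom_sum d f.
exists (undup s), (free_part d f); split=> [k|].
  split; last exact: h.
  move=> j u; rewrite mcoeff_msupp free_part_coef.
  by case: ifP => [/eqP -> //|_]; rewrite eqxx.
apply: (@fcoef_inj K n m) => t.
have -> : fcoef (\sum_(k <- undup s) free_part d f k) t = \sum_(k <- undup s) fcoef (free_part d f k) t.
  exact: fcoef_sum.
under eq_bigr do rewrite fcoef_free_part.
case: (boolP (fdeg d t \in s)) => ht.
  rewrite (bigD1_seq (fdeg d t)) ?undup_uniq ?mem_undup //= eqxx big1 ?addr0 // => k.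
  by rewrite eq_sym => /negPf ->.
rewrite big1_seq => [|k /= ]; last first.
  by rewrite mem_undup => ks; case: eqP => // E'; move: ht; rewrite E' ks.
rewrite E fcoef_sum big1_seq // => k /= ks; apply/eqP/contraT.
by rewrite -mcoeff_msupp => /(hc k) E'; move: ht; rewrite /fdeg E' ks.
Qed.

Lemma fdivX u f : (forall t, fcoef f t != 0 -> (u <= t.1)%MM) ->
  exists g, f = 'X_[u] *: g.
Proof.
move=> h; exists (\sum_(t <- fsupp f) (fcoef f t)%:MP *: fmon K ((t.1 - u)%MM, t.2)).
rewrite {1}[f]fexpand scaler_sumr; apply: eq_big_seq => t.
rewrite mem_fsupp => /h hu; rewrite scalerA mulrC -scalerA fmonX; congr (_ *: fmon K _).
by rewrite /tmul /= addmC submK //; case: (t).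
Qed.

Lemma frank_tmul u s t : (frank d (tmul u s) < frank d (tmul u t))%N =
  (frank d s < frank d t)%N.
Proof.
apply/idP/idP => [|h]; last by apply/frank_lt/flt_tmul/frank_lt.
apply: contraLR; rewrite -!leqNgt leq_eqVlt => /orP [/eqP/frank_inj -> //|].
by move=> h; apply/ltnW/frank_lt/flt_tmul/frank_lt.
Qed.

Lemma inm_fmon t : inm0 (fmon K t) t.
Proof.
split; first by rewrite fcoef_mon eqxx oner_neq0.
by move=> s; rewrite fcoef_mon; case: (eqVneq t s) => [-> _ []|_] //; rewrite eqxx.
Qed.

Lemma inm_mulXV u f t : inm0 ('X_[u] *: f) (tmul u t) -> inm0 f t.
Proof.
move=> [h1 h2]; split; first by rewrite fcoefX in h1.
move=> s hs ne; rewrite -(frank_tmul u); apply: h2; first by rewrite fcoefX.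
by move=> /tmul_inj.
Qed.

Lemma fmon_divX (j : 'I_n) t : (0 < t.1 j)%N ->
  fmon K t = 'X_j *: fmon K ((t.1 - U_(j))%MM, t.2).
Proof.
move=> h; rewrite fmonX /tmul /= addmC submK; first by case: (t).
by rewrite lep1mP -lt0n.
Qed.

Lemma inm_fpart (Q : pred mon) f t : inm0 f t -> Q t -> inm0 (fpart Q f) t.
Proof.
move=> [h1 h2] Qt; split; first by rewrite fcoef_fpart Qt.
by move=> s; rewrite fcoef_fpart; case: ifP => [_|]; [exact: h2 | rewrite eqxx].
Qed.

Variables (P : gfree K n d -> Prop) (j0 : 'I_n).
Hypotheses (gP : graded_submodule P)
  (hP : forall j : 'I_n, (j0 < j)%N -> forall f : F, P ('X_j *: f)).

Let hPs : subspace (P : F -> Prop) := subspace_full (graded_sub_submodule gP).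

Let low : pred mon := fun t => [forall j : 'I_n, (j0 < j)%N ==> (t.1 j == 0%N)].

Let high_in t : ~~ low t -> P (fmon K t).
Proof.
rewrite negb_forall => /existsP [j]; rewrite negb_imply => /andP [jj].
by rewrite -lt0n => /fmon_divX ->; apply: hP.
Qed.

Let lowE t (j : 'I_n) : low t -> (j0 < j)%N -> t.1 j = 0%N.
Proof. by move=> /forallP /(_ j) /implyP h /h /eqP. Qed.

Let low_tmul k t : low t -> low (tmul (U_(j0) *+ k) t).
Proof.
move=> lt; apply/forallP=> j; apply/implyP=> jj; rewrite mnmDE mulmnE mnm1E.
by rewrite (lowE lt jj); case: (eqVneq j0 j) => // E; rewrite E ltnn in jj.
Qed.

(** The characteristic property of the order. Monomials containing later variables lie in P and may
    be dropped; among the remaining ones of equal degree, those below a multiple of x_j0^k are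
    divisible by x_j0^k as well, so f can be divided. *)
Lemma IN_colon t : IN0 (fun f => exists k, P ('X_j0 ^+ k *: f)) t <->
  exists k, IN0 P (tmul (U_(j0) *+ k) t).
Proof.
split=> [[f [k Pf] ft]|[k [f Pf ft]]].
  exists k, ('X_j0 ^+ k *: f) => //; rewrite mpolyXn; exact: inm_mulX.
case: (boolP (low t)) => lt; last first.
  by exists (fmon K t); [exists 0%N; rewrite scale1r; apply: high_in | apply: inm_fmon].
pose k0 := fdeg d (tmul (U_(j0) *+ k) t).
pose f1 := free_part d f k0.
have Pf1 : P f1 by apply: graded_free_part.
have f1t : inm0 f1 (tmul (U_(j0) *+ k) t) by rewrite /f1 free_partE; apply: inm_fpart.
pose f2 := fpart low f1.
have Pf2 : P f2.
  rewrite -[f2](subKr f1); apply: (@subspaceB _ _ _ P) => //.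
  by apply: fpart_sub => // s; apply: high_in.
have f2t : inm0 f2 (tmul (U_(j0) *+ k) t) by apply: inm_fpart => //; apply: low_tmul.
have [g Eg] : exists g, f2 = 'X_[U_(j0) *+ k] *: g.
  apply: fdivX => s hs; apply/mnm_lepP => j; rewrite mulmnE mnm1E.
  case: eqP => [<-|//]; rewrite mul1n.
  have tk : (k <= (tmul (U_(j0) *+ k) t).1 j0)%N.
    by rewrite mnmDE mulmnE mnm1E eqxx mul1n leq_addr.
  have ls : low s by move: hs; rewrite fcoef_fpart; case: ifP => //; rewrite eqxx.
  case: (eqVneq s (tmul (U_(j0) *+ k) t)) => [-> //|/eqP ne].
  (* Let i be the last variable at which s and the initial monomial differ. If i < j0 the exponents
     at j0 agree, if i = j0 that of s is larger, and i > j0 is excluded as s is low. *)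
  apply: leq_trans tk _; case/frank_lt: (f2t.2 s hs ne) => [|[_ [i [h1 h2]]]|[_ -> _] //].
    move: hs; rewrite fcoef_fpart ls fcoef_free_part.
    by case: (eqVneq (fdeg d s) k0) => [->|_]; rewrite ?ltxx ?eqxx.
  case: (ltngtP i j0) => ij.
  - by rewrite h2.
  - by rewrite (lowE ls ij) ltn0 in h1.
  - by move: (val_inj ij) h1 => ->; apply: ltnW.
exists g; last by rewrite Eg in f2t; apply: inm_mulXV f2t.
by exists k; rewrite mpolyXn -Eg.
Qed.

(** If t does not contain x_j0, subtracting x_j0 h changes only monomials containing x_j0, and the
    low ones of these of the degree of t are smaller than t. *)
Lemma IN_add_var t : IN0 (fun f => exists h, P (f - 'X_j0 *: h)) t <->
  (0 < t.1 j0)%N \/ IN0 P t.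
Proof.
split=> [[f [h Ph] ft]|[ht|[f Pf ft]]]; last 2 first.
- exists (fmon K t); last exact: inm_fmon.
  by exists (fmon K ((t.1 - U_(j0))%MM, t.2)); rewrite -fmon_divX // subrr; case: hPs.
- by exists f => //; exists 0; rewrite scaler0 subr0.
case: (posnP (t.1 j0)) => [t0|]; [right|by left].
case: (boolP (low t)) => lt; last by exists (fmon K t); [apply: high_in|apply: inm_fmon].
set p := f - _ in Ph; pose p1 := free_part d p (fdeg d t); pose p2 := fpart low p1.
have Pp1 : P p1 by apply: graded_free_part.
have pE s : s.1 j0 = 0%N -> fcoef p s = fcoef f s.
  move=> s0; rewrite fcoefB; case: (eqVneq (fcoef ('X_j0 *: h) s) 0) => [->|].
    by rewrite subr0.
  by case/fcoefX_neq0 => s' E; rewrite E /= mnmDE mnm1E eqxx in s0.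
exists p2.
  rewrite -[p2](subKr p1); apply: (@subspaceB _ _ _ P) => //.
  by apply: fpart_sub => // s; apply: high_in.
have p2E s : fcoef p2 s = if low s && (fdeg d s == fdeg d t) then fcoef p s else 0.
  by rewrite fcoef_fpart fcoef_free_part; case: (low s).
split; first by rewrite p2E lt eqxx pE //; case: ft.
move=> s; rewrite p2E; case: ifP => [/andP [ls /eqP ds]|]; last by rewrite eqxx.
case: (posnP (s.1 j0)) => [s0|s0 _ _]; first by rewrite pE //; apply: ft.2.
apply/frank_lt/Or32; split=> //; exists j0; rewrite t0; split=> // j jj.
by rewrite (lowE ls jj) (lowE lt jj).
Qed.

End Revlex.

(** * Graded submodules of F *)

Section Grading.
Local Open Scope ring_scope.
Variables (K : fieldType) (n m : nat) (d : 'I_m -> int).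
Local Notation S := {mpoly K[n]}.
Local Notation F := 'rV[S]_m.
Implicit Types (T : gfree K n d -> Prop) (f g h : F).

Lemma free_hom_free_part f k : free_hom d k (free_part d f k).
Proof.
by move=> j u; rewrite mcoeff_msupp free_part_coef; case: ifP => [/eqP|_ /eqP].
Qed.

Lemma free_partB f g k : free_part d (f - g) k = free_part d f k - free_part d g k.
Proof.
apply: fcoef_inj => t; rewrite fcoefB !fcoef_free_part fcoefB.
by case: ifP; rewrite ?subrr.
Qed.

Lemma free_part_sum f : exists s : seq int, forall s', uniq s' -> {subset s <= s'} ->
  f = \sum_(k <- s') free_part d f k.
Proof.
exists (map (fdeg d) (fsupp f)) => s' us' ss'; apply: fcoef_inj => t.
rewrite fcoef_sum; under eq_bigr do rewrite fcoef_free_part.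
case: (boolP (fdeg d t \in s')) => ht.
  rewrite (bigD1_seq (fdeg d t)) //= eqxx big1 ?addr0 // => k.
  by rewrite eq_sym => /negPf ->.
rewrite big1_seq => [|k /= ks]; last first.
  by case: eqP => // E; rewrite E ks in ht.
apply/eqP/contraT; rewrite -mem_fsupp => tf.
by move: ht; rewrite ss' //; apply: map_f.
Qed.

Lemma free_part_homogM (p : S) (i : nat) f k : p \is i.-homog ->
  free_part d (p *: f) (i%:Z + k) = p *: free_part d f k.
Proof.
move=> hp; rewrite -{1}(subrK (free_part d f k) f) scalerDr.
set b := f - _; apply: fcoef_inj => t.
rewrite fcoef_free_part fcoefD.
have -> : fcoef (p *: b) t = if fdeg d t == i%:Z + k then 0 else fcoef (p *: b) t.
  case: ifP => // /eqP dt; apply/eqP/contraT; rewrite -mcoeff_msupp mxE.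
  case/msuppM_le/allpairsP => [[u v] /= [hu hv E]].
  have := dhomog_mf hp hu => /= du.
  have : fcoef b (v, t.2) != 0 by rewrite -mcoeff_msupp.
  rewrite fcoefB fcoef_free_part.
  case: (eqVneq (fdeg d (v, t.2)) k) => [_|/eqP]; first by rewrite subrr eqxx.
  case; move: dt; rewrite /fdeg E mdegD du PoszD -addrA; exact: addrI.
case: (boolP (fdeg d t == i%:Z + k)) => [_|ne]; first by rewrite add0r.
apply/esym/eqP/contraT; rewrite -mcoeff_msupp => /(free_homZ hp (@free_hom_free_part f k)) E.
by move: ne; rewrite /fdeg E eqxx.
Qed.

Lemma dhomog_Xpow (j : 'I_n) N : ('X_j ^+ N : S) \is N.-homog.
Proof. by rewrite mpolyXn dhomogX /= mdegMn mdeg1 mul1n. Qed.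

Lemma msat_graded T : graded_submodule T -> graded_submodule (msat T : gfree K n d -> Prop).
Proof.
move=> gT; apply: graded_of_free_part; first exact/msat_submodule/graded_sub_submodule.
move=> f k hf j; have [N hN] := hf j; exists N.
by rewrite -(free_part_homogM f k (dhomog_Xpow j N)); apply: graded_free_part.
Qed.

(** The submodule T + yF. *)
Definition add_mult T (y : S) : gfree K n d -> Prop :=
  fun f => exists h : F, T (f - y *: h).

Lemma add_mult_submodule T y : submodule full T -> submodule full (add_mult T y).
Proof.
move=> [T0 TD TZ]; split.
- by exists 0; rewrite scaler0 subr0.
- move=> f g [h1 H1] [h2 H2]; exists (h1 + h2).
  by rewrite scalerDr opprD addrACA; apply: TD.
- move=> p f _ [h H]; exists (p *: h).
  by rewrite scalerA (mulrC y) -scalerA -scalerBr; apply: TZ.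
Qed.

Lemma add_mult_graded T y : y \is 1.-homog -> graded_submodule T ->
  graded_submodule (add_mult T y).
Proof.
move=> hy gT; apply: graded_of_free_part.
  exact/add_mult_submodule/graded_sub_submodule.
move=> f k [h Th]; exists (free_part d h (k - 1)).
have -> : free_part d f k - y *: free_part d h (k - 1) = free_part d (f - y *: h) k.
  by rewrite free_partB -(free_part_homogM h (k - 1) hy) [_ + (k - 1)]addrC subrK.
exact: graded_free_part.
Qed.

Lemma add_mult_sub T y f : T f -> add_mult T y f.
Proof. by exists 0; rewrite scaler0 subr0. Qed.

Lemma add_mult_mem T y f : submodule full T -> add_mult T y (y *: f).
Proof. by case=> T0 _ _; exists f; rewrite subrr. Qed.

End Grading.

(** * The graded quotient module F/T *)

Section Quotient.
Local Open Scope ring_scope.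
Local Open Scope quotient_scope.
Variables (K : fieldType) (n m : nat) (d : 'I_m -> int).
Local Notation S := {mpoly K[n]}.
Local Notation F := 'rV[S]_m.
Variables (T : gfree K n d -> Prop) (gT : graded_submodule T).

Let Ts : subspace (T : F -> Prop) := subspace_full (graded_sub_submodule gT).

(** Congruence modulo T, made boolean by excluded middle because quotient types are built on boolean
    relations. *)
Definition qrel (x y : F) : bool :=
  if excluded_middle_informative (T (x - y)) then true else false.

Lemma qrelP x y : reflect (T (x - y)) (qrel x y).
Proof. by rewrite /qrel; case: excluded_middle_informative => h; constructor. Qed.

Lemma qrel_equiv : equiv_class_of qrel.
Proof.
split=> [x|x y|y x z].
- by apply/qrelP; rewrite subrr; case: Ts.
- apply/qrelP/qrelP => /(subspaceN Ts); by rewrite opprB.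
- move=> /qrelP h1 /qrelP h2; apply/qrelP.
  by case: Ts => _ TD _; have := TD _ _ h1 h2; rewrite addrA subrK.
Qed.

Canonical qequiv := EquivRelPack qrel_equiv.
Definition qtype : Type := {eq_quot qequiv}.
HB.instance Definition _ := Choice.on qtype.
HB.instance Definition _ := EqQuotient.on qtype.

Definition qpi (x : F) : qtype := \pi_qtype x.

Lemma qpiP x y : qpi x = qpi y <-> T (x - y).
Proof.
split=> [h|h]; first by apply/qrelP/eqmodP.
by apply/eqmodP/qrelP.
Qed.

Lemma qreprK q : qpi (repr q) = q.
Proof. exact: reprK. Qed.

Definition qadd (p q : qtype) : qtype := qpi (repr p + repr q).
Definition qopp (p : qtype) : qtype := qpi (- repr p).
Definition qscale (a : S) (p : qtype) : qtype := qpi (a *: repr p).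

Let qrepr x : T (repr (qpi x) - x).
Proof. by apply/qpiP; rewrite qreprK. Qed.

Lemma qpiD x y : qadd (qpi x) (qpi y) = qpi (x + y).
Proof.
apply/qpiP; rewrite opprD addrACA; case: Ts => _ TD _; exact: TD.
Qed.

Lemma qpiN x : qopp (qpi x) = qpi (- x).
Proof. by apply/qpiP; rewrite -opprD; apply: (subspaceN Ts). Qed.

Lemma qpiZ a x : qscale a (qpi x) = qpi (a *: x).
Proof. by apply/qpiP; rewrite -scalerBr; case: gT => -[_ _ TZ] _; apply: TZ. Qed.

Lemma qaddA : associative qadd.
Proof. by move=> x y z; rewrite -[x]qreprK -[y]qreprK -[z]qreprK !qpiD addrA. Qed.
Lemma qaddC : commutative qadd.
Proof. by move=> x y; rewrite -[x]qreprK -[y]qreprK !qpiD addrC. Qed.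
Lemma qadd0 : left_id (qpi 0) qadd.
Proof. by move=> x; rewrite -[x]qreprK !qpiD add0r. Qed.
Lemma qaddN : left_inverse (qpi 0) qopp qadd.
Proof. by move=> x; rewrite -[x]qreprK !qpiN !qpiD addNr. Qed.

HB.instance Definition _ := GRing.isZmodule.Build qtype qaddA qaddC qadd0 qaddN.

Lemma qscaleA a b x : qscale a (qscale b x) = qscale (a * b) x.
Proof. by rewrite -[x]qreprK !qpiZ scalerA. Qed.
Lemma qscale1 : left_id 1 qscale.
Proof. by move=> x; rewrite -[x]qreprK !qpiZ scale1r. Qed.
Lemma qscaleDr : right_distributive qscale +%R.
Proof.
move=> a x y; change (qscale a (qadd x y) = qadd (qscale a x) (qscale a y)).
by rewrite -[x]qreprK -[y]qreprK qpiD !qpiZ qpiD scalerDr.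
Qed.
Lemma qscaleDl x : {morph qscale^~ x : a b / a + b}.
Proof.
move=> a b; rewrite -[x]qreprK !qpiZ scalerDl.
exact/esym/qpiD.
Qed.

HB.instance Definition _ := GRing.Zmodule_isLmodule.Build S qtype
  qscaleA qscale1 qscaleDr qscaleDl.

Lemma qpi_linear : linear (qpi : F -> qtype).
Proof.
move=> a x y; have -> : a *: qpi x = qpi (a *: x) := qpiZ a x.
by have -> : qpi (a *: x) + qpi y = qpi (a *: x + y) := qpiD _ _.
Qed.

HB.instance Definition _ := GRing.isLinear.Build S F qtype *:%R qpi qpi_linear.

Definition qhom (k : int) (q : qtype) : Prop :=
  exists f : F, free_hom d k f /\ qpi f = q.

Lemma qhom0 k : qhom k 0.
Proof. by exists 0; split; [apply: free_hom0 | rewrite linear0]. Qed.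

Lemma qhomD k x y : qhom k x -> qhom k y -> qhom k (x + y).
Proof.
move=> [f [hf <-]] [g [hg <-]]; exists (f + g); rewrite linearD.
by split=> //; apply: free_homD.
Qed.

Lemma qhomZ (i : nat) k p x : p \is i.-homog -> qhom k x -> qhom (i%:Z + k) (p *: x).
Proof.
move=> hp [f [hf <-]]; exists (p *: f); rewrite linearZ.
by split=> //; apply: free_homZ.
Qed.

Lemma qhom_sum x : exists (s : seq int) (c : int -> qtype),
  (forall k, qhom k (c k)) /\ x = \sum_(k <- s) c k.
Proof.
have [s [c [hc E]]] := free_hom_sum d (repr x).
exists s, (fun k => qpi (c k)); split=> [k|]; first by exists (c k).
by rewrite -linear_sum -E; exact/esym/qreprK.
Qed.

Lemma qpi_eq0 x : qpi x = 0 <-> T x.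
Proof. by have := qpiP x 0; rewrite subr0 linear0. Qed.

(** Lift the summands to homogeneous elements of F. Their sum is in T, hence so is its part of
    degree k, which is the k-th lift. *)
Lemma qhom_direct (s : seq int) (c : int -> qtype) :
  uniq s -> (forall k, qhom k (c k)) -> \sum_(k <- s) c k = 0 ->
  forall k, k \in s -> c k = 0.
Proof.
move=> us /choice_fun [f hf] sum0 k ks.
have : T (\sum_(k <- s) f k).
  apply/qpi_eq0; rewrite linear_sum -[RHS]sum0; apply: eq_bigr => i _.
  by case: (hf i).
move=> /(graded_free_part k gT) h; case: (hf k) => hk <-; apply/qpi_eq0.
suff <- : free_part d (\sum_(k <- s) f k) k = f k by [].
apply: fcoef_inj => t; rewrite fcoef_free_part fcoef_sum.
have ft i : fcoef (f i) t = if fdeg d t == i then fcoef (f i) t else 0.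
  case: ifP => // /negbT ne; apply/eqP/contraT; rewrite -mcoeff_msupp.
  by move/((hf i).1) => E; move: ne; rewrite /fdeg E eqxx.
rewrite (bigD1_seq k) //= [RHS]ft; case: ifP => // /eqP E.
rewrite big1 ?addr0 // => i ik; rewrite ft E.
by rewrite eq_sym (negPf ik).
Qed.

Lemma qfingen : exists s : seq qtype, forall x, Defs.span full (fun y => y \in s) x.
Proof.
have [s hs] := free_fingen K n m; exists (map qpi s) => x.
have [w [hw E]] := hs (repr x).
exists [seq (c.1, qpi c.2) | c <- w]; split.
  by move=> _ /mapP [c /hw [_ h] ->]; split=> //=; apply: map_f.
rewrite -[x]qreprK E linear_sum big_map; apply: eq_bigr => c _.
by rewrite linearZ.
Qed.

Definition qmodule : gmodule K n :=
  GModule qhom0 qhomD qhomZ qhom_sum qhom_direct qfingen.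

Lemma qmodule_quotient : is_quotient T qmodule.
Proof.
exists (qpi : {linear F -> qtype}); split.
- by move=> y; exists (repr y); apply: qreprK.
- by move=> k x hx; exists x.
- by move=> x; rewrite qpi_eq0.
Qed.

End Quotient.

(** * Powers of the ideal of the variables *)

Section IdealPowers.
Local Open Scope ring_scope.
Variables (K : fieldType) (n r : nat) (A : {mpoly K[n]} -> Prop).
Local Notation S := {mpoly K[n]}.
Hypothesis AE : forall p, A p <-> subpoly r p.

Lemma subpoly1 : subpoly r (1 : S).
Proof. by rewrite -mpolyC1; apply: subpolyC. Qed.

Lemma subpolyM (p q : S) : subpoly r p -> subpoly r q -> subpoly r (p * q).
Proof.
move=> hp hq u /msuppM_le /allpairsP [[a b] /= [ha hb ->]] j rj.
by rewrite mnmDE (hp a ha j rj) (hq b hb j rj).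
Qed.

Let A1 : A 1.
Proof. by apply/AE/subpoly1. Qed.
Let AM a b : A a -> A b -> A (a * b).
Proof. by move=> /AE ha /AE hb; apply/AE/subpolyM. Qed.

Lemma ideal_powX (j : 'I_n) k : (j < r)%N -> ideal_pow A (varideal r) k ('X_j ^+ k).
Proof.
move=> jr; elim: k => [|k IH] /=; first by rewrite expr0.
apply: span_mem => //; exists 'X_j, ('X_j ^+ k); split=> //; last by rewrite exprS.
by apply: span_mem; [apply: subpoly1 | exists j].
Qed.

Lemma varideal_deg (p : S) : varideal r p ->
  subpoly r p /\ forall u, u \in msupp p -> (0 < mdeg u)%N.
Proof.
suff: submodule (M := {mpoly K[n]}^o) (subpoly r)
    (fun p : S => subpoly r p /\ forall u, u \in msupp p -> (0 < mdeg u)%N).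
  move=> hN; apply: (span_min hN) => _ [j jr ->]; split.
    move=> u; rewrite msuppX inE => /eqP -> i ri; rewrite mnm1E.
    by case: eqP => // E; rewrite -E leqNgt jr in ri.
  by move=> u; rewrite msuppX inE => /eqP ->; rewrite mdeg1.
split.
- by split=> u; rewrite msupp0.
- move=> x y [h1 h2] [h3 h4]; split=> u /msuppD_le; rewrite mem_cat => /orP [];
    by [apply: h1 | apply: h2 | apply: h3 | apply: h4].
- move=> a x ha [h1 h2]; split; first exact: subpolyM.
  move=> u /msuppM_le /allpairsP [[b c] /= [hb /h2 hc ->]].
  by rewrite mdegD ltn_addl.
Qed.

Lemma ideal_pow_deg k (p : S) : ideal_pow A (varideal r) k p ->
  subpoly r p /\ forall u, u \in msupp p -> (k <= mdeg u)%N.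
Proof.
elim: k p => [|k IH] p /=; first by move=> /AE.
suff: submodule (M := {mpoly K[n]}^o) A
    (fun p : S => subpoly r p /\ forall u, u \in msupp p -> (k < mdeg u)%N).
  move=> hN; apply: (span_min hN) => _ [a [b [/varideal_deg [h1 h2] /IH [h3 h4] ->]]].
  split; first exact: subpolyM.
  move=> u /msuppM_le /allpairsP [[c e] /= [/h2 hc /h4 he ->]].
  by rewrite mdegD -add1n leq_add.
split.
- by split=> u; rewrite msupp0.
- move=> x y [h1 h2] [h3 h4]; split=> u /msuppD_le; rewrite mem_cat => /orP [];
    by [apply: h1 | apply: h2 | apply: h3 | apply: h4].
- move=> a x /AE ha [h1 h2]; split; first exact: subpolyM.
  move=> u /msuppM_le /allpairsP [[b c] /= [hb /h2 hc ->]].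
  by rewrite mdegD ltn_addl.
Qed.

End IdealPowers.

Lemma full_subpoly (K : fieldType) n (p : {mpoly K[n]}) : full p <-> subpoly n p.
Proof. by split=> // _ u _ j; rewrite leqNgt ltn_ord. Qed.

(** * The axioms of sdeg for quotients of F *)

Section Sdeg.
Local Open Scope ring_scope.
Variables (K : fieldType) (n m : nat) (d : 'I_m -> int).
Local Notation S := {mpoly K[n]}.
Local Notation F := 'rV[S]_m.
Implicit Types (T Y : gfree K n d -> Prop) (f g h : F).

(** Homogeneous components are unique in N, so the part of degree k of any lift of x is already a
    lift. *)
Lemma quotient_hom_lift (N : gmodule K n) (phi : {linear gfree K n d -> N}) k (x : N) :
  (forall y, exists x, phi x = y) -> (forall k x, ghom k x -> ghom k (phi x)) ->
  ghom k x -> exists f : F, free_hom d k f /\ phi f = x.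
Proof.
move=> surj hom hx; have [f Ef] := surj x.
have [s hs] := free_part_sum d f.
pose s' := undup (k :: s).
have us' : uniq s' by apply: undup_uniq.
have ks' : k \in s' by rewrite mem_undup mem_head.
have Ef' : f = \sum_(i <- s') free_part d f i.
  by apply: hs => // i hi; rewrite mem_undup inE hi orbT.
pose c i : N := phi (free_part d f i) - (if i == k then x else 0).
exists (free_part d f k); split; first exact: free_hom_free_part.
have hNx i (y : N) : ghom i y -> ghom i (- y).
  move=> hy; rewrite -scaleN1r -[i]add0r; apply: (@ghomZ _ _ N 0) => //.
  by rewrite rpredN; apply: dhomog1.
have hc i : ghom i (c i).
  apply: ghomD; first by apply/hom/free_hom_free_part.
  apply: hNx; case: eqP => [->//|_]; exact: ghom0.
have sum0 : \sum_(i <- s') c i = 0.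
  rewrite sumrB -linear_sum.
  have -> : \sum_(i <- s') free_part d f i = f by rewrite [RHS]Ef'.
  rewrite Ef (bigD1_seq k) //= eqxx big1 ?addr0 ?subrr // => i /negPf -> //.
have := ghom_direct us' hc sum0 ks'.
by rewrite /c eqxx => /eqP; rewrite subr_eq0 => /eqP.
Qed.

(** The isomorphism (F/T1)/(T2/T1) = F/T2, where both quotients of F are known only up to
    isomorphism. *)
Lemma quotient_factor T1 T2 (N N' : gmodule K n)
    (phi : {linear gfree K n d -> N}) (V : N -> Prop) :
  (forall y, exists x, phi x = y) -> (forall k x, ghom k x -> ghom k (phi x)) ->
  (forall x, T1 x <-> phi x = 0) -> is_quotient T2 N' ->
  (forall f, T1 f -> T2 f) -> (forall f, V (phi f) <-> T2 f) -> is_quotient V N'.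
Proof.
move=> surj hom ker [phi2 [surj2 hom2 ker2]] sub VE.
have [rep hrep] := choice_fun surj.
have eq2 f g : phi f = phi g -> phi2 f = phi2 g.
  move=> E; apply/eqP; rewrite -subr_eq0 -linearB; apply/eqP/ker2/sub/ker.
  by rewrite linearB E subrr.
pose psi (x : N) : N' := phi2 (rep x).
have psiE f : psi (phi f) = phi2 f by apply: eq2; rewrite hrep.
have psi_lin : linear psi.
  move=> a x y; rewrite -[x]hrep -[y]hrep -linearP !psiE.
  by rewrite linearP.
pose psiL := HB.pack_for {linear N -> N'} psi (GRing.isLinear.Build _ _ _ _ psi psi_lin).
exists psiL; split.
- by move=> y; have [f <-] := surj2 y; exists (phi f); apply: psiE.
- move=> k x hx; have [f [hf <-]] := quotient_hom_lift surj hom hx.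
  have -> : psiL (phi f) = phi2 f by apply: psiE.
  exact: hom2.
- move=> x; have [f <-] := surj x; have -> : psiL (phi f) = phi2 f by apply: psiE.
  by split=> [/VE/ker2|/ker2/VE].
Qed.

(** Chains correspond by taking images and preimages under [phi]. *)
Lemma length_quotient T Y (N : gmodule K n) (phi : {linear gfree K n d -> N})
    (V : N -> Prop) l :
  (forall y, exists x, phi x = y) -> (forall x, T x <-> phi x = 0) ->
  (forall f, V (phi f) <-> Y f) ->
  length_is full T Y l -> length_is full (fun x : N => x = 0) V l.
Proof.
move=> surj ker VE [[C [C0 Cl hC lt]] hmax]; split.
  have TC i : (i <= l)%N -> forall f, T f -> C i f.
    elim: i => [_ f Tf|i IH il f Tf]; [exact/C0 | have [h _] := lt i il].
    by apply/h/IH => //; apply: ltnW.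
  exists (fun i x => exists2 f, C i f & phi f = x); split.
  - by move=> x; split=> [[f /C0/ker h <-]//|->]; exists 0; rewrite ?linear0 //; apply/C0/ker; rewrite linear0.
  - move=> x; split=> [[f /Cl/VE h <-]//|]; have [f <-] := surj x => /VE/Cl Cf.
    by exists f.
  - move=> i il; have [h0 hD hZ] := hC i il; split.
    + by exists 0 => //; rewrite linear0.
    + by move=> _ _ [f hf <-] [g hg <-]; exists (f + g); [apply: hD | rewrite linearD].
    + by move=> a _ _ [f hf <-]; exists (a *: f); [apply: hZ | rewrite linearZ].
  - move=> i il; have [sub [f [h1 h2]]] := lt i il; split.
      by move=> _ [g /sub hg <-]; exists g.
    exists (phi f); split; first by exists f.
    case=> g hg E; apply: h2; have [h0 hD hZ] := hC i (ltnW il).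
    rewrite -[f](subrK g); apply: hD => //; apply: TC; first exact: ltnW.
    by apply/ker; rewrite linearB E subrr.
move=> D l' [D0 Dl hD lt']; apply: (hmax (fun i f => D i (phi f))); split.
- by move=> f; split=> [/D0/ker|/ker/D0].
- by move=> f; split=> [/Dl/VE|/VE/Dl].
- move=> i il; have [h0 hA hZ] := hD i il; split; first by rewrite linear0.
    by move=> f g hf hg; rewrite linearD; apply: hA.
  by move=> a f _ hf; rewrite linearZ; apply: hZ.
- move=> i il; have [sub [x [h1 h2]]] := lt' i il; split; first by move=> f; apply: sub.
  by have [f Ef] := surj x; exists f; rewrite Ef.
Qed.

Lemma local_cohomology0E T (N : gmodule K n) (phi : {linear gfree K n d -> N}) f :
  submodule full T -> (forall x, T x <-> phi x = 0) ->
  @local_cohomology0 _ _ N (phi f) <-> msat (T : F -> Prop) f.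
Proof.
move=> hT ker; split.
  case=> _ [k _ hk] j; exists k; apply/ker; rewrite linearZ; apply: hk.
  by apply: ideal_powX; [exact: full_subpoly | exact: ltn_ord].
move=> /(msat_deg hT) [k hk]; split=> //; exists k.+1 => // p hp.
have [_ h] := ideal_pow_deg (@full_subpoly K n) hp.
by rewrite -linearZ; apply/ker/hk => u /h /ltnW.
Qed.

Lemma length_msat coef (rank : fmonomial n m -> nat) (T : F -> Prop) (s : seq (fmonomial n m)) :
  is_coef coef -> injective rank -> submodule full T -> uniq s ->
  (forall t, t \in s <-> IN coef rank (msat T) t /\ ~ IN coef rank T t) ->
  length_is full T (msat T) (size s).
Proof.
move=> hc rinj hT us hs; apply: (length_IN hc rinj (@full_subpoly K n) (s := s)) => //.
- exact: msat_submodule.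
- by move=> f; apply: msat_sub.
Qed.

Lemma seq_of_finite (I : eqType) (Q : I -> Prop) (s : seq I) :
  (forall t, Q t -> t \in s) -> exists s', uniq s' /\ forall t, t \in s' <-> Q t.
Proof.
move=> h; pose q t := if excluded_middle_informative (Q t) then true else false.
have qP t : q t <-> Q t by rewrite /q; case: excluded_middle_informative.
exists [seq t <- undup s | q t]; split; first by rewrite filter_uniq ?undup_uniq.
move=> t; rewrite mem_filter mem_undup; split=> [/andP [/qP]//|Qt].
by rewrite h // andbT; apply/qP.
Qed.

Lemma length_msat_exists (T : F -> Prop) : submodule full T ->
  exists l, length_is full T (msat T) l.
Proof.
move=> hT; have rinj := @frank_inj n m (fun=> 0).
have [s hs] := msat_finite (fcoef_is_coef K n m) rinj hT.
have [s' [us' hs']] := seq_of_finite (fun t (h : IN _ _ _ t /\ ~ IN _ _ _ t) => hs t h.1 h.2).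
exists (size s'); exact: (length_msat (fcoef_is_coef K n m) rinj hT us' hs').
Qed.

Variables (sdeg : gmodule K n -> nat) (Hsdeg : smallest_extended_degree sdeg).

(** Quantifying over all presentations of F/T keeps isomorphisms out of the inductions. *)
Definition sv T s : Prop := forall N, is_quotient T N -> sdeg N = s.

Lemma sdeg_msat T l N N' : graded_submodule T -> length_is full T (msat (T : F -> Prop)) l ->
  is_quotient T N -> is_quotient (msat (T : F -> Prop) : gfree K n d -> Prop) N' -> sdeg N = (sdeg N' + l)%N.
Proof.
move=> gT hl [phi [surj hom ker]] hN'; case: Hsdeg => ax1 _ _.
have VE f : local_cohomology0 (phi f) <-> msat (T : F -> Prop) f.
  exact: (local_cohomology0E f (graded_sub_submodule gT) ker).
apply: ax1; last exact: (length_quotient surj ker VE hl).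
by apply: (quotient_factor surj hom ker hN') => // f; apply: msat_sub.
Qed.

Lemma sv_msat T l s : graded_submodule T -> length_is full T (msat (T : F -> Prop)) l ->
  sv (msat (T : F -> Prop) : gfree K n d -> Prop) s -> sv T (s + l)%N.
Proof.
move=> gT hl hs N hN.
have hQ := qmodule_quotient (msat_graded gT).
by rewrite (sdeg_msat gT hl hN hQ) (hs _ hQ).
Qed.

(** Invariance under isomorphism is not an axiom. It follows from the first one, as the same model
    of F/T^sat may be used for N and for N'. *)
Lemma sdeg_quotient_uniq T N N' : graded_submodule T ->
  is_quotient T N -> is_quotient T N' -> sdeg N = sdeg N'.
Proof.
move=> gT hN hN'; have [l hl] := length_msat_exists (graded_sub_submodule gT).
have hQ := qmodule_quotient (msat_graded gT).
by rewrite (sdeg_msat gT hl hN hQ) (sdeg_msat gT hl hN' hQ).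
Qed.

(** The axiom is applied to the constructed quotient [Q], so that the open set depends on T
    alone. *)
Lemma sv_add_mult T : graded_submodule T ->
  exists2 O, nonempty_open (@linform_coord K n) O &
    forall y, O y -> (forall f : F, T (val y *: f) -> T f) ->
    forall s, sv (add_mult T (val y)) s -> sv T s.
Proof.
move=> gT; have hQ := qmodule_quotient gT; pose Q := qmodule gT.
case: Hsdeg => _ /(_ Q) [O hO ax2] _; exists O => // y Oy reg s hs N hN.
rewrite (sdeg_quotient_uniq gT hN hQ).
have hQ' := qmodule_quotient (add_mult_graded (valP y) gT).
rewrite -(hs _ hQ'); have [phi [surj hom ker]] := hQ.
apply: (ax2 y Oy).
  move=> x; have [f <-] := surj x; rewrite -linearZ => /ker/reg/ker.
  by [].
apply: (quotient_factor surj hom ker hQ') => [f|f]; first exact: add_mult_sub.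
split=> [[x]|[h Th]].
  have [h <-] := surj x; rewrite -linearZ => /eqP; rewrite -subr_eq0 -linearB.
  by move=> /eqP/ker Th; exists h.
exists (phi h); rewrite -linearZ; apply/eqP; rewrite -subr_eq0 -linearB.
exact/eqP/ker.
Qed.

Lemma sv_full T : (forall f, T f) -> sv T 0.
Proof.
move=> hT N [phi [surj _ ker]]; case: Hsdeg => _ _; apply=> x.
by have [f <-] := surj x; apply/ker.
Qed.

Lemma sv_ext T Y s : (forall f, T f <-> Y f) -> sv T s -> sv Y s.
Proof.
move=> E hT N [phi [surj hom ker]]; apply: hT; exists phi; split=> // x.
by split=> [/E/ker|/ker/E].
Qed.

End Sdeg.

(** * Linear substitutions of the variables *)

Section LinearSubstitution.
Local Open Scope ring_scope.
Variables (K : fieldType) (n : nat).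
Local Notation S := {mpoly K[n]}.
Implicit Types (A B : 'M[K]_n) (p q : S).

Definition lform A (i : 'I_n) : S := \sum_j A i j *: 'X_j.

Definition lsubst A : S -> S := comp_mpoly [tuple lform A i | i < n].

HB.instance Definition _ A := GRing.RMorphism.on (lsubst A).

Lemma lsubstX A (i : 'I_n) : lsubst A 'X_i = lform A i.
Proof. by rewrite /lsubst comp_mpolyXU -tnth_nth tnth_mktuple. Qed.

Lemma lsubstC A c : lsubst A c%:MP = c%:MP.
Proof. exact: comp_mpolyC. Qed.

Lemma lsubstZ A c p : lsubst A (c *: p) = c *: lsubst A p.
Proof. exact: comp_mpolyZ. Qed.

Lemma lform_row A B (i : 'I_n) : (forall j, A i j = B i j) -> lform A i = lform B i.
Proof. by move=> h; apply: eq_bigr => j _; rewrite h. Qed.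

Lemma lform1 (i : 'I_n) : lform 1%:M i = 'X_i.
Proof.
rewrite /lform (bigD1 i) //= mxE eqxx scale1r big1 ?addr0 // => j ne.
by rewrite mxE eq_sym (negPf ne) scale0r.
Qed.

Lemma lform_homog A (i : 'I_n) : lform A i \is 1.-homog.
Proof. by apply: rpred_sum => j _; rewrite rpredZ // dhomogX /= mdeg1 eqxx. Qed.

Lemma lsubst_lform A B (i : 'I_n) : lsubst A (lform B i) = lform (B *m A) i.
Proof.
rewrite /lform (raddf_sum (lsubst A)) /=.
under eq_bigr do rewrite lsubstZ lsubstX scaler_sumr.
rewrite exchange_big; apply: eq_bigr => k _; rewrite mxE scaler_suml.
by apply: eq_bigr => j _; rewrite scalerA.
Qed.

Lemma lsubst_monE A u : lsubst A 'X_[u] = \prod_(i < n) lform A i ^+ u i.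
Proof. by rewrite /lsubst comp_mpolyX; apply: eq_bigr => i _; rewrite tnth_mktuple. Qed.

(** The rows of a matrix are the images of the variables, hence the reversed product. *)
Lemma lsubst_comp A B p : lsubst A (lsubst B p) = lsubst (B *m A) p.
Proof.
rewrite [p]mpolyE (raddf_sum (lsubst B)) (raddf_sum (lsubst A)) (raddf_sum (lsubst (B *m A))) /=.
apply: eq_bigr => u _; rewrite !lsubstZ; congr (_ *: _).
rewrite !lsubst_monE rmorph_prod; apply: eq_bigr => i _.
by rewrite rmorphXn /= lsubst_lform.
Qed.

Lemma lsubst1 p : lsubst 1%:M p = p.
Proof.
rewrite -[RHS]comp_mpoly_id; congr (p \mPo _); apply: eq_from_tnth => i.
by rewrite !tnth_mktuple lform1.
Qed.

Lemma lsubst_homog A p k : p \is k.-homog -> lsubst A p \is k.-homog.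
Proof.
move=> hp; rewrite [p]mpolyE (raddf_sum (lsubst A)) big_seq; apply: rpred_sum => u up /=.
rewrite lsubstZ rpredZ // lsubst_monE.
have := dhomog_mf hp up => /= <-; rewrite mdegE.
elim/big_rec2: _ => [|i y1 y2 _ h]; first exact: dhomog1.
by apply: dhomogM => //; have := dhomogMn (u i) (lform_homog A i); rewrite mul1n.
Qed.

Lemma lsubstK A : A \in unitmx -> cancel (lsubst (invmx A)) (lsubst A).
Proof. by move=> uA p; rewrite lsubst_comp mulVmx // lsubst1. Qed.

Lemma lsubstVK A : A \in unitmx -> cancel (lsubst A) (lsubst (invmx A)).
Proof. by move=> uA p; rewrite lsubst_comp mulmxV // lsubst1. Qed.

Lemma homog1E (z : S) : z \is 1.-homog -> z = \sum_j z@_U_(j) *: 'X_j.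
Proof.
move=> hz; apply/mpolyP => u; rewrite linear_sum /=.
under eq_bigr do rewrite mcoeffZ mcoeffX.
case: (boolP (mdeg u == 1%N)) => [/mdeg1P [i /eqP ->]|ne].
  rewrite (bigD1 i) //= eqxx mulr1 big1 ?addr0 // => j ji.
  by rewrite eq_mnm1 (negPf ji) mulr0.
rewrite (dhomog_nemf_coeff hz ne) big1 // => j _.
by case: (eqVneq U_(j)%MM u) => [E|_]; [rewrite -E mdeg1 in ne | rewrite mulr0].
Qed.

End LinearSubstitution.

(** * The action of the group of coordinate changes *)

Section Action.
Local Open Scope ring_scope.
Variables (K : fieldType) (n m : nat) (d : 'I_m -> int).
Local Notation S := {mpoly K[n]}.
Local Notation F := 'rV[S]_m.
Implicit Types (f h : F) (g : gaut K n d) (T : F -> Prop).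

Lemma gaut_actE g f : gaut_act g f = map_mx (lsubst (gvar g)) f *m gbas g.
Proof. by []. Qed.

Definition ginv g f : F := map_mx (lsubst (invmx (gvar g))) (f *m invmx (gbas g)).

Lemma gaut_actD g f h : gaut_act g (f + h) = gaut_act g f + gaut_act g h.
Proof. by rewrite !gaut_actE map_mxD mulmxDl. Qed.

Lemma gaut_actZ g (a : S) f : gaut_act g (a *: f) = lsubst (gvar g) a *: gaut_act g f.
Proof. by rewrite !gaut_actE map_mxZ scalemxAl. Qed.

Lemma ginvD g f h : ginv g (f + h) = ginv g f + ginv g h.
Proof. by rewrite /ginv mulmxDl map_mxD. Qed.

Lemma ginvZ g (a : S) f : ginv g (a *: f) = lsubst (invmx (gvar g)) a *: ginv g f.
Proof. by rewrite /ginv -scalemxAl map_mxZ. Qed.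

Lemma gactK g : cancel (gaut_act g) (ginv g).
Proof.
move=> f; rewrite /ginv gaut_actE mulmxK ?gbas_unit // -map_mx_comp.
by apply/rowP => j; rewrite mxE /= lsubstVK // gvar_unit.
Qed.

Lemma ginvK g : cancel (ginv g) (gaut_act g).
Proof.
move=> f; rewrite /ginv gaut_actE -map_mx_comp.
rewrite (_ : map_mx _ _ = f *m invmx (gbas g)) ?mulmxKV ?gbas_unit //.
by apply/rowP => j; rewrite mxE /= lsubstK // gvar_unit.
Qed.

Lemma ginv0 g : ginv g 0 = 0.
Proof. by have := ginvZ g 0 0; rewrite scaler0 rmorph0 scale0r. Qed.

Lemma gaut_act0 g : gaut_act g 0 = 0.
Proof. by have := gaut_actZ g 0 0; rewrite scaler0 rmorph0 scale0r. Qed.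

Lemma gaut_act_sum g (I : Type) (r : seq I) (G : I -> F) :
  gaut_act g (\sum_(i <- r) G i) = \sum_(i <- r) gaut_act g (G i).
Proof.
apply: (big_morph (gaut_act g)); [exact: gaut_actD | exact: gaut_act0].
Qed.

Lemma ginvN g f : ginv g (- f) = - ginv g f.
Proof. by rewrite -scaleN1r ginvZ rmorphN1 scaleN1r. Qed.

Lemma ginvB g f h : ginv g (f - h) = ginv g f - ginv g h.
Proof. by rewrite ginvD ginvN. Qed.

Lemma gaut_act_hom g f k : free_hom d k f -> free_hom d k (gaut_act g f).
Proof.
move=> hf j u; rewrite gaut_actE mxE => /msupp_sum_le.
case/flatten_mapP => i; rewrite mem_filter => /andP [_ _] /msuppM_le.
case/allpairsP => [[a b] /= [ha hb ->]]; rewrite mxE in ha.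
have hb' := gbas_hom (j := j) (u := b) (g := g) (i := i); rewrite mxE in hb'.
have := hb' hb; rewrite mdegD PoszD -addrA => ->.
(* When k < d i no natural number z has z + d i = k, but then the entry is zero. *)
have [z [hz E]] : exists z : nat, f 0 i \is z.-homog /\ (f 0 i == 0) || (z%:Z + d i == k).
  case: (eqVneq (f 0 i) 0) => [->|ne]; first by exists 0%N; split; rewrite ?rpred0.
  have vi := mlead_supp ne; exists (mdeg (mlead (f 0 i))); split; last first.
    by rewrite (hf i _ vi) eqxx orbT.
  apply/dhomogP => v hv /=; apply/eqP; rewrite -eqz_nat; apply/eqP.
  by apply: (@addIr _ (d i)); rewrite (hf i _ hv) (hf i _ vi).
have := dhomog_mf (lsubst_homog (gvar g) hz) ha => /= ->.
case/orP: E => /eqP // E; move: ha; rewrite E rmorph0 msupp0 //.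
Qed.

Lemma gaut_act_free_part g f k :
  free_part d (gaut_act g f) k = gaut_act g (free_part d f k).
Proof.
have [s hs] := free_part_sum d f.
pose s' := undup (k :: s); have us' : uniq s' by apply: undup_uniq.
have {hs}E : f = \sum_(i <- s') free_part d f i.
  by apply: hs => // i hi; rewrite mem_undup inE hi orbT.
pose h i := gaut_act g (free_part d f i).
have hk i t : fcoef (h i) t = if fdeg d t == i then fcoef (h i) t else 0.
  case: ifP => // /negbT ne; apply/eqP/contraT; rewrite -mcoeff_msupp.
  move=> /(@gaut_act_hom g _ _ (@free_hom_free_part _ _ _ d f i)) E'.
  by move: ne; rewrite /fdeg E' eqxx.
apply: fcoef_inj => t; rewrite fcoef_free_part {1}E gaut_act_sum fcoef_sum.
rewrite [RHS]hk; case: (eqVneq (fdeg d t) k) => // dt.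
rewrite (bigD1_seq k) ?mem_undup ?mem_head //= big1 ?addr0 // => i ik.
by rewrite (hk i t) dt eq_sym (negPf ik).
Qed.

(** This lets initial monomials of g(T) be computed in T, without moving T. *)
Lemma gaut_act_is_coef g : is_coef (fun f => fcoef (gaut_act g f)).
Proof.
split=> [f h t|c f t|f|f h].
- by rewrite gaut_actD fcoefD.
- by rewrite gaut_actZ lsubstC fcoefC.
- by exists (fsupp (gaut_act g f)) => t; rewrite mem_fsupp.
- rewrite -[f](gactK g); have -> : gaut_act g f = 0; last exact: ginv0.
  by apply: fcoef_inj => t; rewrite h fcoef0.
Qed.

Definition gim g T : F -> Prop := fun f => T (ginv g f).

Lemma gim_submodule g T : submodule full T -> submodule full (gim g T).
Proof.
case=> T0 TD TZ; split; rewrite /gim.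
- by rewrite ginv0.
- by move=> f h hf hh; rewrite ginvD; apply: TD.
- by move=> a f _ hf; rewrite ginvZ; apply: TZ.
Qed.

Lemma gim_graded g (T : gfree K n d -> Prop) : graded_submodule T ->
  graded_submodule (gim g T : gfree K n d -> Prop).
Proof.
move=> gT; apply: graded_of_free_part; first exact/gim_submodule/graded_sub_submodule.
move=> f k hf; rewrite /gim -[f](ginvK g) gaut_act_free_part gactK.
exact: graded_free_part.
Qed.

Lemma IN_gim g T (rank : fmonomial n m -> nat) t :
  IN (@fcoef K n m) rank (gim g T) t <-> IN (fun f => fcoef (gaut_act g f)) rank T t.
Proof.
split=> [[f hf ft]|[f Tf ft]]; first by exists (ginv g f); rewrite // /inm ginvK.
by exists (gaut_act g f); rewrite // /gim gactK.
Qed.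

(** A substitution turns x_j^N into a form of degree N, to which the degree bound of [msat_deg]
    applies. *)
Lemma gim_msat g T f : submodule full T -> gim g (msat T) f <-> msat (gim g T) f.
Proof.
move=> hT; split=> h.
  have [N hN] := msat_deg hT h => j; exists N.
  rewrite /gim ginvZ; apply: hN => u.
  by move=> /(dhomog_mf (lsubst_homog _ (dhomog_Xpow K j N))) /= ->.
have [N hN] := msat_deg (gim_submodule g hT) h => j; exists N.
rewrite -(gactK g ('X_j ^+ N *: ginv g f)) gaut_actZ ginvK; apply: hN => u.
by move=> /(dhomog_mf (lsubst_homog _ (dhomog_Xpow K j N))) /= ->.
Qed.

Lemma gim_add_mult g (T : F -> Prop) (y : S) f :
  gim g (add_mult (d := d) T y) f <-> add_mult (d := d) (gim g T) (lsubst (gvar g) y) f.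
Proof.
split=> -[h hh].
  exists (gaut_act g h).
  by rewrite /gim ginvB ginvZ gactK lsubstVK ?gvar_unit.
exists (ginv g h); move: hh.
by rewrite /gim ginvB ginvZ lsubstVK ?gvar_unit.
Qed.

End Action.

(** * Combinatorics of the colon sequence *)

Section ColonSequence.
Local Open Scope ring_scope.
Variables (K : fieldType) (n m : nat) (W : 'rV[{mpoly K[n]}]_m -> Prop).
Local Notation mon := (fmonomial n m).
Implicit Types (t : mon).

(* Iset i and Jset i turn out to be the sets of initial monomials of the i-th
   module of the chain and of its saturation. *)
Definition high i t : Prop := exists j : 'I_n, (n - i <= j)%N /\ (0 < t.1 j)%N.

Definition Iset i t : Prop := high i t \/ colon_seq W i (fmon K t).

Definition Jset i t : Prop :=
  high i t \/ (n <= i)%N \/ colon_seq W i.+1 (fmon K t).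

(** This number depends only on W and i; it links the lengths for F/U, for F/W and for the
    algorithm. *)
Definition card_JI i l : Prop := exists s : seq mon,
  [/\ uniq s, size s = l & forall t, t \in s <-> Jset i t /\ ~ Iset i t].

Section Step.
Variables (i : nat) (j : 'I_n).
Hypothesis ji : (j + i.+1)%N = n.

Lemma colon_seqS f : colon_seq W i.+1 f <-> exists k, colon_seq W i ('X_j ^+ k *: f).
Proof.
split=> [[j' Ej [k h]]|h]; last by exists j.
have -> : j = j' by apply: val_inj => /=; move: Ej ji => /=; lia.
by exists k.
Qed.

(** Mirrors [IN_colon]: passing to the saturation is dividing by powers of the next variable. *)
Lemma Jset_colon t : Jset i t <-> exists k, Iset i (tmul (U_(j) *+ k) t).
Proof.
split.
  case=> [h|[ni|/colon_seqS [k h]]].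
  - by exists 0%N; left; rewrite tmul0.
  - by exfalso; move: ni ji; lia.
  - by exists k; right; rewrite -fmonX -mpolyXn.
case=> k [[a [h1 h2]]|h]; [left|right;right].
  exists a; split=> //; move: h2; rewrite mnmDE mulmnE mnm1E.
  by case: eqP => [E|//]; move: h1; rewrite -E; lia.
by apply/colon_seqS; exists k; rewrite mpolyXn fmonX.
Qed.

(** Mirrors [IN_add_var]: the next cut adds the multiples of one variable. *)
Lemma IsetS t : Iset i.+1 t <-> (0 < t.1 j)%N \/ Jset i t.
Proof.
have ni : (i < n)%N by move: ji; lia.
split.
  case=> [[a [h1 h2]]|h]; last by right; right; right.
  case: (ltnP a (n - i)) => ai; last by right; left; exists a.
  by left; have <- : a = j by apply: val_inj => /=; move: ji; lia.
case=> [h|[[a [h1 h2]]|[|h]]].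
- by left; exists j; split=> //; move: ji; lia.
- by left; exists a; split=> //; move: h1; lia.
- by rewrite leqNgt ni.
- by right.
Qed.

End Step.

(** At i = n no variable is left and the saturation is all of F; the middle alternative in [Jset]
    records this. *)
Lemma Jset_last t : Jset n t.
Proof. by right; left. Qed.

Lemma ord_of_step i : (i < n)%N -> exists j : 'I_n, (j + i.+1)%N = n.
Proof.
move=> lt; have h : (n - i.+1 < n)%N by lia.
by exists (Ordinal h) => /=; lia.
Qed.

End ColonSequence.

(** * The chain of general hyperplane sections and its initial monomials *)

Section Chain.
Local Open Scope ring_scope.
Variables (K : fieldType) (n m : nat) (d : 'I_m -> int).
Local Notation S := {mpoly K[n]}.
Local Notation F := 'rV[S]_m.
Local Notation IN0 := (IN (@fcoef K n m) (frank d)).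
Variables (U : gfree K n d -> Prop) (gU : graded_submodule U).
Implicit Types (A : 'M[K]_n) (i : nat).

(* Cut F/U successively by the last rows of A, dividing out H^0 each time. *)
Fixpoint chain A i : gfree K n d -> Prop :=
  if i is i'.+1 then fun f =>
    exists2 j : 'I_n, (j + i'.+1)%N = n & add_mult (d := d) (msat (chain A i')) (lform A j) f
  else U.

Lemma chainS A i (j : 'I_n) f : (j + i.+1)%N = n ->
  chain A i.+1 f <-> add_mult (d := d) (msat (chain A i)) (lform A j) f.
Proof.
move=> ji; split=> [[j' Ej h]|h]; last by exists j.
by have -> : j = j' by apply: val_inj => /=; move: Ej ji => /=; lia.
Qed.

Lemma graded_ext (T T' : gfree K n d -> Prop) :
  (forall f, T f <-> T' f) -> graded_submodule T -> graded_submodule T'.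
Proof.
move=> E gT; apply: graded_of_free_part.
  exact: submodule_ext E (graded_sub_submodule gT).
by move=> f k /E h; apply/E; apply: graded_free_part.
Qed.

Lemma chain_graded A i : (i <= n)%N -> graded_submodule (chain A i).
Proof.
elim: i => [//|i IH] ni; have [j ji] := ord_of_step ni.
apply: (graded_ext (T := add_mult (msat (chain A i)) (lform A j))).
  by move=> f; split=> /(chainS A f ji).
by apply: add_mult_graded; [exact: lform_homog | apply/msat_graded/IH/ltnW].
Qed.

Lemma chain_submodule A i : (i <= n)%N -> submodule full (chain A i : F -> Prop).
Proof. by move=> ni; apply/graded_sub_submodule/chain_graded. Qed.

Lemma chain_high A i (a : 'I_n) (f : F) : (i <= n)%N -> (n - i <= a)%N ->
  chain A i (lform A a *: f).
Proof.
elim: i f => [|i IH] f ni ha; first by move: ha; rewrite subn0 leqNgt ltn_ord.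
have [j ji] := ord_of_step ni; apply/(chainS A _ ji).
case: (ltnP a (n - i)) => ai.
  have -> : a = j by apply: val_inj => /=; move: ji; lia.
  by apply: add_mult_mem; apply/msat_submodule/chain_submodule/ltnW.
by apply/add_mult_sub/msat_sub/IH => //; apply: ltnW.
Qed.

Lemma msat_ext (T T' : F -> Prop) f : (forall f, T f <-> T' f) -> msat T f -> msat T' f.
Proof. by move=> E h j; have [N /E hN] := h j; exists N. Qed.

(** Only the last i rows enter the first i cuts, so a row can be chosen after the cuts that precede
    it. *)
Lemma chain_local A A' i f : (forall a b : 'I_n, (n - i <= a)%N -> A a b = A' a b) ->
  chain A i f -> chain A' i f.
Proof.
elim: i A A' f => [//|i IH] A A' f E [j ji [h hh]]; exists j => //; exists h.
rewrite -(lform_row (A := A)); last by move=> b; apply: E; move: ji; lia.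
apply: msat_ext hh => f'; split; apply: IH => a b ha; [|apply/esym]; apply: E; lia.
Qed.

(** Regularity of the forms used in the first i cuts, each modulo the saturation reached before
    it. *)
Definition good A i : Prop := forall i' (j : 'I_n), (i' < i)%N -> (j + i'.+1)%N = n ->
  forall f : F, msat (chain A i') (lform A j *: f) -> msat (chain A i') f.

Lemma good_local A A' i : (forall a b : 'I_n, (n - i <= a)%N -> A a b = A' a b) ->
  good A i -> good A' i.
Proof.
move=> E gA i' j lt ji f h.
have E' (a b : 'I_n) : (n - i' <= a)%N -> A a b = A' a b by move=> ha; apply: E; lia.
apply: (msat_ext (T := chain A i')) => [f'|].
  by split; apply: chain_local => // a b ha; apply/esym/E'.
apply: (gA i' j lt ji); rewrite (lform_row (B := A')) => [|b]; last by apply: E; lia.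
apply: msat_ext h => f'; split; apply: chain_local => // a b ha.
exact/esym/E'.
Qed.

Lemma good_le A i i' : (i' <= i)%N -> good A i -> good A i'.
Proof. by move=> le h k j lt; apply: h; apply: leq_trans le. Qed.

Variables (W : F -> Prop) (g : gaut K n d).
Hypothesis hUW : forall t, IN0 (gim g U) t <-> W (fmon K t).
(** With the inverse matrix, g sends the form in row j to the variable j. *)
Let A := invmx (gvar g).

Let gimX_high i (a : 'I_n) (f : F) : (i <= n)%N -> (n - i <= a)%N ->
  gim g (chain A i) ('X_a *: f).
Proof. by move=> ni ha; rewrite /gim ginvZ lsubstX; apply: chain_high. Qed.

Lemma msat_chain_last (f : F) : msat (chain A n) f.
Proof.
rewrite -[f](gactK g); apply/(gim_msat g (gaut_act g f)); first exact: chain_submodule.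
by move=> j; exists 1%N; rewrite expr1; apply: gimX_high; rewrite ?subnn.
Qed.

(** Saturating by all variables is the same as saturating by the next form alone, as this form is
    regular modulo the saturation. In the coordinates of g it is a variable, and [IN_colon]
    applies. *)
Lemma IN_msat_chain i : (i < n)%N -> good A i.+1 ->
  (forall t, IN0 (gim g (chain A i)) t <-> Iset W i t) ->
  forall t, IN0 (gim g (msat (chain A i))) t <-> Jset W i t.
Proof.
move=> ni gA hI t; have [j ji] := ord_of_step ni; have ni' := ltnW ni.
have hP (a : 'I_n) : (j < a)%N -> forall f : F, gim g (chain A i) ('X_a *: f).
  by move=> ja f; apply: gimX_high => //; lia.
have hs := chain_submodule A ni'.
rewrite (Jset_colon W ji).
have E := IN_colon (gim_graded g (chain_graded A ni')) hP t.
have reg k (f : F) : msat (chain A i) (lform A j ^+ k *: f) -> msat (chain A i) f.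
  elim: k f => [|k IH] f; first by rewrite scale1r.
  by rewrite exprSr -scalerA => /IH; apply: (gA i j (ltnSn i) ji).
split.
  move=> h; have /E [k /hI hk] : IN0 (fun f => exists k, gim g (chain A i) ('X_j ^+ k *: f)) t.
    apply: IN_mono h => f hf; have [N hN] := (gim_msat g f hs).1 hf j; by exists N.
  by exists k.
case=> k hk; have /E h : exists k, IN0 (gim g (chain A i)) (tmul (U_(j) *+ k) t).
  by exists k; apply/hI.
apply: IN_mono h => f [N]; rewrite /gim ginvZ rmorphXn /= lsubstX => hN.
by apply: (reg N); apply: msat_sub.
Qed.

Lemma IN_chain i : (i <= n)%N -> good A i ->
  forall t, IN0 (gim g (chain A i)) t <-> Iset W i t.
Proof.
elim: i => [|i IH] ni gA t.
  rewrite [chain A 0]/= hUW; split=> [h|[[j [h _]]|//]]; first by right.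
  by move: h; rewrite subn0 leqNgt ltn_ord.
have [j ji] := ord_of_step ni; have ni' := ltnW ni.
rewrite (IsetS W ji) -(IN_msat_chain ni gA (IH ni' (good_le (leqnSn i) gA))).
have gP := gim_graded g (msat_graded (chain_graded A ni')).
have hP (a : 'I_n) : (j < a)%N -> forall f : F, gim g (msat (chain A i)) ('X_a *: f).
  by move=> ja f; apply: msat_sub; apply: gimX_high => //; lia.
rewrite -(IN_add_var gP hP t).
have EX : lsubst (gvar g) (lform A j) = 'X_j.
  by rewrite lsubst_lform mulVmx ?gvar_unit // lform1.
have E f : gim g (chain A i.+1) f <-> exists h, gim g (msat (chain A i)) (f - 'X_j *: h).
  have := gim_add_mult g (msat (chain A i)) (lform A j) f; rewrite EX => E.
  by split=> [/(chainS A _ ji)/E h|/E h]; [exact: h | apply/(chainS A _ ji)].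
by split; apply: IN_mono => f /E.
Qed.

Lemma IN_msat_chain_last : good A n ->
  forall t, IN0 (gim g (msat (chain A n))) t <-> Jset W n t.
Proof.
move=> gA t; split=> [_|_]; first exact: Jset_last.
exists (fmon K t); last exact: inm_fmon.
exact: msat_chain_last.
Qed.

(** The initial monomials are counted in the coordinates of g, but the length is that of submodules
    of F as they stand. *)
Lemma length_chain i : (i <= n)%N -> good A i ->
  (forall t, IN0 (gim g (msat (chain A i))) t <-> Jset W i t) ->
  exists l, card_JI W i l /\ length_is full (chain A i) (msat (chain A i)) l.
Proof.
move=> ni gA hJ; have hI := IN_chain ni gA.
have hs := chain_submodule A ni; have hc := gaut_act_is_coef g.
have rinj := @frank_inj n m d.
have [s hs'] := msat_finite hc rinj hs.
have [s' [us' hs'']] := seq_of_finite (fun t (h : IN _ _ _ t /\ ~ IN _ _ _ t) => hs' t h.1 h.2).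
exists (size s'); split; last exact: (length_msat hc rinj hs us' hs'').
exists s'; split=> // t; rewrite hs''.
have E1 := IN_gim g (msat (chain A i)) (frank d) t.
have E2 := IN_gim g (chain A i) (frank d) t.
by rewrite -E1 -E2 hI hJ.
Qed.

End Chain.

(** * Polynomial functions on lines *)

Section Lines.
Local Open Scope ring_scope.
Variable K : fieldType.

Lemma poly_roots_finite (p : {poly K}) : p != 0 ->
  exists s : seq K, forall t, t \notin s -> p.[t] != 0.
Proof.
elim/ltn_ind: {p}(size p) {-2}p (erefl (size p)) => k IH p sp p0.
case: (classic (exists a, root p a)) => [[a /factor_theorem [q E]]|hn]; last first.
  by exists [::] => t _; apply/negP=> ht; apply: hn; exists t.
have q0 : q != 0 by apply: contraNneq p0 => q0; rewrite E q0 mul0r.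
have [|s hs] := IH (size q) _ q erefl q0.
  by rewrite -sp E size_Mmonic ?monicXsubC // size_XsubC addn2.
exists (a :: s) => t; rewrite inE negb_or => /andP [ta /hs ht].
by rewrite E hornerM mulf_neq0 // hornerXsubC subr_eq0.
Qed.

(** Even with infinitely many coordinates, a polynomial function involves finitely many, so on a
    curve with polynomial coordinates it is a polynomial in the parameter. *)
Lemma polynomial_function_line (X I : Type) (c : I -> X -> K) (L : I -> {poly K}) h :
  polynomial_function c h ->
  exists p : {poly K}, forall s x, (forall i, c i x = (L i).[s]) -> h x = p.[s].
Proof.
move=> [N [idx [q hq]]].
exists (\sum_(u <- msupp q) q@_u *: \prod_(i < N) L (idx i) ^+ u i) => s x hx.
rewrite hq mevalE horner_sum; apply: eq_bigr => u _.
rewrite hornerZ horner_prod; congr (_ * _); apply: eq_bigr => i _.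
by rewrite horner_exp hx.
Qed.

End Lines.

(** * General choice of one row *)

Section GenericRow.
Local Open Scope ring_scope.
Variables (K : fieldType) (HK : infinite_field K) (n m : nat) (d : 'I_m -> int).
Local Notation S := {mpoly K[n]}.
Local Notation F := 'rV[S]_m.

Lemma homog_line (y w : S) (t : K) : y \is 1.-homog -> w \is 1.-homog ->
  y + t%:MP * w \is 1.-homog.
Proof. by move=> hy hw; rewrite rpredD // mul_mpolyC rpredZ. Qed.

Lemma linform_line (h : {y : S | y \is 1.-homog} -> K) (y w : S) :
  polynomial_function (@linform_coord K n) h ->
  exists p : {poly K}, forall t y', val y' = y + t%:MP * w -> h y' = p.[t].
Proof.
move=> hh; have [p hp] := polynomial_function_line
  (fun i => (y@_U_(i))%:P + w@_U_(i) *: 'X) hh.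
exists p => t y' E; apply: hp => i; rewrite /linform_coord E mcoeffD mcoeffCM.
by rewrite hornerD hornerC hornerZ hornerX mulrC.
Qed.

(** Join a point of O to a regular form by a line: almost all of its points have both properties. *)
Lemma open_regular (T : F -> Prop) O : submodule full T ->
  (forall f, msat T f -> T f) -> nonempty_open (@linform_coord K n) O ->
  exists z, O z /\ forall f, T (val z *: f) -> T f.
Proof.
move=> hT hs [[Q [hQ hO]] [z1 /hO [h Qh hz1]]].
have [z0 hz0 reg] := exists_regular HK hT hs.
have [b hb] := pencil_regular hT (fun f _ hf => reg f hf) (y := val z1).
have [p hp] := linform_line (val z1) z0 (hQ h Qh).
have p0 : p != 0.
  apply: contraNneq hz1 => p0; rewrite (hp 0) ?p0 ?horner0 //.
  by rewrite mpolyC0 mul0r addr0.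
have [r hr] := poly_roots_finite p0.
have [t] := HK (b ++ r); rewrite mem_cat negb_or => /andP [/hb tb /hr tr].
exists (exist (fun y : S => y \is 1.-homog) _ (homog_line t (valP z1) hz0)); split=> //.
by apply/hO; exists h => //; rewrite (hp t).
Qed.

Variables (T : F -> Prop) (O : {y : S | y \is 1.-homog} -> Prop).
Hypotheses (hT : submodule full T) (hs : forall f, msat T f -> T f)
  (hO : nonempty_open (@linform_coord K n) O).

Lemma gvar_line (h : gaut K n d -> K) (g : gaut K n d) (B : 'M[K]_n) :
  polynomial_function (@gaut_coord K n m d) h ->
  exists p : {poly K}, forall s g', gvar g' = gvar g - s *: B -> gbas g' = gbas g ->
    h g' = p.[s].
Proof.
move=> hh; have [p hp] := polynomial_function_line (fun i => match i with
  | inl (a, b) => (gvar g a b)%:P - B a b *: 'X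
  | inr (a, b, u) => ((gbas g a b)@_u)%:P end) hh.
exists p => s g' E1 E2; apply: hp => -[[a b]|[[a b] u]] /=.
  by rewrite E1 !mxE hornerD hornerN hornerZ hornerX hornerC mulrC.
by rewrite E2 hornerC.
Qed.

(* Sherman-Morrison: adding t times the row w to the row j of the inverse of
   gvar g moves gvar g along a line, with parameter s = t / (1 + t l). *)
Lemma generic_row (h : gaut K n d -> K) (g : gaut K n d) (j : 'I_n) :
  polynomial_function (@gaut_coord K n m d) h -> h g != 0 ->
  exists g' : gaut K n d, [/\ h g' != 0,
    forall a b, a != j -> invmx (gvar g') a b = invmx (gvar g) a b,
    exists2 y, O y & val y = lform (invmx (gvar g')) j,
    forall f, T (lform (invmx (gvar g')) j *: f) -> T f
  & gbas g' = gbas g].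
Proof.
move=> hh hg; have [z [Oz regz]] := open_regular hT hs hO.
pose G := gvar g; pose A := invmx G; have uG : G \in unitmx := gvar_unit g.
(* The line passes through the present row at parameter 0 and through the regular form z of O at
   parameter 1. *)
pose y := lform A j; pose w := val z - y.
have hy : y \is 1.-homog := lform_homog A j.
have hw : w \is 1.-homog by rewrite rpredB // (valP z).
pose om : 'rV[K]_n := \row_b w@_U_(b).
pose e : 'cV[K]_n := delta_mx j 0.
pose lam : K := (om *m G *m e) 0 0.
have omGe : om *m G *m e = lam%:M by rewrite [LHS]mx11_scalar.
pose B := G *m e *m om *m G.
have [p hp] := gvar_line g B hh.
have p0 : p != 0.
  by apply: contraNneq hg => p0; rewrite (hp 0) ?p0 ?horner0 // scale0r subr0.
have [b hb] : exists b : seq K, forall t, t \notin b ->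
    forall f, T ((y + t%:MP * w) *: f) -> T f.
  (* If y and w both send f into T, so does their sum z, which is regular. *)
  apply: pencil_regular => // f h1 h2; apply: regz.
  rewrite -[val z](subrK y) -/w scalerDl; case: hT => _ TD _; exact: TD.
have [[Q [hQ hOQ]] _] := hO.
have /hOQ [h2 Qh2 h2z] := Oz.
have [p2 hp2] := linform_line y w (hQ h2 Qh2).
have p20 : p2 != 0.
  apply: contraNneq h2z => p20; rewrite (hp2 1) ?p20 ?horner0 //.
  by rewrite mpolyC1 mul1r addrC subrK.
pose p3 : {poly K} := 1 - lam *: 'X.
have p3E s : p3.[s] = 1 - lam * s by rewrite /p3 !hornerE.
have p30 : p3 != 0.
  apply/eqP => E; have := p3E 0; rewrite E horner0 mulr0 subr0.
  by move/esym/eqP; rewrite oner_eq0.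
have [r1 hr1] := poly_roots_finite p0.
have [r2 hr2] := poly_roots_finite p20.
have [r3 hr3] := poly_roots_finite p30.
(* Conditions on t are excluded through s = t / (1 + t lam), the inverse of t = s / (1 - lam s);
   [r1] keeps h nonzero and [r3] keeps the denominator nonzero. *)
have [s] := HK (r1 ++ r3 ++ [seq t / (1 + t * lam) | t <- b ++ r2]).
rewrite !mem_cat !negb_or => /and3P [/hr1 s1 /hr3 s3 s2].
rewrite p3E in s3; pose t := s / (1 - lam * s).
have ts : t * (1 - lam * s) = s by rewrite /t divfK.
clearbody t.
have tn : t \notin b ++ r2.
  apply: contra s2 => tb; apply/mapP; exists t => //.
  have E : 1 + t * lam = (1 - lam * s)^-1.
    by apply: (mulIf s3); rewrite mulVf // mulrDl mul1r mulrAC ts [s * _]mulrC subrK.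
  by rewrite E invrK.
move: tn; rewrite mem_cat negb_or => /andP [/hb regt /hr2 t2].
pose G' := G - s *: B; pose A' := A + t *: (e *m om).
have GA : G *m A = 1%:M by apply: mulmxV.
have GA' : G' *m A' = 1%:M.
  pose X := G *m e *m om.
  have -> : G' *m A' = (1%:M + t *: X) - (s + s * t * lam) *: X.
    rewrite mulmxBl; congr (_ - _); first by rewrite mulmxDr GA -scalemxAr mulmxA.
    rewrite -scalemxAl mulmxDr -scalemxAr.
    have -> : B *m A = X by rewrite /B -!mulmxA GA mulmx1 mulmxA.
    have -> : B *m (e *m om) = lam *: X.
      rewrite /B !mulmxA -(mulmxA _ om) -(mulmxA _ (om *m G)) omGe.
      by rewrite mul_mx_scalar -scalemxAl.
    by rewrite scalerDr !scalerA scalerDl.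
  (* The two rank-one corrections cancel exactly when t = s + s t lam, which is [ts]. *)
  rewrite -addrA -scalerBl (_ : t - _ = 0) ?scale0r ?addr0 //.
  by apply/eqP; rewrite subr_eq0 -subr_eq; apply/eqP; rewrite -[RHS]ts; ring.
have [uG' uA'] := mulmx1_unit GA'.
have EA' : invmx G' = A' by rewrite -[A'](mulKmx uG') GA' mulmx1.
pose g' := GAut uG' (gbas_unit g) (@gbas_hom _ _ _ _ g).
have Ey : lform A' j = y + t%:MP * w.
  rewrite [w]homog1E // mul_mpolyC scaler_sumr /y /lform -big_split.
  apply: eq_bigr => k _ /=; rewrite scalerA -scalerDl; congr (_ *: _).
  by rewrite !mxE big_ord1 !mxE !eqxx mul1r.
exists g'; split.
- by rewrite (hp s).
- move=> a k aj; rewrite [gvar g']/= EA' !mxE big_ord1 !mxE (negPf aj).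
  by rewrite mul0r mulr0 addr0.
- exists (exist (fun y : S => y \is 1.-homog) _ (homog_line t hy hw)) => /=; last by rewrite EA' Ey.
  by apply/hOQ; exists h2 => //; rewrite (hp2 t).
- by move=> f; rewrite [gvar g']/= EA' Ey; apply: regt.
- by [].
Qed.

End GenericRow.

(** * The extended degree of F/U *)

Section SdegGin.
Local Open Scope ring_scope.
Variables (K : fieldType) (HK : infinite_field K) (n m : nat) (d : 'I_m -> int).
Local Notation S := {mpoly K[n]}.
Local Notation F := 'rV[S]_m.
Variables (sdeg : gmodule K n -> nat) (Hsdeg : smallest_extended_degree sdeg).
Variables (U : gfree K n d -> Prop) (gU : graded_submodule U) (W : F -> Prop).
Variables (O : gaut K n d -> Prop) (hO : nonempty_open (@gaut_coord K n m d) O).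
Hypothesis hUW : forall g, O g -> forall t,
  IN (@fcoef K n m) (frank d) (gim g U) t <-> W (fmon K t).

(** From [O] only one polynomial function h with h(g0) != 0 is kept. The induction carries an
    implication from the value of sdeg at stage i back to the value for U, as the former is known
    only once the chain reaches F. *)
Lemma sdeg_chain_gin : exists l : nat -> nat,
  (forall i, (i <= n)%N -> card_JI W i (l i)) /\ sv sdeg U (\sum_(i < n.+1) l i)%N.
Proof.
have [[Q [hQ hOQ]] [g0 /hOQ [h Qh hg0]]] := hO; have hh := hQ h Qh.
have Oh g : h g != 0 -> O g by move=> hg; apply/hOQ; exists h.
suff H i : (i <= n)%N -> exists g l, [/\ h g != 0, good U (invmx (gvar g)) i,
    forall i', (i' < i)%N -> card_JI W i' (l i') &
    forall s, sv sdeg (chain U (invmx (gvar g)) i) s ->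
      sv sdeg U (s + \sum_(i' < i) l i')%N].
  have [g [l [hg gA hl hsv]]] := H n (leqnn n).
  have [ln [hln len]] := length_chain gU (hUW (Oh g hg)) (leqnn n) gA
    (IN_msat_chain_last gU W gA).
  exists (fun i => if (i < n)%N then l i else ln); split.
    move=> i; rewrite leq_eqVlt => /orP [/eqP ->|lt]; first by rewrite ltnn.
    by rewrite lt; apply: hl.
  rewrite big_ord_recr /= ltnn addnC.
  rewrite (eq_bigr (fun i : 'I_n => l i)) => [|i _]; last by rewrite ltn_ord.
  apply: hsv; rewrite -[ln]add0n.
  apply: (sv_msat Hsdeg (chain_graded gU _ (leqnn n)) len).
  by apply: (sv_full Hsdeg) => f; apply: msat_chain_last.
elim: i => [_|i IH lt].
  exists g0, (fun=> 0%N); split=> // s hs; rewrite big_ord0 addn0.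
  exact: hs.
have [g [l [hg gA hl hsv]]] := IH (ltnW lt).
have [j ji] := ord_of_step lt; have hsub := chain_submodule gU (invmx (gvar g)) (ltnW lt).
pose T := msat (chain U (invmx (gvar g)) i).
have [OT hOT svT] := sv_add_mult Hsdeg (msat_graded (chain_graded gU (invmx (gvar g)) (ltnW lt))).
have hT : submodule full T by apply: msat_submodule.
have [g' [hg' rows [y Oy Ey] reg _]] :=
  generic_row HK hT (fun f => msat_idem hsub) hOT j hh hg.
have E (a b : 'I_n) : (n - i <= a)%N -> invmx (gvar g) a b = invmx (gvar g') a b.
  move=> ha; apply/esym/rows; apply: contraTneq ha => ->.
  by rewrite -ltnNge; move: ji; lia.
(* Changing row j does not affect the module for which the new form was chosen. *)
have EC : chain U (invmx (gvar g')) i = chain U (invmx (gvar g)) i.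
  apply: functional_extensionality => f; apply: propositional_extensionality.
  by split; apply: chain_local => // a b ha; apply/esym/E.
have gA' : good U (invmx (gvar g')) i.+1.
  move=> i' a; rewrite ltnS leq_eqVlt => /orP [/eqP ->|lt'] Ea f.
    have -> : a = j by apply: val_inj => /=; move: Ea ji; lia.
    by rewrite EC; apply: reg.
  exact: (good_local E gA lt' Ea).
have [li [hli len]] := length_chain gU (hUW (Oh g' hg')) (ltnW lt) (good_le (leqnSn i) gA')
  (IN_msat_chain gU lt gA'
    (IN_chain gU (hUW (Oh g' hg')) (ltnW lt) (good_le (leqnSn i) gA'))).
rewrite EC in len.
exists g', (fun k => if (k < i)%N then l k else li); split=> //.
  move=> i'; rewrite ltnS leq_eqVlt => /orP [/eqP ->|lt']; first by rewrite ltnn.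
  by rewrite lt'; apply: hl.
move=> s hs; rewrite big_ord_recr /= ltnn.
rewrite (eq_bigr (fun i' : 'I_i => l i')) => [|i' _]; last by rewrite ltn_ord.
rewrite addnA addnAC; apply: hsv.
apply: (sv_msat Hsdeg (chain_graded gU _ (ltnW lt)) len).
apply: (svT y Oy); first by rewrite Ey.
rewrite Ey; apply: sv_ext hs => f; rewrite -EC; split; first by move/(chainS _ _ _ ji).
by move=> hf; apply/(chainS _ _ _ ji).
Qed.

End SdegGin.

(** * Spaces spanned by monomials *)

Section MonomialModules.
Local Open Scope ring_scope.
Variables (K : fieldType) (n m : nat).
Local Notation S := {mpoly K[n]}.
Local Notation F := 'rV[S]_m.
Local Notation mon := (fmonomial n m).
Implicit Types (I G : mon -> Prop) (f : F) (t : mon) (u : 'X_{1..n}).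

(** The K-span of the monomials in I. *)
Definition Mono I f : Prop := forall t, fcoef f t != 0 -> I t.

Definition supported r u : Prop := forall a : 'I_n, (r <= a)%N -> u a = 0%N.

Lemma fcoef_scale_neq0 (p : S) f t : fcoef (p *: f) t != 0 ->
  exists u t', [/\ u \in msupp p, fcoef f t' != 0 & t = tmul u t'].
Proof.
rewrite -mcoeff_msupp mxE => /msuppM_le /allpairsP [[u v] /= [hu hv E]].
exists u, (v, t.2); split=> //; first by rewrite -mcoeff_msupp.
by rewrite /tmul /= -E; case: (t).
Qed.

Lemma Mono_submodule r I : (forall u t, supported r u -> I t -> I (tmul u t)) ->
  submodule (subpoly r) (Mono I).
Proof.
move=> hI; split=> [t|f g hf hg t|p f hp hf t]; rewrite ?fcoef0 ?eqxx //.
  rewrite fcoefD; case: (eqVneq (fcoef f t) 0) => [->|/hf //].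
  by rewrite add0r; apply: hg.
case/fcoef_scale_neq0 => u [t' [hu ht' ->]]; apply: hI; last exact: hf.
by move=> a ra; apply: (hp u hu).
Qed.

Lemma subm_full_subpoly (X : F -> Prop) : submodule (subpoly n) X <-> submodule full X.
Proof.
split=> -[X0 XD XZ]; split=> // p f _ hf; apply: XZ => //; exact/full_subpoly.
Qed.

Lemma Mono_submodule_full I : (forall u t, I t -> I (tmul u t)) ->
  submodule full (Mono I).
Proof. by move=> hI; apply/subm_full_subpoly/Mono_submodule => u t _; apply: hI. Qed.

Lemma Mono_fmon I t : Mono I (fmon K t) <-> I t.
Proof.
split=> [h|h s]; first by apply: h; rewrite fcoef_mon eqxx oner_neq0.
by rewrite fcoef_mon; case: (eqVneq t s) => [<-|_] //; rewrite eqxx.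
Qed.

Lemma Mono_eq I I' : (forall t, I t <-> I' t) -> forall f, Mono I f <-> Mono I' f.
Proof. by move=> E f; split=> h t /h /E. Qed.

Lemma subspace_Mono (X : F -> Prop) f : subspace X ->
  Mono (fun t => X (fmon K t)) f -> X f.
Proof.
move=> hX hf; rewrite [f]fexpand; apply: subspace_sum_seq => // t.
by rewrite mem_fsupp => /hf; case: hX => _ _; apply.
Qed.

Lemma IN_Mono d I t : IN (@fcoef K n m) (frank d) (Mono I) t <-> I t.
Proof.
split=> [[f hf [ft _]]|h]; first exact: hf.
by exists (fmon K t); [apply/Mono_fmon | apply: inm_fmon].
Qed.

Lemma span_fmonP r (A : S -> Prop) G f : (forall p, A p <-> subpoly r p) ->
  Defs.span A (fmon_set G) f <->
  Mono (fun t => exists u s, [/\ supported r u, G s & t = tmul u s]) f.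
Proof.
move=> AE; split.
  apply: span_min.
    have := @Mono_submodule r (fun t => exists u s, [/\ supported r u, G s & t = tmul u s]).
    case=> [u _ hu [v [s [hv Gs ->]]]|X0 XD XZ].
      exists (u + v)%MM, s; rewrite tmulA; split=> // a ra.
      by rewrite mnmDE hu ?hv.
    by split=> // p g /AE; apply: XZ.
  move=> _ [t Gt ->]; apply/Mono_fmon; exists 0%MM, t; rewrite tmul0; split=> //.
  by move=> a _; rewrite mnm0E.
have hS : submodule A (Defs.span A (fmon_set G : F -> Prop)).
  by apply: span_submodule => a b /AE ha /AE hb; apply/AE/subpolyM.
have hS' : subspace (Defs.span A (fmon_set G : F -> Prop)).
  by apply: submod_subspace hS => c; apply/AE/subpolyC.
move=> hf; apply: subspace_Mono => // t /hf [u [s [hu Gs ->]]].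
rewrite -fmonX; case: hS => _ _; apply; first exact/AE/subpolyX.
by apply: span_mem; [apply/AE/subpoly1 | exists s].
Qed.

End MonomialModules.

(** * The lengths of the algorithm *)

Section MonomialColon.
Local Open Scope ring_scope.
Variables (K : fieldType) (n m : nat).
Local Notation S := {mpoly K[n]}.
Local Notation F := 'rV[S]_m.
Local Notation mon := (fmonomial n m).
Variables (W : F -> Prop) (hW : submodule full W).
Implicit Types (f : F) (t : mon) (u : 'X_{1..n}).

Lemma colon_submodule i : (i <= n)%N -> submodule full (colon_seq W i).
Proof.
elim: i => [//|i IH] lt; have [j ji] := ord_of_step lt.
have {}IH := IH (ltnW lt); have [C0 CD CZ] := IH.
split.
- by apply/(colon_seqS W ji); exists 0%N; rewrite scaler0.
- move=> f g /(colon_seqS W ji) [a ha] /(colon_seqS W ji) [b hb].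
  apply/(colon_seqS W ji); exists (b + a)%N; rewrite scalerDr.
  by apply: CD; [apply: subm_pow | rewrite addnC; apply: subm_pow].
- move=> p f _ /(colon_seqS W ji) [a ha]; apply/(colon_seqS W ji); exists a.
  by rewrite scalerA mulrC -scalerA; apply: CZ.
Qed.

(** Later variables have been divided out by earlier colons, and a colon by another variable
    preserves this. *)
Lemma colon_div i (a : 'I_n) f : (i <= n)%N -> (n - i <= a)%N ->
  colon_seq W i ('X_a *: f) -> colon_seq W i f.
Proof.
elim: i f => [|i IH] f lt ha; first by move: ha; rewrite subn0 leqNgt ltn_ord.
have [j ji] := ord_of_step lt.
move=> /(colon_seqS W ji) [k hk]; apply/(colon_seqS W ji).
case: (ltnP a (n - i)) => ai.
  have E : a = j by apply: val_inj => /=; move: ji; lia.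
  by exists k.+1; rewrite exprSr -scalerA -[X in 'X_X *: _]E.
by exists k; apply: (IH _ (ltnW lt) ai); rewrite scalerA mulrC -scalerA.
Qed.

Lemma colon_succ i t : (i < n)%N -> colon_seq W i (fmon K t) -> colon_seq W i.+1 (fmon K t).
Proof.
move=> lt h; have [j ji] := ord_of_step lt; apply/(colon_seqS W ji).
by exists 0%N; rewrite scale1r.
Qed.

Lemma high_tmul i u t : high i t -> high i (tmul u t).
Proof. by case=> a [h1 h2]; exists a; rewrite mnmDE ltn_addl. Qed.

Lemma Iset_tmul i u t : (i <= n)%N -> Iset W i t -> Iset W i (tmul u t).
Proof.
move=> ni [/high_tmul h|h]; [by left|right].
by rewrite -fmonX; case: (colon_submodule ni) => _ _; apply.
Qed.

Lemma Jset_tmul i u t : (i <= n)%N -> Jset W i t -> Jset W i (tmul u t).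
Proof.
move=> ni [/high_tmul h|[h|h]]; [by left|by right; left|].
case: (ltnP i n) => [lt|]; last by right; left.
by right; right; rewrite -fmonX; case: (colon_submodule lt) => _ _; apply.
Qed.

Lemma Iset_Jset i t : (i <= n)%N -> Iset W i t -> Jset W i t.
Proof.
move=> ni [h|h]; first by left.
case: (ltnP i n) => [lt|]; last by right; left.
by right; right; apply: colon_succ.
Qed.

(** A multiple of t whose degree exceeds those of the finitely many monomials in the difference of
    the two sets cannot be one of them. *)
Lemma Jset_bound i l : (i <= n)%N -> card_JI W i l ->
  exists N, forall u t, (N <= mdeg u)%N -> Jset W i t -> Iset W i (tmul u t).
Proof.
move=> ni [s [_ _ hs]]; exists (\max_(t <- s) mdeg t.1).+1 => u t hu ht.
apply: NNPP => nI; have : tmul u t \in s by apply/hs; split=> //; apply: Jset_tmul.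
move=> hin; have := @leq_bigmax_seq _ s xpredT (fun t : mon => mdeg t.1) _ hin isT; rewrite /=.
rewrite leqNgt mdegD => /negP; apply; exact: (leq_trans hu (leq_addr _ _)).
Qed.

Lemma msat_Mono_Iset i l f : (i <= n)%N -> card_JI W i l ->
  msat (Mono (Iset W i)) f <-> Mono (Jset W i) f.
Proof.
move=> ni hl; split=> h.
  move=> t ht; case: (ltnP i n) => [lt|ni']; last by right; left.
  have [j ji] := ord_of_step lt; have [N hN] := h j.
  apply/(Jset_colon W ji); exists N; apply: hN.
  by rewrite mpolyXn fcoefX.
have [N hN] := Jset_bound ni hl; move=> j; exists N => t.
rewrite mpolyXn => /fcoefX_neq0 [t' -> /h ht']; apply: hN => //.
by rewrite mdegMn mdeg1 mul1n.
Qed.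

(** The monomials of V_i and of its saturation are the elements of [Iset] and [Jset] free of the
    last i variables. All other monomials belong to both sets, so the difference is the same. *)
Lemma length_restricted i l G : (i <= n)%N -> card_JI W i l ->
  minimal_monomial_generators G (colon_seq W i) ->
  length_is (subpoly (n - i)) (restricted_span K (n - i) G)
    (restricted_sat K (n - i) G) l.
Proof.
move=> ni hl [genG minG]; set r := (n - i)%N.
pose low t := supported r t.1.
have lowN t : low t <-> ~ high i t.
  split=> [h [a [h1 h2]]|h a ra]; first by rewrite h in h2.
  by apply/eqP; rewrite -leqn0 leqNgt; apply/negP => h2; apply: h; exists a.
have colonE t : colon_seq W i (fmon K t) <-> exists u s, G s /\ t = tmul u s.
  rewrite genG (span_fmonP _ _ (@full_subpoly K n)) Mono_fmon.
  split=> [[u [s [_ h1 h2]]]|[u [s [h1 h2]]]]; first by exists u, s.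
  by exists u, s; split=> // a; rewrite leqNgt ltn_ord.
(* If x_a divides a minimal generator s, then s/x_a is in the module too, so s is a proper multiple
   of another generator and could be dropped. *)
have Glow s : G s -> low s.
  move=> Gs; apply/lowN => -[a [ha sa]].
  have : colon_seq W i (fmon K s) by apply/colonE; exists 0%MM, s; rewrite tmul0.
  rewrite (fmon_divX K sa) => /(colon_div ni ha) /colonE [u [s'' [Gs'' E]]].
  have Es : s = tmul (U_(a) + u)%MM s''.
    rewrite -tmulA -E /tmul /= addmC submK ?lep1mP -?lt0n //; by case: (s).
  have ne : s'' <> s.
    move=> E'; have := congr1 (fun t : mon => mdeg t.1) Es.
    by rewrite E' /= !mdegD mdeg1; lia.
  have [] : G s /\ s <> s; last by [].
  apply: (minG (fun t => G t /\ t <> s)) => //; first by move=> t [].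
  move=> f; rewrite genG !(span_fmonP _ _ (@full_subpoly K n)).
  apply: Mono_eq => t; split=> -[v [w [hv hw ->]]]; last by exists v, w; case: hw.
  case: (classic (w = s)) => [->|nw]; last by exists v, w.
  exists (v + (U_(a) + u))%MM, s''; rewrite -tmulA -Es; split=> // b.
  by rewrite leqNgt ltn_ord.
have IE t : low t -> (Iset W i t <-> colon_seq W i (fmon K t)).
  by move=> /lowN h; split=> [[]|h'] //; right.
have VE f : restricted_span K r G f <-> Mono (fun t => low t /\ Iset W i t) f.
  rewrite /restricted_span (span_fmonP (r := r)) //; apply: Mono_eq => t; split.
    case=> u [s [hu Gs ->]].
    have lt : low (tmul u s) by move=> a ra; rewrite mnmDE hu // (Glow s Gs).
    by split=> //; apply/IE => //; apply/colonE; exists u, s.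
  case=> lt /(IE t lt) /colonE [u [s [Gs E]]]; exists u, s; split=> // a ra.
  by apply/eqP; rewrite -leqn0 -(lt a ra) E mnmDE leq_addr.
have [N hN] := Jset_bound ni hl.
have subE p : subpoly r p <-> subpoly r (p : S) by [].
have satX f (j : 'I_n) : restricted_sat K r G f -> (j < r)%N ->
    exists k, restricted_span K r G ('X_j ^+ k *: f).
  by move=> [_ [k _ hk]] jr; exists k; apply: hk; apply: ideal_powX.
have VsE f : restricted_sat K r G f <-> Mono (fun t => low t /\ Jset W i t) f.
  split.
    move=> hf t ht; split.
      move=> a ra; case: hf => hf _; apply: (hf t.2 t.1) => //.
      by rewrite mcoeff_msupp.
    case: (ltnP i n) => [lt|]; last by right; left.
    have [j ji] := ord_of_step lt.
    have jr : (j < r)%N by rewrite /r; move: ji; lia.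
    have [k /VE hk] := satX f j hf jr.
    apply/(Jset_colon W ji); exists k.
    by have [|_] := hk (tmul (U_(j) *+ k)%MM t); rewrite // mpolyXn fcoefX.
  move=> h; split.
    move=> k u; rewrite mcoeff_msupp => hu a ra.
    by have [hlow _] := h (u, k) hu; apply: hlow.
  exists N.+1 => // p hp; apply/VE => t /fcoef_scale_neq0 [u [t' [hu ht' ->]]].
  have [hp1 hp2] := ideal_pow_deg subE hp; have [h1 h2] := h t' ht'; split.
    by move=> a ra; rewrite mnmDE (hp1 u hu a ra) h1.
  by apply: hN => //; apply/ltnW/hp2.
have [s [us <- hs]] := hl.
have lowM u t : supported r u -> low t -> low (tmul u t).
  by move=> hu ht a ra; rewrite mnmDE hu ?ht.
have hV : submodule (subpoly r) (restricted_span K r G).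
  apply: (submodule_ext (T := Mono (fun t => low t /\ Iset W i t))).
    by move=> f; split=> /VE.
  by apply: Mono_submodule => u t hu [h1 h2]; split; [apply: lowM | apply: Iset_tmul].
have hVs : submodule (subpoly r) (restricted_sat K r G).
  apply: (submodule_ext (T := Mono (fun t => low t /\ Jset W i t))).
    by move=> f; split=> /VsE.
  by apply: Mono_submodule => u t hu [h1 h2]; split; [apply: lowM | apply: Jset_tmul].
apply: (length_IN (fcoef_is_coef K n m) (@frank_inj n m (fun=> 0)) subE hV hVs) => //.
- move=> f /VE h; apply/VsE => t /h [h1 h2]; split=> //; exact: Iset_Jset.
- move=> t; rewrite hs.
  have E1 : IN (@fcoef K n m) (frank (fun=> 0)) (restricted_sat K r G) t <-> low t /\ Jset W i t.
    have <- := IN_Mono K (fun=> 0) (fun t => low t /\ Jset W i t) t.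
    by split; apply: IN_mono => f /VsE.
  have E2 : IN (@fcoef K n m) (frank (fun=> 0)) (restricted_span K r G) t <-> low t /\ Iset W i t.
    have <- := IN_Mono K (fun=> 0) (fun t => low t /\ Iset W i t) t.
    by split; apply: IN_mono => f /VE.
  rewrite E1 E2; split=> [[h1 h2]|[[h1 h2] h3]]; last by split=> // h; apply: h3.
  (* A monomial outside [Iset] cannot be high. *)
  have hlow : low t by apply/lowN => h; apply: h2; left.
  by split=> // -[].
- by move=> f hf j jr; apply: satX.
Qed.

End MonomialColon.

(** * The extended degree of F/W *)

Section MonomialChain.
Local Open Scope ring_scope.
Variables (K : fieldType) (HK : infinite_field K) (n m : nat) (d : 'I_m -> int).
Local Notation S := {mpoly K[n]}.
Local Notation F := 'rV[S]_m.
Local Notation mon := (fmonomial n m).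
Variables (W : F -> Prop) (hW : submodule full W)
  (mW : forall f, W f -> Mono (fun t => W (fmon K t)) f).
Implicit Types (f : F) (t : mon) (u : 'X_{1..n}) (g : gaut K n d).

(** The preimage under g of a monomial space. It plays the role of the chain, with initial monomials
    I in the coordinates of g. *)
Definition premono g (I : mon -> Prop) : gfree K n d -> Prop :=
  fun f => Mono I (gaut_act g f).

Lemma premono_graded g I : (forall u t, I t -> I (tmul u t)) ->
  graded_submodule (premono g I).
Proof.
move=> hI; have hM := @Mono_submodule_full K n m I hI; have [M0 MD MZ] := hM.
apply: graded_of_free_part.
  split; rewrite /premono.
  - by rewrite gaut_act0.
  - by move=> f h hf hh; rewrite gaut_actD; apply: MD.
  - by move=> a f _ hf; rewrite gaut_actZ; apply: MZ.
move=> f k hf t; rewrite -gaut_act_free_part fcoef_free_part.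
by case: ifP => [_|_]; [apply: hf | rewrite eqxx].
Qed.

Lemma IN_premono g I t :
  IN (fun f => fcoef (gaut_act g f)) (frank d) (premono g I) t <-> I t.
Proof.
have <- := IN_Mono K d I t; split=> [[f hf ft]|[f hf ft]].
  by exists (gaut_act g f).
by exists (ginv g f); rewrite // /premono /inm ginvK.
Qed.

Lemma msat_premono g i l : (i <= n)%N -> card_JI W i l ->
  msat (premono g (Iset W i)) = premono g (Jset W i).
Proof.
move=> ni hl; apply: functional_extensionality => f; apply: propositional_extensionality.
have hI := premono_graded g (fun u t => @Iset_tmul K n m W hW i u t ni).
have := gim_msat g (gaut_act g f) (graded_sub_submodule hI).
rewrite /gim gactK => ->.
rewrite -[premono g (Jset W i) f]/(Mono (Jset W i) (gaut_act g f)).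
rewrite -(msat_Mono_Iset hW _ ni hl).
by split; apply: msat_ext => h; rewrite /premono ginvK.
Qed.

Lemma gaut_act_scalar g (p : S) (k : 'I_m) : gbas g = 1%:M ->
  gaut_act g (p *: delta_mx 0 k) = lsubst (gvar g) p *: delta_mx 0 k.
Proof.
move=> g1; rewrite gaut_actZ gaut_actE g1 mulmx1; congr (_ *: _).
by apply/rowP => j; rewrite !mxE; case: (_ && _); rewrite ?rmorph1 ?rmorph0.
Qed.

Lemma ginv_scalar g (p : S) (k : 'I_m) : gbas g = 1%:M ->
  ginv g (p *: delta_mx 0 k) = lsubst (invmx (gvar g)) p *: delta_mx 0 k.
Proof.
move=> g1; apply: (can_inj (gactK g)).
by rewrite ginvK (gaut_act_scalar _ _ g1) lsubstK ?gvar_unit.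
Qed.

(* Jset W i is spanned by multiples of the later variables and by monomials in
   the earlier ones, which both substitutions fix. *)
Lemma premono_Jset_sub g g' i (j : 'I_n) f : (j + i.+1)%N = n ->
  gbas g = 1%:M -> gbas g' = 1%:M ->
  (forall a b, a != j -> invmx (gvar g') a b = invmx (gvar g) a b) ->
  (forall a b : 'I_n, (a < j)%N -> invmx (gvar g) a b = (a == b)%:R) ->
  premono g (Jset W i) f -> premono g' (Jset W i) f.
Proof.
move=> ji g1 g1' rows rowsid hf.
have ni : (i < n)%N by move: ji; lia.
have hM : submodule full (premono g' (Jset W i)).
  exact/graded_sub_submodule/premono_graded/(fun u t => @Jset_tmul K n m W hW i u t (ltnW ni)).
have lfid (a : 'I_n) : (a < j)%N -> lform (invmx (gvar g)) a = 'X_a.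
  move=> aj; rewrite -lform1; apply: lform_row => b; rewrite rowsid // mxE.
  by [].
have lfid' (a : 'I_n) : (a < j)%N -> lform (invmx (gvar g')) a = 'X_a.
  move=> aj; rewrite -lfid //; apply: lform_row => b; apply: rows.
  by apply: contraTneq aj => ->; rewrite ltnn.
rewrite -[f](gactK g) [gaut_act g f]fexpand.
rewrite (big_morph (ginv g) (ginvD g) (ginv0 g)).
apply: (subspace_sum_seq (subspace_full hM)) => -[u k].
rewrite mem_fsupp => /hf ht; rewrite ginvZ lsubstC.
have [_ _ hZ] := hM; apply: hZ; first exact: I.
rewrite /fmon (ginv_scalar _ _ g1) /=.
pose q u' : F := lsubst (invmx (gvar g)) 'X_[u'] *: delta_mx 0 k.
rewrite -/(q u).
have qhigh (a : 'I_n) : (n - i <= a)%N -> (0 < u a)%N -> premono g' (Jset W i) (q u).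
  move=> ha ua; have aj : a != j by apply: contraTneq ha => ->; rewrite -ltnNge; move: ji; lia.
  have E : 'X_[u] = 'X_[u - U_(a)] * 'X_a :> S by rewrite -mpolyXD submK // lep1mP -lt0n.
  rewrite /q E rmorphM /= lsubstX -(lform_row (A := invmx (gvar g'))); last by move=> b; apply: rows.
  move=> t; rewrite (gaut_act_scalar _ _ g1') rmorphM /= lsubst_lform (mulVmx (gvar_unit g')) lform1.
  rewrite mulrC -scalerA => /fcoefX_neq0 [t' -> _]; left; exists a.
  by rewrite mnmDE mnm1E eqxx.
case: ht => [[a /= [ha ua]]|[|hu]]; [exact: (qhigh a) | by rewrite leqNgt ni |].
case: (classic (high i (u, k))) => [[a /= [ha ua]]|nh]; first exact: (qhigh a).
have ulow (a : 'I_n) : (n - i <= a)%N -> u a = 0%N.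
  by move=> ha; apply/eqP; rewrite -leqn0 leqNgt; apply/negP => ua; apply: nh; exists a.
(* Removing x_j from u leaves a monomial in the variables before j, which both substitutions fix; it
   stays in W_(i+1), where x_j can be divided out. *)
pose v := (u - U_(j) *+ u j)%MM.
have uj : (U_(j) *+ u j <= u)%MM.
  by apply/mnm_lepP => a; rewrite mulmnE mnm1E; case: eqP => [<-|//]; rewrite mul1n.
have Eu : u = (v + U_(j) *+ u j)%MM by rewrite /v submK.
have vhigh (a : 'I_n) : (j <= a)%N -> v a = 0%N.
  rewrite leq_eqVlt /v mnmBE mulmnE mnm1E => /orP [/eqP/val_inj <-|ja].
    by rewrite eqxx mul1n subnn.
  by rewrite ulow //; move: ji ja; lia.
have fix_v (B : 'M[K]_n) : (forall a : 'I_n, (a < j)%N -> lform B a = 'X_a) -> lsubst B 'X_[v] = 'X_[v].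
  move=> hB; rewrite lsubst_monE [RHS]mpolyXE_id; apply: eq_bigr => a _.
  by case: (ltnP a j) => aj; [rewrite hB | rewrite vhigh // !expr0].
have hv : colon_seq W i.+1 (fmon K (v, k)).
  have /(colon_seqS W ji) [b hb] := hu; apply/(colon_seqS W ji); exists (b + u j)%N.
  rewrite exprD -scalerA [in X in _ *: X]mpolyXn fmonX.
  by rewrite /tmul /= addmC -Eu.
have fix_v' : lsubst (gvar g') 'X_[v] = 'X_[v].
  by rewrite -{1}(fix_v _ lfid') lsubstK ?gvar_unit.
rewrite /q Eu mpolyXD rmorphM /= (fix_v _ lfid) mulrC => t.
rewrite (gaut_act_scalar _ _ g1') rmorphM /= fix_v' -scalerA => /fcoef_scale_neq0 [w [t' [_ ht' ->]]].
have -> : t' = (v, k).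
  apply/eqP; move: ht'; rewrite -[_ *: delta_mx _ _]/(fmon K (v, k)) fcoef_mon.
  by case: (eqVneq (v, k) t') => // _; rewrite eqxx.
apply: (Jset_tmul hW) => //; first exact: ltnW.
by right; right.
Qed.

Lemma free_hom_row1 (k : 'I_m) : free_hom d (d k) (row k (1%:M : 'M[S]_m)).
Proof.
move=> j u; rewrite !mxE; case: eqP => [->|_]; last by rewrite msupp0.
by rewrite msupp1 inE => /eqP ->; rewrite mdeg0 add0r.
Qed.

Definition gaut1 : gaut K n d :=
  GAut (unitmx1 K n) (unitmx1 S m) free_hom_row1.

Lemma gaut1_act f : gaut_act gaut1 f = f.
Proof.
by rewrite gaut_actE mulmx1; apply/rowP => j; rewrite mxE /= lsubst1.
Qed.

(** In the coordinates of g the form is the variable j, so this is the monomial computation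
    [IsetS]. *)
Lemma add_mult_premono g i (j : 'I_n) f : (j + i.+1)%N = n ->
  add_mult (premono g (Jset W i)) (lform (invmx (gvar g)) j) f <->
  premono g (Iset W i.+1) f.
Proof.
move=> ji.
have E h : gaut_act g (lform (invmx (gvar g)) j *: h) = 'X_j *: gaut_act g h.
  by rewrite gaut_actZ lsubst_lform (mulVmx (gvar_unit g)) lform1.
have gaut_actB f1 f2 : gaut_act g (f1 - f2) = gaut_act g f1 - gaut_act g f2.
  by rewrite gaut_actD -scaleN1r gaut_actZ rmorphN1 scaleN1r.
split=> [[h hh] t ht|hf].
  apply/(IsetS W ji).
  case: (eqVneq (fcoef ('X_j *: gaut_act g h) t) 0) => [z|/fcoefX_neq0 [t' -> _]].
    by right; apply: hh; rewrite gaut_actB E fcoefB z subr0.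
  by left; rewrite mnmDE mnm1E eqxx.
pose Q : pred mon := fun t => (0 < t.1 j)%N.
have [h Eh] : exists h, fpart Q (gaut_act g f) = 'X_j *: h.
  apply: fdivX => t; rewrite fcoef_fpart lep1mP /Q; case: ifP; rewrite ?eqxx //.
  by rewrite lt0n.
exists (ginv g h) => t; rewrite gaut_actB E ginvK -Eh fcoefB fcoef_fpart.
case: (boolP (Q t)) => [_|nQ]; first by rewrite subrr eqxx.
rewrite subr0 => /hf /(IsetS W ji) [Qt|//].
by rewrite /Q Qt in nQ.
Qed.

Variables (sdeg : gmodule K n -> nat) (Hsdeg : smallest_extended_degree sdeg).

(** The induction keeps the rows before n - i equal to those of the identity, so the variables not
    yet cut are left alone. *)
Lemma sdeg_monomial (l : nat -> nat) : (forall i, (i <= n)%N -> card_JI W i (l i)) ->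
  sv (d := d) sdeg W (\sum_(i < n.+1) l i)%N.
Proof.
move=> hl.
have gI g i : (i <= n)%N -> graded_submodule (premono g (Iset W i)).
  move=> ni; exact: (premono_graded g (fun u t => @Iset_tmul K n m W hW i u t ni)).
have gJ g i : (i <= n)%N -> graded_submodule (premono g (Jset W i)).
  move=> ni; exact: (premono_graded g (fun u t => @Jset_tmul K n m W hW i u t ni)).
have step g i s : (i <= n)%N -> sv sdeg (premono g (Jset W i)) s ->
    sv sdeg (premono g (Iset W i)) (s + l i)%N.
  move=> ni hs; have [w [uw <- hw]] := hl i ni.
  apply: (sv_msat Hsdeg (gI g i ni)); last by rewrite (msat_premono g ni (hl i ni)).
  apply: (length_msat (gaut_act_is_coef g) (@frank_inj n m d) (graded_sub_submodule (gI g i ni)) uw).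
  move=> t; rewrite hw (msat_premono g ni (hl i ni)).
  have E1 := IN_premono g (Jset W i) t; have E2 := IN_premono g (Iset W i) t.
  by rewrite -E1 -E2.
suff H i : (i <= n)%N -> exists g, [/\ gbas g = 1%:M,
    forall a b : 'I_n, (a < n - i)%N -> invmx (gvar g) a b = (a == b)%:R
  & forall s, sv sdeg (premono g (Iset W i)) s -> sv (d := d) sdeg W (s + \sum_(i' < i) l i')%N].
  have [g [_ _ hsv]] := H n (leqnn n).
  rewrite big_ord_recr /= addnC; apply: hsv; rewrite -[l n]add0n.
  apply: step => //; apply: (sv_full Hsdeg) => f t _; exact: Jset_last.
elim: i => [_|i IH lt].
  exists gaut1; split=> //= [a b _|s hs]; first by rewrite invmx1 mxE.
  rewrite big_ord0 addn0; apply: sv_ext hs => f; rewrite /premono gaut1_act.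
  split=> [h|/mW h t /h Wt]; last by right.
  apply: (subspace_Mono (subspace_full hW)) => t /h [[a [ha _]]|//].
  by move: ha; rewrite subn0 leqNgt ltn_ord.
have [g [g1 rowsid hsv]] := IH (ltnW lt); have [j ji] := ord_of_step lt.
have ni := ltnW lt; pose T := premono g (Jset W i).
have hT := graded_sub_submodule (gJ g i ni).
have hsat f : msat (premono g (Jset W i)) f -> premono g (Jset W i) f.
  rewrite -(msat_premono g ni (hl i ni)); apply: msat_idem.
  exact/graded_sub_submodule/gI.
have [O hO svT] := sv_add_mult Hsdeg (gJ g i ni).
(* Here no open condition is imposed on g, so the constant 1 takes the place of the function h. *)
have h1 : polynomial_function (@gaut_coord K n m d) (fun=> 1).
  exists 0%N, (fun k : 'I_0 => match k with Ordinal a b => inl (j, j) end), 1 => x.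
  by rewrite meval1.
have [g' [_ rows [y Oy Ey] reg g'1]] := generic_row HK hT hsat hO j (g := g) h1 (oner_neq0 _).
have rowsid1 (a b : 'I_n) : (a < j)%N -> invmx (gvar g) a b = (a == b)%:R.
  by move=> aj; apply: rowsid; move: ji; lia.
have rowsid2 (a b : 'I_n) : (a < j)%N -> invmx (gvar g') a b = (a == b)%:R.
  by move=> aj; rewrite rows ?rowsid1 //; apply: contraTneq aj => ->; rewrite ltnn.
have {}g'1 : gbas g' = 1%:M by rewrite g'1.
(* The form was chosen for the module in the coordinates of g; the cut is computed in those of g',
   so the two modules have to agree. *)
have ET : premono g (Jset W i) = premono g' (Jset W i).
  apply: functional_extensionality => f; apply: propositional_extensionality; split.
    exact: (premono_Jset_sub ji g1 g'1 rows rowsid1).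
  apply: (premono_Jset_sub ji g'1 g1 _ rowsid2) => a b aj; exact/esym/rows.
exists g'; split=> //.
  by move=> a b ha; apply: rowsid2; move: ji ha; lia.
move=> s hs; rewrite big_ord_recr /= addnA addnAC; apply: hsv; apply: step => //.
apply: (svT y Oy); first by rewrite Ey.
rewrite Ey ET; apply: sv_ext hs => f.
by split=> /(add_mult_premono g' f ji).
Qed.

End MonomialChain.

(** * Generic initial modules in terms of initial monomials *)

Section Gin.
Local Open Scope ring_scope.
Variables (K : fieldType) (n m : nat) (d : 'I_m -> int).
Local Notation F := 'rV[{mpoly K[n]}]_m.

Lemma monomial_Mono (W : F -> Prop) : monomial_submodule W ->
  submodule full W /\ forall f, W f -> Mono (fun t => W (fmon K t)) f.
Proof.
move=> [G hG]; split.
  apply: (submodule_ext (T := Defs.span full (fmon_set G : F -> Prop))).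
    by move=> f; split=> /hG.
  exact: span_submodule.
move=> f /hG /(span_fmonP _ _ (@full_subpoly K n)) hf t /hf h.
by apply/hG/(span_fmonP _ _ (@full_subpoly K n))/Mono_fmon.
Qed.

Lemma is_initial_inm (f : F) t :
  is_initial_monomial d f t <-> inm (@fcoef K n m) (frank d) f t.
Proof. by split=> -[h1 h2]; split=> // t' h3 h4; apply/frank_lt/h2. Qed.

(** The set of initial monomials of a submodule is closed under multiplication, so taking the span
    adds no monomial. *)
Lemma gin_IN (U W : gfree K n d -> Prop) (g : gaut K n d) : graded_submodule U ->
  (forall f, W f <-> initial_module d (fun y => exists2 x, U x & y = gaut_act g x) f) ->
  forall t, IN (@fcoef K n m) (frank d) (gim g U) t <-> W (fmon K t).
Proof.
move=> gU hW t; rewrite hW /initial_module (span_fmonP _ _ (@full_subpoly K n)) Mono_fmon.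
have hU := gim_submodule g (graded_sub_submodule gU).
split=> [[f Uf ft]|[u [s [_ [f [x Ux Ef] fs] ->]]]].
  exists 0%MM, t; rewrite tmul0; split=> // [a _|]; first exact: mnm0E.
  exists f; last exact/is_initial_inm.
  by exists (ginv g f); rewrite ?ginvK.
exists ('X_[u] *: f); last exact/inm_mulX/is_initial_inm.
by case: hU => _ _; apply=> //; rewrite /gim Ef gactK.
Qed.

End Gin.

Theorem mainTheorem10 (K : fieldType) (HK : infinite_field K) (n : nat)
    (sdeg : gmodule K n -> nat) (Hsdeg : smallest_extended_degree sdeg)
    (m : nat) (d : 'I_m -> int)
    (U : gfree K n d -> Prop) (HU : graded_submodule U)
    (M : gmodule K n) (HM : is_quotient U M)
    (W : gfree K n d -> Prop) (HW : is_gin d U W)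
    (G : 'I_n.+1 -> fmonomial n m -> Prop)
    (HG : forall i : 'I_n.+1,
        minimal_monomial_generators (G i) (colon_seq W i)) :
  exists l : 'I_n.+1 -> nat,
    [/\ forall i : 'I_n.+1,
          length_is (subpoly (n - i)) (restricted_span K (n - i) (G i))
            (restricted_sat K (n - i) (G i)) (l i),
        forall N : gmodule K n, is_quotient W N ->
          sdeg N = (\sum_(i < n.+1) l i)%N
      & sdeg M = (\sum_(i < n.+1) l i)%N].
Proof.
case: HW => monoW [O hO ginO]; have [hW mW] := monomial_Mono monoW.
have hUW g Og := gin_IN HU (ginO g Og).
have [l [hl svU]] := sdeg_chain_gin HK Hsdeg HU hO hUW.
exists (fun i : 'I_n.+1 => l i); split.
- move=> i; have ni : (i <= n)%N by rewrite -ltnS ltn_ord.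
  exact: (length_restricted hW ni (hl i ni) (HG i)).
- exact: (sdeg_monomial HK hW mW Hsdeg hl).
- exact: svU.
Qed.
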